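(* Let $\alpha>0$ and $\gamma>0$. If $0<\alpha<1$ and $f\in L_1(\mathbb{R}_+;x^{-\gamma}dx)$, then the fractional Kontorovich-Lebedev transform $F_\alpha f$ is the Kontorovich-Lebedev transform of $G_\alpha f$, i.e. for $\tau\in\mathbb{R}$ $$(F_\alpha f)(\tau)=(F\,G_\alpha f)(\tau)=\int_0^\infty K_{i\tau}(x)\,(G_\alpha f)(x)\,dx ,$$ where the integral converges absolutely. The result is valid as well under the conditions $0<\alpha\le1$ and $$f^*(1-s)\in L_2(\gamma-i\infty,\gamma+i\infty).$$ Under the condition $$\frac{\Gamma(s)}{\Gamma(\alpha s)}f^*(1-s)\in L_1(\gamma-i\infty,\gamma+i\infty)$$ or the condition $$\frac{\Gamma(s)}{\Gamma(\alpha s)}f^*(1-s)\in L_2(\gamma-i\infty,\gamma+i\infty)$$ the result is valid for all $\alpha>0$.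
   Context: For $\alpha>0$, $\nu\in\mathbb{C}$, ${\rm Re}(z)>0$: $K_{\alpha,\nu}(z)=\int_0^\infty e^{-z\cosh^\alpha u}\cosh(\nu u)\,du$, and $K_\nu=K_{1,\nu}$ is the Macdonald function. The fractional Kontorovich-Lebedev transform is $$(F_\alpha f)(\tau)=\int_0^\infty K_{\alpha,i\tau}(x)f(x)\,dx ,$$ and $F=F_1$, i.e. $(Ff)(\tau)=\int_0^\infty K_{i\tau}(x)f(x)\,dx$, is the Kontorovich-Lebedev transform. The Mellin transform of $f$ on $\mathbb{R}_+$ is $f^*(s)=\int_0^\infty f(t)t^{s-1}dt$; on the line ${\rm Re}(s)=1-\gamma$ it is understood either as an absolutely convergent integral (when $f\in L_1(\mathbb{R}_+;x^{-\gamma}dx)$) or in the mean square sense (when $f\in L_2(\mathbb{R}_+;x^{1-2\gamma}dx)$); $f$ is assumed to have a Mellin transform in one of these senses. The operator $G_\alpha$: for $0<\alpha<1$ and $f\in L_1(\mathbb{R}_+;x^{-\gamma}dx)$, $$(G_\alpha f)(x)=\frac1x\int_0^\infty\Phi_\alpha\left(\frac{t}{x^\alpha}\right)f(t)\,dt,\qquad \Phi_\alpha(x)=\frac{1}{2\pi i}\int_{\gamma-i\infty}^{\gamma+i\infty}\frac{\Gamma(s)}{\Gamma(\alpha s)}x^{-s}\,ds ,\quad x>0,$$ which equals $$(G_\alpha f)(x)=\frac{1}{2\pi i}\int_{\gamma-i\infty}^{\gamma+i\infty}\frac{\Gamma(s)}{\Gamma(\alpha s)}\,f^*(1-s)\,x^{\alpha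 s-1}\,ds .$$ In the remaining cases (any $\alpha>0$) $G_\alpha f$ is defined by this last formula, the integral being absolutely convergent if the quotient times $f^*(1-s)$ is in $L_1$ on the line, and understood in the mean square sense (limit in $L_2(\mathbb{R}_+;x^{1-2\alpha\gamma}dx)$ of the integrals over $[\gamma-iT,\gamma+iT]$ as $T\to\infty$) if it is in $L_2$ on the line. In particular $G_1f=f$. *)

(* Defs.v *)
From HB Require Import structures.
From mathcomp Require Import all_boot all_order all_algebra.
From mathcomp Require Import complex.
From mathcomp Require Import all_classical all_reals all_analysis.

Set Implicit Arguments.
Unset Strict Implicit.
Unset Printing Implicit Defensive.

Import Order.TTheory GRing.Theory Num.Theory.
Import numFieldNormedType.Exports.

Local Open Scope classical_set_scope.
Local Open Scope ring_scope.
Local Open Scope complex_scope.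

Section complex_lebesgue.
Variable R : realType.
Implicit Types (D : set R) (w : R -> R) (f g : R -> R[i]).

Local Notation mu := (@lebesgue_measure R).

Definition Rplus : set R := `]0, +oo[.

Definition cmeasurable D f : Prop :=
  measurable_fun D (fun x => complex.Re (f x)) /\
  measurable_fun D (fun x => complex.Im (f x)).

Definition cintegrable D f : Prop :=
  mu.-integrable D (fun x => (complex.Re (f x))%:E) /\
  mu.-integrable D (fun x => (complex.Im (f x))%:E).

Definition cintegral D f : R[i] :=
  (\int[mu]_(x in D) complex.Re (f x))%R +i*
  (\int[mu]_(x in D) complex.Im (f x))%R.

(* Squared norm of f in the space L_2(D; w(x) dx). *)
Definition sqnorm D w f : \bar R :=
  (\int[mu]_(x in D) (w x * Normc.normc (f x) ^+ 2)%:E)%E.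

Definition in_L1 D w f : Prop := cintegrable D (fun x => (w x)%:C * f x).

Definition in_L2 D w f : Prop := cmeasurable D f /\ (sqnorm D w f < +oo)%E.

(* g is the limit in L_2(D; w(x) dx) of the family fT as T -> +oo. *)
Definition mean_square_limit D w (fT : R -> R -> R[i]) g : Prop :=
  in_L2 D w g /\
  sqnorm D w (fun x => fT T x - g x) @[T --> +oo] --> 0%E.

End complex_lebesgue.

Section special_functions.
Variable R : realType.
Implicit Types (s z nu : R[i]) (c t u y alpha : R).

Definition cexp z : R[i] :=
  (expR (complex.Re z))%:C * (cos (complex.Im z) +i* sin (complex.Im z)).

Definition ccosh z : R[i] := (cexp z + cexp (- z)) / 2%:R.

Definition cosh u : R := (expR u + expR (- u)) / 2%:R.

(* t^s for t > 0, with the real logarithm of t. *)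
Definition cpow t s : R[i] := cexp (s * (ln t)%:C).

(* Euler's integral; meaningful for Re s > 0, the only range where it is used. *)
Definition Gamma s : R[i] :=
  cintegral (@Rplus R) (fun t => (expR (- t))%:C * cpow t (s - 1)).

Definition K alpha nu z : R[i] :=
  cintegral (@Rplus R)
    (fun u => cexp (- z * (cosh u `^ alpha)%:C) * ccosh (nu * u%:C)).

Definition vline c y : R[i] := c +i* y.

(* (2 pi i)^-1 times the integral of h(s) ds along s = c + i y, y in D;
   the factor i of ds = i dy cancels the one of the denominator. *)
Definition vline_integral c (D : set R) (h : R[i] -> R[i]) : R[i] :=
  ((2%:R * pi)^-1)%:C * cintegral D (fun y => h (vline c y)).

(* Membership in L_1 and L_2 of the whole line Re s = c. *)
Definition vline_L1 c (h : R[i] -> R[i]) : Prop :=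
  in_L1 [set: R] (fun=> 1) (fun y => h (vline c y)).

Definition vline_L2 c (h : R[i] -> R[i]) : Prop :=
  in_L2 [set: R] (fun=> 1) (fun y => h (vline c y)).

End special_functions.

Section transforms.
Variable R : realType.
Implicit Types (f g : R -> R[i]) (fs : R[i] -> R[i]) (alpha gamma tau x y : R).

(* F_alpha; the Kontorovich-Lebedev transform F is FKL 1. *)
Definition FKL alpha f tau : R[i] :=
  cintegral (@Rplus R) (fun x => K alpha (0 +i* tau) x%:C * f x).

Definition mellin_on (D : set R) f (s : R[i]) : R[i] :=
  cintegral D (fun t => f t * cpow t (s - 1)).

(* fs is the Mellin transform of f on the line Re s = 1 - gamma, either as an
   absolutely convergent integral or as the L_2-limit of the integrals over
   [1/N, N]; only the values of fs on that line matter. *)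
Definition is_mellin gamma f fs : Prop :=
  (in_L1 (@Rplus R) (fun x => x `^ (- gamma)) f /\
   forall y, fs (vline (1 - gamma) y) =
             mellin_on (@Rplus R) f (vline (1 - gamma) y))
  \/
  (in_L2 (@Rplus R) (fun x => x `^ (1 - 2%:R * gamma)) f /\
   mean_square_limit [set: R] (fun=> 1)
     (fun N y => mellin_on `[N^-1, N] f (vline (1 - gamma) y))
     (fun y => fs (vline (1 - gamma) y))).

Definition Gamma_ratio alpha (s : R[i]) : R[i] :=
  Gamma s / Gamma (alpha%:C * s).

Definition Phi alpha gamma x : R[i] :=
  vline_integral gamma [set: R] (fun s => Gamma_ratio alpha s * cpow x (- s)).

Definition G_kernel alpha gamma f x : R[i] :=
  (x^-1)%:C *
  cintegral (@Rplus R) (fun t => Phi alpha gamma (t / x `^ alpha) * f t).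

(* D is the set of the ordinates y of the points gamma + i y of the contour. *)
Definition G_mellin_on alpha gamma (D : set R) fs x : R[i] :=
  vline_integral gamma D
    (fun s => Gamma_ratio alpha s * fs (1 - s) * cpow x (alpha%:C * s - 1)).

(* g is (a version of) G_alpha f on the positive half-line. The mean square
   definition determines g only almost everywhere, hence a relation; when
   several clauses apply they agree almost everywhere. *)
Definition is_G alpha gamma f g : Prop :=
  [\/ [/\ 0 < alpha < 1,
          in_L1 (@Rplus R) (fun x => x `^ (- gamma)) f
        & forall x, 0 < x -> g x = G_kernel alpha gamma f x],
      exists fs, [/\ is_mellin gamma f fs,
          vline_L1 gamma (fun s => Gamma_ratio alpha s * fs (1 - s))
        & forall x, 0 < x -> g x = G_mellin_on alpha gamma [set: R] fs x]
    | exists fs, [/\ is_mellin gamma f fs,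
          vline_L2 gamma (fun s => Gamma_ratio alpha s * fs (1 - s))
        & mean_square_limit (@Rplus R)
            (fun x => x `^ (1 - 2%:R * alpha * gamma))
            (fun T => G_mellin_on alpha gamma `[- T, T] fs) g]].

End transforms.

(* Main.v *)
Require Import Defs.
From HB Require Import structures.
From mathcomp Require Import all_boot all_order all_algebra.
From mathcomp Require Import complex.
From mathcomp Require Import all_classical all_reals all_analysis.
From mathcomp Require Import measurable_realfun.
From mathcomp Require Import ring lra.

Set Implicit Arguments.
Unset Strict Implicit.
Unset Printing Implicit Defensive.

Import Order.TTheory GRing.Theory Num.Theory.
Import numFieldNormedType.Exports.

Local Open Scope classical_set_scope.
Local Open Scope ring_scope.
Local Open Scope complex_scope.

(** For [s = gamma + i y] one has the Mellin inversion
    [2 pi K_{alpha,i tau}(x) = int Gamma(s) C(alpha s) x^{-s} dy], where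
    [C(z) = int_0^oo cos(tau u) cosh(u)^{-z} du]; it follows from the
    Cahen-Mellin integral [2 pi e^{-x} = int Gamma(s) x^{-s} dy] by Fubini.  Hence
    [2 pi int K_{alpha,i tau} f = int Gamma(s) C(alpha s) f^*(1 - s) dy].  Since
    the Mellin transform of [K_{i tau}] at [alpha s] is
    [Gamma(alpha s) C(alpha s)], integrating [K_{i tau}] against the contour
    integral of [Gamma(s) / Gamma(alpha s) f^*(1 - s) x^{alpha s - 1}] gives the
    same value.  The [L_2] cases are limits of truncated integrals, taken with
    the Cauchy-Schwarz inequality in weighted [L_2] spaces.  The mean square
    limit defining [G_alpha f] exists by completeness of [L_2] and the Bessel
    inequality for [int h(y) x^{i alpha y} dy], which is proved with the
    regularizing factor [min(x, 1/x)^e], whose Mellin transform is the Poisson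
    kernel.  All bounds on [Gamma(s)] and [Gamma(s) / Gamma(alpha s)] come from
    comparing [|Gamma(sigma + i y)|^2 / Gamma(sigma)^2] with the product of
    [(1 + y^2 / (sigma + k)^2)^{-1}] over [k]. *)

(** * Complex numbers and measurability *)

(** Both sides become integrals over y of one density [K_Mellin]: the factor Gamma(alpha s) produced
    by the Mellin transform of K_{i tau} cancels the denominator of the quotient that defines
    G_alpha. This density is integrable and square integrable for every alpha > 0, so the side of
    F_alpha f is governed by the Mellin transform of f, and the listed conditions give G_alpha f a
    meaning. For alpha <= 1 the quotient is bounded, for alpha < 1 it decays like y^{-2}; this
    reduces the conditions on f alone to conditions on the product. A mean square limit cannot be
    exchanged with an integral by Fubini. Each L_2 argument therefore proves the identity for
    truncations, where everything converges absolutely, and passes to the limit by continuity of the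
    pairing of L_2(w dx) with L_2(w^{-1} dx). K lies in every L_2(x^{p - 1} dx) with p > 0, in
    particular in the duals of the spaces that contain f and G_alpha f. Since a mean square limit is
    determined only almost everywhere, the identity is proved for every admissible g, and the
    existence of such a g is a separate question. *)

Notation Cre := complex.Re.
Notation Cim := complex.Im.
Notation nrm := Normc.normc.

Section complex_algebra.
Variable R : realType.
Implicit Types (z w s : R[i]) (x y t : R).

Lemma nrm_ge0 z : 0 <= nrm z.
Proof. by case: z => a b; exact: sqrtr_ge0. Qed.

Lemma nrm0 : nrm (0 : R[i]) = 0. Proof. exact: Normc.normc0. Qed.

Lemma nrmM z w : nrm (z * w) = nrm z * nrm w.
Proof. exact: Normc.normcM. Qed.

Lemma nrmD z w : nrm (z + w) <= nrm z + nrm w.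
Proof. exact: le_normcD. Qed.

Lemma nrmN z : nrm (- z) = nrm z.
Proof. exact: normcN. Qed.

Lemma nrm_real x : nrm x%:C = `|x|.
Proof. by rewrite /= expr0n addr0 sqrtr_sqr. Qed.

Lemma nrm_sqr z : nrm z ^+ 2 = Cre z ^+ 2 + Cim z ^+ 2.
Proof. by case: z => a b /=; rewrite sqr_sqrtr// addr_ge0// sqr_ge0. Qed.

Lemma nrm_eq0 z : (nrm z == 0) = (z == 0).
Proof.
apply/eqP/eqP => [|->]; [exact: Normc.eq0_normc|exact: nrm0].
Qed.

Lemma nrmV z : nrm z^-1 = (nrm z)^-1.
Proof. exact: Normc.normcV. Qed.

Lemma le_Re_nrm z : `|Cre z| <= nrm z.
Proof.
rewrite -(@ler_pXn2r _ 2)// ?nnegrE ?nrm_ge0//.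
by rewrite nrm_sqr real_normK ?num_real// lerDl sqr_ge0.
Qed.

Lemma le_Im_nrm z : `|Cim z| <= nrm z.
Proof.
rewrite -(@ler_pXn2r _ 2)// ?nnegrE ?nrm_ge0//.
by rewrite nrm_sqr real_normK ?num_real// lerDr sqr_ge0.
Qed.

Lemma le_nrm_ReIm z : nrm z <= `|Cre z| + `|Cim z|.
Proof.
rewrite -(@ler_pXn2r _ 2)// ?nnegrE ?nrm_ge0 ?addr_ge0//.
rewrite nrm_sqr sqrrD !real_normK ?num_real// lerD2r lerDl.
by rewrite mulrn_wge0// mulr_ge0.
Qed.

Lemma ReM z w : Cre (z * w) = Cre z * Cre w - Cim z * Cim w.
Proof. by case: z w => [a b] [c d]. Qed.

Lemma ImM z w : Cim (z * w) = Cre z * Cim w + Cim z * Cre w.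
Proof. by case: z w => [a b] [c d]. Qed.

Lemma ReD z w : Cre (z + w) = Cre z + Cre w.
Proof. by case: z w => [a b] [c d]. Qed.

Lemma ImD z w : Cim (z + w) = Cim z + Cim w.
Proof. by case: z w => [a b] [c d]. Qed.

Lemma ReN z : Cre (- z) = - Cre z. Proof. by case: z. Qed.

Lemma ImN z : Cim (- z) = - Cim z. Proof. by case: z. Qed.

Lemma Re_realM x z : Cre (x%:C * z) = x * Cre z.
Proof. by rewrite ReM /= mul0r subr0. Qed.

Lemma Im_realM x z : Cim (x%:C * z) = x * Cim z.
Proof. by rewrite ImM /= mul0r addr0. Qed.

Lemma Re_Mreal x z : Cre (z * x%:C) = Cre z * x.
Proof. by rewrite ReM /= mulr0 subr0. Qed.

Lemma Im_Mreal x z : Cim (z * x%:C) = Cim z * x.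
Proof. by rewrite ImM /= mulr0 add0r. Qed.

Lemma complex_eq z w : Cre z = Cre w -> Cim z = Cim w -> z = w.
Proof. by case: z w => [a b] [c d] /= -> ->. Qed.

Lemma realcM x y : (x * y)%:C = x%:C * y%:C :> R[i].
Proof. exact: rmorphM. Qed.

Lemma realcD x y : (x + y)%:C = x%:C + y%:C :> R[i].
Proof. exact: rmorphD. Qed.

Lemma realcV x : (x^-1)%:C = x%:C^-1 :> R[i].
Proof. exact: fmorphV. Qed.

Lemma realc_neq0 x : x != 0 -> x%:C != 0 :> R[i].
Proof. by move=> x0; rewrite eq_complex /= negb_and x0. Qed.

Lemma cexpD z w : cexp (z + w) = cexp z * cexp w.
Proof.
rewrite /cexp ReD ImD expRD realcM cosD sinD.
case: z w => [a b] [c d] /=; apply: complex_eq => /=; ring.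
Qed.

Lemma nrm_cexp z : nrm (cexp z) = expR (Cre z).
Proof.
rewrite /cexp nrmM nrm_real ger0_norm ?expR_ge0//= cos2Dsin2 sqrtr1 mulr1//.
Qed.

Lemma cexp_real x : cexp x%:C = (expR x)%:C.
Proof. by rewrite /cexp /= cos0 sin0 complexr0 mulr1. Qed.

Lemma cpow_Re x s : cpow x s =
  (expR (Cre s * ln x))%:C * (cos (Cim s * ln x) +i* sin (Cim s * ln x)).
Proof. by rewrite /cpow /cexp Re_Mreal Im_Mreal. Qed.

Lemma nrm_cpow x s : 0 < x -> nrm (cpow x s) = x `^ Cre s.
Proof. by move=> x0; rewrite nrm_cexp Re_Mreal /powR gt_eqF. Qed.

Lemma cpowD x s w : cpow x (s + w) = cpow x s * cpow x w.
Proof. by rewrite /cpow mulrDl cexpD. Qed.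

Lemma cpow_real x y : 0 < x -> cpow x y%:C = (x `^ y)%:C.
Proof. by move=> x0; rewrite /cpow -realcM cexp_real /powR gt_eqF. Qed.

Lemma cpow1 s : cpow (1 : R) s = 1.
Proof. by rewrite /cpow ln1 mulr0 (cexp_real 0) expR0. Qed.

Lemma cpow0 x : cpow x 0 = 1.
Proof. by rewrite /cpow mul0r (cexp_real 0) expR0. Qed.

Lemma cpowM x y s : 0 < x -> 0 < y -> cpow (x * y) s = cpow x s * cpow y s.
Proof.
by move=> x0 y0; rewrite /cpow lnM ?posrE// realcD mulrDr cexpD.
Qed.

Lemma cpow_neq0 x s : cpow x s != 0.
Proof.
have h : cpow x (- s) * cpow x s = 1 by rewrite -cpowD addNr cpow0.
by apply: contra_eq_neq h => ->; rewrite mulr0 eq_sym oner_neq0.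
Qed.

Lemma cpowN x s : cpow x (- s) = (cpow x s)^-1.
Proof.
apply: (mulIf (cpow_neq0 x s)).
by rewrite -cpowD addNr cpow0 mulVf// cpow_neq0.
Qed.

Lemma cpow_powR x y s : cpow (x `^ y) s = cpow x (y%:C * s).
Proof. by rewrite /cpow ln_powR realcM mulrA (mulrC s). Qed.

End complex_algebra.

Section complex_measurability.
Context d (T : measurableType d) (R : realType).
Implicit Types (D : set T) (f g : T -> R[i]) (h : T -> R).

(* [cmeasurable] over an arbitrary measurable space, as needed on products. *)
Definition cmeas D f := measurable_fun D (fun x => Cre (f x)) /\
  measurable_fun D (fun x => Cim (f x)).

Lemma cmeasM D f g : cmeas D f -> cmeas D g -> cmeas D (fun x => f x * g x).
Proof.
move=> [f1 f2] [g1 g2]; split.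
- under eq_fun do rewrite ReM.
  by apply: measurable_funB; apply: measurable_funM.
- under eq_fun do rewrite ImM.
  by apply: measurable_funD; apply: measurable_funM.
Qed.

Lemma cmeasD D f g : cmeas D f -> cmeas D g -> cmeas D (fun x => f x + g x).
Proof.
move=> [f1 f2] [g1 g2]; split.
- by under eq_fun do rewrite ReD; apply: measurable_funD.
- by under eq_fun do rewrite ImD; apply: measurable_funD.
Qed.

Lemma cmeasN D f : cmeas D f -> cmeas D (fun x => - f x).
Proof.
move=> [f1 f2]; split.
- by under eq_fun do rewrite ReN; exact: measurableT_comp.
- by under eq_fun do rewrite ImN; exact: measurableT_comp.
Qed.

Lemma cmeasB D f g : cmeas D f -> cmeas D g -> cmeas D (fun x => f x - g x).
Proof. by move=> mf mg; apply: cmeasD => //; exact: cmeasN. Qed.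

Lemma cmeas_cst D z : cmeas D (fun=> z).
Proof. by split; exact: measurable_cst. Qed.

Lemma cmeas_real D h : measurable_fun D h -> cmeas D (fun x => (h x)%:C).
Proof. by move=> mh; split => //; exact: measurable_cst. Qed.

Lemma cmeas_Complex D h k : measurable_fun D h -> measurable_fun D k ->
  cmeas D (fun x => h x +i* k x).
Proof. by []. Qed.

Lemma cmeas_cexp D f : cmeas D f -> cmeas D (fun x => cexp (f x)).
Proof.
move=> [f1 f2]; rewrite /cexp; apply: cmeasM.
  by apply: cmeas_real; exact: measurableT_comp.
by apply: cmeas_Complex; apply: measurableT_comp => //; apply: continuous_measurable_fun;
  [exact: continuous_cos|exact: continuous_sin].
Qed.

Lemma cmeas_cpow D h f : measurable_fun D h -> cmeas D f ->
  cmeas D (fun x => cpow (h x) (f x)).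
Proof.
move=> mh mf; apply: cmeas_cexp; apply: cmeasM => //.
by apply: cmeas_real; exact: measurableT_comp.
Qed.

Lemma measurable_nrm D f : cmeas D f -> measurable_fun D (fun x => nrm (f x)).
Proof.
move=> [f1 f2]; rewrite (_ : (fun _ => _) =
    (fun x => Num.sqrt (Cre (f x) ^+ 2 + Cim (f x) ^+ 2))); last first.
  by apply/funext => x; case: (f x).
apply: measurableT_comp.
  by apply: continuous_measurable_fun; exact: sqrt_continuous.
by apply: measurable_funD; apply: measurable_funX.
Qed.

Lemma cmeas_sub D E f : measurable D -> E `<=` D -> cmeas D f -> cmeas E f.
Proof.
move=> mD ED [f1 f2]; split; exact: measurable_funS ED _.
Qed.

Lemma eq_cmeas D f g : (forall x, D x -> f x = g x) -> cmeas D f -> cmeas D g.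
Proof.
move=> fg [f1 f2]; split; [apply: eq_measurable_fun f1|apply: eq_measurable_fun f2];
  by move=> x; rewrite inE => /fg ->.
Qed.

End complex_measurability.

Lemma cmeas_comp d1 d2 (T1 : measurableType d1) (T2 : measurableType d2)
    (R : realType) (D : set T2) (E : set T1) (f : T2 -> R[i]) (p : T1 -> T2) :
  measurable D -> (forall x, E x -> D (p x)) -> measurable_fun E p ->
  cmeas D f -> cmeas E (fun x => f (p x)).
Proof.
move=> mD EDp mp [f1 f2]; have Ep : p @` E `<=` D by move=> _ [x Ex <-]; exact: EDp.
by split; [apply: (measurable_comp mD Ep f1)|apply: (measurable_comp mD Ep f2)].
Qed.

(** * Complex integrals *)

Section complex_integral.
Variable R : realType.
Local Notation mu := (@lebesgue_measure R).
Local Notation T := (measurableTypeR R).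
Implicit Types (D E : set T) (f g : T -> R[i]) (h k : T -> R).

Lemma measurable_Rplus : measurable (@Rplus R : set T).
Proof. exact: measurable_itv. Qed.

Lemma RplusE x : @Rplus R x = (0 < x).
Proof. by rewrite /Rplus /= in_itv/= andbT. Qed.

Lemma cintegrable_cmeas D f : cintegrable D f -> cmeas D f.
Proof.
by move=> [i1 i2]; split; apply/measurable_EFinP; [exact: measurable_int i1|exact: measurable_int i2].
Qed.

Lemma cintegrable_le D f h : measurable D -> cmeas D f ->
  (forall x, D x -> nrm (f x) <= h x) -> mu.-integrable D (EFin \o h) ->
  cintegrable D f.
Proof.
move=> mD [f1 f2] fh ih; split; apply: (le_integrable mD _ _ ih).
- exact/measurable_EFinP.
- move=> x Dx /=; rewrite lee_fin; apply: le_trans (le_Re_nrm _) _.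
  by apply: le_trans (fh _ Dx) _; exact: ler_norm.
- exact/measurable_EFinP.
- move=> x Dx /=; rewrite lee_fin; apply: le_trans (le_Im_nrm _) _.
  by apply: le_trans (fh _ Dx) _; exact: ler_norm.
Qed.

Lemma cintegrable_nrm D f : measurable D -> cintegrable D f ->
  mu.-integrable D (fun x => (nrm (f x))%:E).
Proof.
move=> mD [i1 i2].
have mf := cintegrable_cmeas (conj i1 i2).
apply: (le_integrable mD _ _ (integrableD mD (integrable_norm i1) (integrable_norm i2))).
  by apply/measurable_EFinP; exact: measurable_nrm.
move=> x Dx /=; rewrite lee_fin (ger0_norm (nrm_ge0 _)).
by apply: le_trans (le_nrm_ReIm _) _; exact: ler_norm.
Qed.

Lemma cintegrable_sub D E f : measurable D -> measurable E -> E `<=` D ->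
  cintegrable D f -> cintegrable E f.
Proof. by move=> mD mE ED [i1 i2]; split; exact: (integrableS mD mE ED). Qed.

Lemma eq_cintegrable D f g : measurable D -> (forall x, D x -> f x = g x) ->
  cintegrable D f -> cintegrable D g.
Proof.
move=> mD fg [i1 i2]; split; [apply: eq_integrable i1 => //|apply: eq_integrable i2 => //];
  by move=> x; rewrite inE => /fg ->.
Qed.

Lemma eq_cintegral D f g : (forall x, D x -> f x = g x) ->
  cintegral D f = cintegral D g.
Proof.
by move=> fg; congr Complex; apply: eq_Rintegral => x; rewrite inE => /fg ->.
Qed.

Lemma cintegrableD D f g : measurable D -> cintegrable D f -> cintegrable D g ->
  cintegrable D (fun x => f x + g x).
Proof.
move=> mD [f1 f2] [g1 g2]; split.
- by under eq_fun do rewrite ReD EFinD; exact: integrableD.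
- by under eq_fun do rewrite ImD EFinD; exact: integrableD.
Qed.

Lemma cintegralD D f g : measurable D -> cintegrable D f -> cintegrable D g ->
  cintegral D (fun x => f x + g x) = cintegral D f + cintegral D g.
Proof.
move=> mD [f1 f2] [g1 g2]; apply: complex_eq => /=.
- by under eq_Rintegral do rewrite ReD; rewrite RintegralD.
- by under eq_Rintegral do rewrite ImD; rewrite RintegralD.
Qed.

Lemma cintegrableZ D z f : measurable D -> cintegrable D f ->
  cintegrable D (fun x => z * f x).
Proof.
move=> mD [f1 f2]; split.
- under eq_fun do rewrite ReM EFinB !EFinM.
  by apply: integrableB => //; apply: integrableZl.
- under eq_fun do rewrite ImM EFinD !EFinM.
  by apply: integrableD => //; apply: integrableZl.
Qed.

Lemma integrable_realZ D (r : R) h : measurable D ->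
  mu.-integrable D (EFin \o h) -> mu.-integrable D (EFin \o (fun x => r * h x)).
Proof.
move=> mD ih; rewrite (_ : _ \o _ = (fun x => r%:E * (h x)%:E)%E)//.
exact: integrableZl.
Qed.

Lemma cintegralZ D z f : measurable D -> cintegrable D f ->
  cintegral D (fun x => z * f x) = z * cintegral D f.
Proof.
move=> mD [f1 f2]; apply: complex_eq => /=.
- under eq_Rintegral do rewrite ReM.
  by rewrite RintegralB ?RintegralZl ?ReM//; exact: integrable_realZ.
- under eq_Rintegral do rewrite ImM.
  by rewrite RintegralD ?RintegralZl ?ImM//; exact: integrable_realZ.
Qed.

Lemma cintegrableN D f : measurable D -> cintegrable D f ->
  cintegrable D (fun x => - f x).
Proof.
move=> mD fi; apply: (eq_cintegrable mD _ (cintegrableZ (-1) mD fi)).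
by move=> x _; rewrite mulN1r.
Qed.

Lemma cintegrableB D f g : measurable D -> cintegrable D f -> cintegrable D g ->
  cintegrable D (fun x => f x - g x).
Proof. by move=> mD fi gi; apply: cintegrableD => //; exact: cintegrableN. Qed.

Lemma cintegralB D f g : measurable D -> cintegrable D f -> cintegrable D g ->
  cintegral D (fun x => f x - g x) = cintegral D f - cintegral D g.
Proof.
move=> mD fi gi; rewrite cintegralD//; last exact: cintegrableN.
congr (_ + _); rewrite -mulN1r -cintegralZ//.
by apply: eq_cintegral => x _; rewrite mulN1r.
Qed.

Lemma cintegral_real D h : cintegral D (fun x => (h x)%:C) =
  (\int[mu]_(x in D) h x)%:C.
Proof.
apply: complex_eq => //=; rewrite /Rintegral/=.
by rewrite integral0.
Qed.

(* Rotating the integral onto the positive axis reduces the bound to the one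
   for the real part. *)
Lemma le_nrm_cintegral D f : measurable D -> cintegrable D f ->
  nrm (cintegral D f) <= \int[mu]_(x in D) nrm (f x).
Proof.
move=> mD fi; set I := cintegral D f.
have [I0|I0] := eqVneq I 0.
  by rewrite I0 nrm0; apply: Rintegral_ge0 => x _; exact: nrm_ge0.
have nI0 : nrm I != 0 by rewrite nrm_eq0.
pose z : R[i] := (nrm I)%:C / I.
have nz : nrm z = 1.
  by rewrite /z nrmM nrmV nrm_real ger0_norm ?nrm_ge0// divff.
have zI : (nrm I)%:C = cintegral D (fun x => z * f x).
  by rewrite cintegralZ// -/I /z divfK.
have -> : nrm I = \int[mu]_(x in D) Cre (z * f x).
  by rewrite -[LHS]/(Cre (nrm I)%:C) zI.
apply: le_Rintegral => //.
- exact: (cintegrableZ z mD fi).1.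
- exact: cintegrable_nrm.
- move=> x Dx; apply: le_trans (ler_norm _) _; apply: le_trans (le_Re_nrm _) _.
  by rewrite nrmM nz mul1r.
Qed.

Lemma cintegral_nrm_le D f h : measurable D -> cmeas D f ->
  (forall x, D x -> nrm (f x) <= h x) -> mu.-integrable D (EFin \o h) ->
  nrm (cintegral D f) <= \int[mu]_(x in D) h x.
Proof.
move=> mD mf fh ih; have fi := cintegrable_le mD mf fh ih.
apply: le_trans (le_nrm_cintegral mD fi) _.
by apply: le_Rintegral => //; exact: cintegrable_nrm.
Qed.

End complex_integral.

(** * Fubini's theorem under a product bound *)

Section fubini.
Variable R : realType.
Local Notation mu := (@lebesgue_measure R).
Local Notation T := (measurableTypeR R).
Implicit Types (D : set T) (a b : T -> R).

Lemma measurable_section1 D1 D2 (F : T -> T -> R) x : D1 x ->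
  measurable D1 -> measurable D2 ->
  measurable_fun (D1 `*` D2) (fun p => F p.1 p.2) -> measurable_fun D2 (F x).
Proof.
move=> D1x mD1 mD2 mF.
have -> : F x = (fun p : T * T => F p.1 p.2) \o (fun y => (x, y)) by [].
apply: (measurable_comp _ _ mF); first exact: measurableX.
  by move=> _ [y D2y <-].
by apply: measurable_funTS; exact: pair1_measurable.
Qed.

Lemma measurable_section2 D1 D2 (F : T -> T -> R) y : D2 y ->
  measurable D1 -> measurable D2 ->
  measurable_fun (D1 `*` D2) (fun p => F p.1 p.2) -> measurable_fun D1 (F^~ y).
Proof.
move=> D2y mD1 mD2 mF.
have -> : F^~ y = (fun p : T * T => F p.1 p.2) \o (fun x => (x, y)) by [].
apply: (measurable_comp _ _ mF); first exact: measurableX.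
  by move=> _ [x D1x <-].
by apply: measurable_funTS; exact: pair2_measurable.
Qed.

(** The function is extended by zero to the plane, where a majorant a(x) b(y) with both factors
    integrable verifies Tonelli's criterion. Integrability is recorded in the first variable only;
    [rfubini] gets the other one by exchanging the variables. *)
Lemma rfubini1 D1 D2 (F : T -> T -> R) a b : measurable D1 -> measurable D2 ->
  measurable_fun (D1 `*` D2) (fun p => F p.1 p.2) ->
  mu.-integrable D1 (EFin \o a) -> mu.-integrable D2 (EFin \o b) ->
  (forall x y, D1 x -> D2 y -> `|F x y| <= a x * b y) ->
  mu.-integrable D1 (fun x => (\int[mu]_(y in D2) F x y)%:E) /\
  \int[mu]_(x in D1) (\int[mu]_(y in D2) F x y) =
  \int[mu]_(y in D2) (\int[mu]_(x in D1) F x y).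
Proof.
move=> mD1 mD2 mF ia ib Fab.
have mD12 : measurable (D1 `*` D2) by exact: measurableX.
have iF x : D1 x -> mu.-integrable D2 (EFin \o F x).
  move=> D1x; apply: (le_integrable mD2 _ _ (integrable_realZ (a x) mD2 ib)).
    by apply/measurable_EFinP; exact: (measurable_section1 D1x mD1 mD2 mF).
  by move=> y D2y /=; rewrite lee_fin (le_trans (Fab _ _ D1x D2y))// ler_norm.
have iF' y : D2 y -> mu.-integrable D1 (EFin \o F^~ y).
  move=> D2y; apply: (le_integrable mD1 _ _ (integrable_realZ (b y) mD1 ia)).
    by apply/measurable_EFinP; exact: (measurable_section2 D2y mD1 mD2 mF).
  move=> x D1x /=; rewrite lee_fin (le_trans (Fab _ _ D1x D2y))// mulrC.
  exact: ler_norm.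
pose G0 : T * T -> R := (fun p => F p.1 p.2) \_ (D1 `*` D2).
pose G : T * T -> \bar R := EFin \o G0.
have mG : measurable_fun setT G.
  by apply/measurable_EFinP; apply/(measurable_restrictT _ mD12).
have G1 x : (\int[mu]_y G (x, y) =
    ((fun x => (\int[mu]_(y in D2) F x y)%:E) \_ D1) x)%E.
  rewrite patchE; case: ifPn => [|]; rewrite ?inE ?notin_setE => D1x.
    rewrite /Rintegral fineK; last exact: integrable_fin_num (iF _ D1x).
    rewrite [RHS]integral_mkcond; apply: eq_integral => y _.
    rewrite /G /G0 /= !patchE /= in_setX /=.
    by rewrite (mem_set (A := D1) D1x)/=; case: ifPn.
  apply: integral0_eq => y _; rewrite /G /G0 /= patchE in_setX /=.
  by rewrite memNset.
have G2 y : (\int[mu]_x G (x, y) =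
    ((fun y => (\int[mu]_(x in D1) F x y)%:E) \_ D2) y)%E.
  rewrite patchE; case: ifPn => [|]; rewrite ?inE ?notin_setE => D2y.
    rewrite /Rintegral fineK; last exact: integrable_fin_num (iF' _ D2y).
    rewrite [RHS]integral_mkcond; apply: eq_integral => x _.
    rewrite /G /G0 /= !patchE /= in_setX /=.
    by rewrite (mem_set (A := D2) D2y)/= andbT; case: ifPn.
  apply: integral0_eq => x _; rewrite /G /G0 /= patchE in_setX /=.
  by rewrite (memNset (A := D2) D2y) andbF.
(* Tonelli: the iterated integral of |G| is at most the product of the integrals of |a| over [D1]
   and |b| over [D2]. *)
have iG : (mu \x mu)%E.-integrable setT G.
  apply/(integrable12ltyP mu mu mG).
  pose A : T -> \bar R := (fun x => `|a x|%:E) \_ D1.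
  pose B : T -> \bar R := (fun x => `|b x|%:E) \_ D2.
  have iA : mu.-integrable setT A.
    by apply/(integrable_mkcond _ mD1); exact: integrable_norm ia.
  have iB : mu.-integrable setT B.
    by apply/(integrable_mkcond _ mD2); exact: integrable_norm ib.
  have A0 x : (0 <= A x)%E by rewrite /A patchE; case: ifPn; rewrite ?lee_fin.
  have B0 x : (0 <= B x)%E by rewrite /B patchE; case: ifPn; rewrite ?lee_fin.
  have le2 x y : (`|G (x, y)| <= A x * B y)%E.
    rewrite /G /G0 /A /B /= !patchE in_setX /=.
    case: ifPn => [/andP[D1x D2y]|h].
      rewrite D1x D2y -EFinM lee_fin (le_trans (Fab _ _ _ _))//; try by rewrite -inE.
      by rewrite -normrM ler_norm.
    by rewrite normr0; apply: mule_ge0; case: ifPn => _; rewrite lee_fin.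
  have mG' x : measurable_fun setT (fun y => `|G (x, y)|%E).
    apply: measurableT_comp => //; apply: (measurableT_comp mG).
    exact: pair1_measurable.
  have mB := measurable_int _ iB; have mA := measurable_int _ iA.
  apply: (@le_lt_trans _ _ (\int[mu]_x (A x * \int[mu]_y B y))%E).
    apply: ge0_le_integral => //.
    - by move=> x _; apply: integral_ge0.
    - apply: (measurable_fun_fubini_tonelli_F (abse \o G)) => //.
      by apply: measurableT_comp.
      by move=> z; exact: abse_ge0.
    - have mc : measurable_fun setT (fun _ : T => \int[mu]_y B y)%E by [].
      exact: (emeasurable_funM mA mc).
    - move=> x _; rewrite -ge0_integralZl//.
      apply: ge0_le_integral => //.
      exact: measurable_funeM.
  rewrite ge0_integralZr//; last by apply: integral_ge0.
  by rewrite lte_mul_pinfty//; [exact: integral_ge0|exact: integrable_fin_num|exact: integrable_lty].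
split.
- apply/(integrable_mkcond _ mD1).
  by apply: eq_integrable (integrable_fubini_F iG) => // x _; rewrite /fubini_F G1.
- rewrite /Rintegral; congr fine.
  rewrite integral_mkcond [RHS]integral_mkcond.
  transitivity (\int[mu]_x \int[mu]_y G (x, y))%E.
    by apply: eq_integral => x _; rewrite G1.
  by rewrite (Fubini iG); apply: eq_integral => y _; rewrite G2.
Qed.

Lemma rfubini D1 D2 (F : T -> T -> R) a b : measurable D1 -> measurable D2 ->
  measurable_fun (D1 `*` D2) (fun p => F p.1 p.2) ->
  mu.-integrable D1 (EFin \o a) -> mu.-integrable D2 (EFin \o b) ->
  (forall x y, D1 x -> D2 y -> `|F x y| <= a x * b y) ->
  [/\ mu.-integrable D1 (fun x => (\int[mu]_(y in D2) F x y)%:E),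
      mu.-integrable D2 (fun y => (\int[mu]_(x in D1) F x y)%:E) &
      \int[mu]_(x in D1) (\int[mu]_(y in D2) F x y) =
      \int[mu]_(y in D2) (\int[mu]_(x in D1) F x y)].
Proof.
move=> mD1 mD2 mF ia ib Fab.
have [i1 e1] := rfubini1 mD1 mD2 mF ia ib Fab.
suff [i2 _] : mu.-integrable D2 (fun y => (\int[mu]_(x in D1) F x y)%:E) /\
  \int[mu]_(y in D2) (\int[mu]_(x in D1) F x y) =
  \int[mu]_(x in D1) (\int[mu]_(y in D2) F x y) by split.
apply: (@rfubini1 D2 D1 (fun y x => F x y) b a) => //.
- have -> : (fun p : T * T => F p.2 p.1) = (fun p => F p.1 p.2) \o (fun p : T * T => (p.2, p.1)).
    by apply/funext => -[].
  apply: (measurable_comp _ _ mF); first exact: measurableX.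
    by move=> _ [[y x] [/= ? ?] <-].
  by apply: measurable_funTS; exact: measurable_swap.
- by move=> y x D2y D1x; rewrite mulrC; exact: Fab.
Qed.

Lemma cfubini D1 D2 (F : T -> T -> R[i]) a b : measurable D1 -> measurable D2 ->
  cmeas (D1 `*` D2) (fun p => F p.1 p.2) ->
  mu.-integrable D1 (EFin \o a) -> mu.-integrable D2 (EFin \o b) ->
  (forall x y, D1 x -> D2 y -> nrm (F x y) <= a x * b y) ->
  [/\ cintegrable D1 (fun x => cintegral D2 (F x)),
      cintegrable D2 (fun y => cintegral D1 (F^~ y)) &
      cintegral D1 (fun x => cintegral D2 (F x)) =
      cintegral D2 (fun y => cintegral D1 (F^~ y))].
Proof.
move=> mD1 mD2 [mF1 mF2] ia ib Fab.
have [||i1 i2 e] := @rfubini D1 D2 (fun x y => Cre (F x y)) a b mD1 mD2 _ ia ib.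
- exact: mF1.
- by move=> x y D1x D2y; apply: le_trans (le_Re_nrm _) (Fab _ _ D1x D2y).
have [||j1 j2 e'] := @rfubini D1 D2 (fun x y => Cim (F x y)) a b mD1 mD2 _ ia ib.
- exact: mF2.
- by move=> x y D1x D2y; apply: le_trans (le_Im_nrm _) (Fab _ _ D1x D2y).
split; [exact: conj i1 j1|exact: conj i2 j2|].
by apply: complex_eq; [exact: e|exact: e'].
Qed.

End fubini.

(** * Change of variables by dilation and reflection *)

Section scaling.
Variable R : realType.
Local Notation mu := (@lebesgue_measure R).
Local Notation T := (measurableTypeR R).
Implicit Types (D : set T) (c : R).

Definition scl c : T -> T := fun x => c * x.

Lemma measurable_scale c : measurable_fun setT (fun x : T => c * x : T).
Proof. exact: mulrl_measurable. Qed.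

Let push c : {measure set T -> \bar R} :=
  measure_function_pushforward__canonical__measure_function_Measure
    mu (measurable_scale c).

(** By uniqueness of Lebesgue measure it is enough to compare the two measures on half-open
    intervals. For c < 0 the preimage of ]a, b] has its ends exchanged and is closed on the left,
    which does not change its length. *)
Lemma lebesgue_measure_scale c (c0 : c != 0) D : measurable D ->
  mscale (NngNum (normr_ge0 c)) (push c) D = mu D.
Proof.
move=> mD; apply/esym/lebesgue_measure_unique => //=.
move=> _ [[a b]] _ <-; rewrite /mscale /=.
have -> (A : set T) : pushforward mu (fun x : T => c * x : T) A =
  mu ((fun x : T => c * x : T) @^-1` A) by [].
have [cp|cn|] := ltrgtP c 0; last by move=> h; rewrite h eqxx in c0.
- rewrite (_ : _ @^-1` _ = `[b / c, a / c[%classic); last first.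
    by apply/seteqP; split => x /=; rewrite !in_itv/= ler_ndivrMr// ltr_ndivlMr// (mulrC x) andbC.
  rewrite !lebesgue_measure_itv/= !lte_fin ltr_nM2r ?invr_lt0//.
  case: ifPn => ab; last by rewrite mule0.
  rewrite -!EFinB -EFinM ltr0_norm//; congr EFin; field.
  by rewrite lt_eqF.
- rewrite (_ : _ @^-1` _ = `]a / c, b / c]%classic); last first.
    by apply/seteqP; split => x /=; rewrite !in_itv/= ltr_pdivrMr// ler_pdivlMr// (mulrC x).
  rewrite !lebesgue_measure_itv/= !lte_fin ltr_pM2r ?invr_gt0//.
  case: ifPn => ab; last by rewrite mule0.
  rewrite -!EFinB -EFinM gtr0_norm//; congr EFin; field.
  by rewrite gt_eqF.
Qed.

Lemma measurable_preimage_scale c D : measurable D -> measurable (scl c @^-1` D).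
Proof. by move=> mD; rewrite -[_ @^-1` _]setTI; exact: measurable_scale. Qed.

Lemma measurable_fun_scale c D d' (U : measurableType d') (f : T -> U) :
  measurable D -> measurable_fun D f ->
  measurable_fun (scl c @^-1` D) (fun x => f (scl c x)).
Proof.
move=> mD mf; apply: (measurable_comp mD _ mf); first by move=> _ [x Dx <-].
by apply: measurable_funTS; exact: measurable_scale.
Qed.

(** Lebesgue measure is |c| times its own image under x -> c x, so this is the change of variables
    formula for image measures. *)
Lemma ge0_integral_scale c (c0 : c != 0) D (f : T -> \bar R) : measurable D ->
  measurable_fun D f -> (forall x, D x -> (0 <= f x)%E) ->
  (\int[mu]_(x in D) f x =
   `|c|%:E * \int[mu]_(x in scl c @^-1` D) f (scl c x))%E.
Proof.
move=> mD mf f0.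
rewrite -(@ge0_integral_pushforward _ _ T T _ (scl c) (measurable_scale c) mu)//; last first.
  by move=> x; rewrite inE; exact: f0.
rewrite -[`|c|]/((NngNum (normr_ge0 c))%:num).
rewrite -[pushforward _ _]/(push c : set T -> \bar R) -ge0_integral_mscale//.
by apply: eq_measure_integral => // A mA AD; exact/esym/(lebesgue_measure_scale c0).
Qed.

Lemma integrable_scale c (c0 : c != 0) D (f : T -> \bar R) : measurable D ->
  mu.-integrable D f -> mu.-integrable (scl c @^-1` D) (fun x => f (scl c x)).
Proof.
move=> mD /integrableP[mf foo]; apply/integrableP; split.
  exact: measurable_fun_scale.
move: foo; rewrite (ge0_integral_scale c0 mD)//; last exact: measurableT_comp.
rewrite !ltey; apply: contraNN => /eqP ->.
by rewrite gt0_muley// lte_fin normr_gt0.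
Qed.

Lemma Rintegral_scale c (c0 : c != 0) D (f : T -> R) : measurable D ->
  mu.-integrable D (EFin \o f) ->
  \int[mu]_(x in D) f x = `|c| * \int[mu]_(x in scl c @^-1` D) f (scl c x).
Proof.
move=> mD fi; have fi' := integrable_scale c0 mD fi.
have /measurable_int mf := fi.
have mD' := measurable_preimage_scale c mD.
have p := integrable_pos_fin_num mD fi; have n := integrable_neg_fin_num mD fi.
have p' := integrable_pos_fin_num mD' fi'.
have n' := integrable_neg_fin_num mD' fi'.
have Ep x : (EFin \o f)^\+%E (scl c x) = (fun x => (EFin \o f) (scl c x))^\+%E x.
  by rewrite !funeposE.
have En x : (EFin \o f)^\-%E (scl c x) = (fun x => (EFin \o f) (scl c x))^\-%E x.
  by rewrite !funenegE.
rewrite /Rintegral integralE [in RHS]integralE (fineB p n) (fineB p' n').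
rewrite mulrBr (ge0_integral_scale c0 mD)//; last exact: measurable_funepos.
rewrite (@ge0_integral_scale c c0 D (EFin \o f)^\-%E)//; last exact: measurable_funeneg.
rewrite (eq_integral _ _ (fun x _ => Ep x)) (eq_integral _ _ (fun x _ => En x)).
congr (_ - _).
- by rewrite fineM; [|by []|exact: p'].
- by rewrite fineM; [|by []|exact: n'].
Qed.

Lemma cintegrable_scale c (c0 : c != 0) D (f : T -> R[i]) : measurable D ->
  cintegrable D f -> cintegrable (scl c @^-1` D) (fun x => f (scl c x)).
Proof. by move=> mD [i1 i2]; split; [exact: (integrable_scale c0 mD i1)|exact: (integrable_scale c0 mD i2)]. Qed.

Lemma cintegral_scale c (c0 : c != 0) D (f : T -> R[i]) : measurable D ->
  cintegrable D f ->
  cintegral D f = (`|c|)%:C * cintegral (scl c @^-1` D) (fun x => f (scl c x)).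
Proof.
move=> mD [i1 i2]; apply: complex_eq.
- by rewrite Re_realM /= (Rintegral_scale c0 mD i1).
- by rewrite Im_realM /= (Rintegral_scale c0 mD i2).
Qed.

Lemma cintegral_Rplus_scale c (f : T -> R[i]) : 0 < c ->
  cintegrable (@Rplus R) f ->
  cintegrable (@Rplus R) (fun x => f (c * x)) /\
  cintegral (@Rplus R) f = c%:C * cintegral (@Rplus R) (fun x => f (c * x)).
Proof.
move=> c0 fi; have cn0 : c != 0 by rewrite gt_eqF.
have E : scl c @^-1` (@Rplus R) = @Rplus R.
  by apply/seteqP; split => x; rewrite /preimage/= !RplusE /scl pmulr_rgt0.
split.
  by have := cintegrable_scale cn0 (@measurable_Rplus R) fi; rewrite E.
by rewrite (cintegral_scale cn0 (@measurable_Rplus R) fi) E gtr0_norm.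
Qed.

Lemma cintegral_reflect (f : T -> R[i]) : cintegrable setT f ->
  cintegrable setT (fun x => f (- x)) /\
  cintegral setT f = cintegral setT (fun x => f (- x)).
Proof.
move=> fi; have n1 : (-1 : R) != 0 by rewrite oppr_eq0 oner_eq0.
have E : (fun x => f (scl (-1) x)) = (fun x => f (- x)).
  by apply/funext => x; rewrite /scl mulN1r.
have mT : measurable [set: T] by [].
split; first by have := cintegrable_scale n1 mT fi; rewrite E preimage_setT.
by rewrite (cintegral_scale n1 mT fi) E preimage_setT normrN normr1 mul1r.
Qed.

End scaling.

(** * The fundamental theorem of calculus on unbounded intervals *)

Section exhaustion.
Variable R : realType.
Local Notation mu := (@lebesgue_measure R).
Local Notation T := (measurableTypeR R).
Implicit Types (D : set T).

(** Dominated convergence for the restrictions of h to [E n], with majorant |h|. *)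
Lemma cvg_integral_exhaust (E : nat -> set T) D (h : T -> R) :
  (forall n, measurable (E n)) -> nondecreasing_seq E -> \bigcup_n E n = D ->
  mu.-integrable D (EFin \o h) ->
  \int[mu]_(x in E n) h x @[n --> \oo] --> \int[mu]_(x in D) h x.
Proof.
move=> mE ndE UE ih.
have mD : measurable D by rewrite -UE; exact: bigcup_measurable.
have ED n : E n `<=` D by rewrite -UE; exact: bigcup_sup.
have /measurable_int mh := ih.
have key : (\int[mu]_(x in D) ((EFin \o h) \_ (E n)) x @[n --> \oo] -->
            \int[mu]_(x in D) (EFin \o h) x)%E.
  apply: (@dominated_cvg _ _ _ mu D mD _ _ (fun x => `|h x|%:E)) => //.
  - move=> n; apply/(measurable_restrict _ (mE n) mD).
    by apply: measurable_funS mh => //; exact: subIsetl.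
  - move=> x Dx; have [N _ ENx] : (\bigcup_n E n) x by rewrite UE.
    apply: cvg_near_cst; near=> n; rewrite patchE mem_set//.
    have /ndE/subsetPset : (N <= n)%N by near: n; exists N.
    exact.
  - exact: integrable_norm ih.
  - move=> n x Dx; rewrite patchE; case: ifPn => _; first by rewrite /= lee_fin.
    by rewrite /= normr0 lee_fin.
have fh := integrable_fin_num mD ih.
have {}key : (\int[mu]_(x in E n) (EFin \o h) x @[n --> \oo] -->
            (\int[mu]_(x in D) h x)%:E)%E.
  rewrite /Rintegral fineK//; apply: cvg_trans key; apply: near_eq_cvg.
  by apply: nearW => n; rewrite -integral_mkcondr setIidr.
exact: fine_cvg key.
Unshelve. all: by end_near. Qed.

Lemma FTC_exhaust_interval (a b : R) (f F : R -> R) : a < b ->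
  (forall x, a <= x <= b -> is_derive x 1 F (f x)) ->
  (forall x, a <= x <= b -> {for x, continuous f}) ->
  (\int[mu]_(x in `[a, b]) (f x)%:E = (F b - F a)%:E)%E.
Proof.
move=> ab dF cf; rewrite EFinB; apply: continuous_FTC2 => //.
- apply/continuous_in_subspaceT => x; rewrite inE/= in_itv/=; exact: cf.
- have cF x : a <= x <= b -> {for x, continuous F}.
    by move=> xab; apply: differentiable_continuous; apply/derivable1_diffP;
      have [] := dF x xab.
  split.
  + move=> x; rewrite in_itv/= => /andP[ax xb].
    by have [] := dF x; rewrite ?(ltW ax) ?(ltW xb).
  + by apply: cvg_at_right_filter; apply: cF; rewrite lexx ltW.
  + by apply: cvg_at_left_filter; apply: cF; rewrite lexx ltW.
- move=> x; rewrite in_itv/= => /andP[ax xb].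
  have := dF x; rewrite ?(ltW ax) ?(ltW xb) => /(_ isT) dFx.
  by rewrite derive1E; exact: derive_val.
Qed.

Lemma measurable_continuous_exhaust (a b : nat -> R) D (f : R -> R) :
  \bigcup_n `[a n, b n]%classic = D ->
  (forall x, D x -> {for x, continuous f}) -> measurable_fun (D : set T) f.
Proof.
move=> UD cf; rewrite -UD; apply/measurable_fun_bigcup.
  by move=> n; exact: measurable_itv.
move=> n; apply: subspace_continuous_measurable_fun; first exact: measurable_itv.
apply: continuous_in_subspaceT => x; rewrite inE => xab; apply: cf.
by rewrite -UD; exists n.
Qed.

Section FTC.
Variables (a b : nat -> R) (D : set T) (f F : R -> R) (l0 l1 : R).
Hypotheses (ab : forall n, a n < b n)
  (ndab : nondecreasing_seq (fun n => `[a n, b n]%classic))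
  (UD : \bigcup_n `[a n, b n]%classic = D)
  (dF : forall x, D x -> is_derive x 1 F (f x))
  (cf : forall x, D x -> {for x, continuous f})
  (Fa : F (a n) @[n --> \oo] --> l0) (Fb : F (b n) @[n --> \oo] --> l1).

Let FTCn n : (\int[mu]_(x in `[a n, b n]) (f x)%:E = (F (b n) - F (a n))%:E)%E.
Proof.
apply: FTC_exhaust_interval => // x xab; [apply: dF|apply: cf];
  by rewrite -UD; exists n => //=; rewrite in_itv.
Qed.

Lemma FTC_exhaust : mu.-integrable D (EFin \o f) ->
  \int[mu]_(x in D) f x = l1 - l0.
Proof.
move=> fi.
have h1 := cvg_integral_exhaust (fun n => measurable_itv `[a n, b n]) ndab UD fi.
have h2 : \int[mu]_(x in `[a n, b n]) f x @[n --> \oo] --> l1 - l0.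
  apply: cvg_trans (cvgB Fb Fa); apply: near_eq_cvg; apply: nearW => n.
  by rewrite /Rintegral FTCn.
exact: (cvg_unique _ h1 h2).
Qed.

(** For a nonnegative integrand monotone convergence replaces dominated convergence, so that
    integrability becomes a conclusion: it follows from the existence of the limits of the
    primitive. *)
Lemma ge0_FTC_exhaust : (forall x, D x -> 0 <= f x) ->
  mu.-integrable D (EFin \o f) /\ \int[mu]_(x in D) f x = l1 - l0.
Proof.
move=> f0.
have mf : measurable_fun D f by exact: measurable_continuous_exhaust UD cf.
have sub n : `[a n, b n]%classic `<=` D by move=> x xab; rewrite -UD; exists n.
have mf' n : measurable_fun (`[a n, b n]%classic : set T) (EFin \o f).
  apply/measurable_EFinP; apply: measurable_funS mf => //.
  by rewrite -UD; apply: bigcup_measurable => ? _; exact: measurable_itv.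
have h1 := @ge0_nondecreasing_set_cvg_integral _ T R (fun n => `[a n, b n]%classic)
  (EFin \o f) mu ndab (fun n => measurable_itv `[a n, b n]) mf'.
have {}h1 : (\int[mu]_(x in `[a n, b n]) (EFin \o f) x @[n --> \oo] -->
    \int[mu]_(x in D) (EFin \o f) x)%E.
  by rewrite -UD; apply: h1 => n x xab; rewrite lee_fin f0//; exact: sub xab.
have h2 : (\int[mu]_(x in `[a n, b n]) (EFin \o f) x @[n --> \oo] --> (l1 - l0)%:E)%E.
  have : (EFin \o (fun n => F (b n) - F (a n))) n @[n --> \oo] --> (l1 - l0)%:E.
    by apply: cvg_EFin; [exact: nearW|exact: cvgB].
  by apply: cvg_trans; apply: near_eq_cvg; apply: nearW => n; rewrite /= FTCn.
have E : (\int[mu]_(x in D) (EFin \o f) x = (l1 - l0)%:E)%E.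
  exact: (cvg_unique _ h1 h2).
split; last by rewrite /Rintegral [X in fine X]E.
apply/integrableP; split; first exact/measurable_EFinP.
rewrite (@eq_integral _ T R mu D (EFin \o f)); first by rewrite E ltry.
by move=> x; rewrite inE => Dx; rewrite gee0_abs// lee_fin f0.
Qed.

End FTC.

End exhaustion.

(** * Differentiation of complex functions of a real variable *)

Section calculus.
Variable R : realType.
Implicit Types (f g u v F G : R -> R) (x k df dg du dv : R).

Lemma is_derive_mul f g x df dg : is_derive x 1 f df -> is_derive x 1 g dg ->
  is_derive x 1 (fun y => f y * g y) (df * g x + f x * dg).
Proof.
move=> hf hg; apply: is_derive_eq (is_deriveM hf hg) _.
by rewrite /GRing.scale/= addrC mulrC.
Qed.

Lemma is_derive_add f g x df dg : is_derive x 1 f df -> is_derive x 1 g dg ->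
  is_derive x 1 (fun y => f y + g y) (df + dg).
Proof. by move=> hf hg; exact: is_deriveD. Qed.

Lemma is_derive_sub f g x df dg : is_derive x 1 f df -> is_derive x 1 g dg ->
  is_derive x 1 (fun y => f y - g y) (df - dg).
Proof. by move=> hf hg; exact: is_deriveB. Qed.

Lemma is_derive_scale f x df k : is_derive x 1 f df ->
  is_derive x 1 (fun y => k * f y) (k * df).
Proof. by move=> hf; exact: (is_deriveZ k hf). Qed.

Lemma is_derive_mulid x k : is_derive x 1 (fun y => k * y) k.
Proof. by apply: is_derive_eq (is_derive_scale k (is_derive_id x 1)) _; rewrite mulr1. Qed.

Lemma is_derive_chain f g x df dg : is_derive (g x) 1 f df ->
  is_derive x 1 g dg -> is_derive x 1 (fun y => f (g y)) (df * dg).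
Proof. by move=> hf hg; exact: (is_derive1_comp hf hg). Qed.

Lemma is_derive_continuous f x df : is_derive x 1 f df -> {for x, continuous f}.
Proof.
by move=> [h _]; apply: differentiable_continuous; exact/derivable1_diffP.
Qed.

(** With its companion for the sine, this is the derivative of e^{u + i v} read on real and
    imaginary parts. *)
Lemma is_derive_expcos u v x du dv : is_derive x 1 u du -> is_derive x 1 v dv ->
  is_derive x 1 (fun y => expR (u y) * cos (v y))
    (expR (u x) * (du * cos (v x) - dv * sin (v x))).
Proof.
move=> hu hv.
have h1 := is_derive_chain (is_derive_expR (u x)) hu.
have h2 := is_derive_chain (is_derive_cos (v x)) hv.
by apply: is_derive_eq (is_derive_mul h1 h2) _; ring.
Qed.

Lemma is_derive_expsin u v x du dv : is_derive x 1 u du -> is_derive x 1 v dv ->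
  is_derive x 1 (fun y => expR (u y) * sin (v y))
    (expR (u x) * (du * sin (v x) + dv * cos (v x))).
Proof.
move=> hu hv.
have h1 := is_derive_chain (is_derive_expR (u x)) hu.
have h2 := is_derive_chain (is_derive_sin (v x)) hv.
by apply: is_derive_eq (is_derive_mul h1 h2) _; ring.
Qed.

(** Differentiability is required of the two components separately, so that the rules and the
    fundamental theorem for real functions apply directly. *)
Definition is_cderive x (f : R -> R[i]) (df : R[i]) :=
  is_derive x 1 (fun y => Cre (f y)) (Cre df) /\
  is_derive x 1 (fun y => Cim (f y)) (Cim df).

Definition ccontinuous_at x (f : R -> R[i]) :=
  {for x, continuous (fun y => Cre (f y))} /\
  {for x, continuous (fun y => Cim (f y))}.

End calculus.

Section complex_calculus.
Variable R : realType.
Implicit Types (f g : R -> R[i]) (df dg z s : R[i]) (h : R -> R) (x dh : R).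

Lemma is_cderive_continuous x f df : is_cderive x f df -> ccontinuous_at x f.
Proof. by move=> [h1 h2]; split; [exact: is_derive_continuous h1|exact: is_derive_continuous h2]. Qed.

Lemma is_cderive_eq x f df dg : is_cderive x f df -> df = dg -> is_cderive x f dg.
Proof. by move=> ? <-. Qed.

Lemma is_cderive_mul x f g df dg : is_cderive x f df -> is_cderive x g dg ->
  is_cderive x (fun y => f y * g y) (df * g x + f x * dg).
Proof.
move=> [f1 f2] [g1 g2]; split.
- rewrite (_ : (fun y => _) = (fun y => Cre (f y) * Cre (g y) - Cim (f y) * Cim (g y))).
    by apply: is_derive_eq (is_derive_sub (is_derive_mul f1 g1) (is_derive_mul f2 g2)) _;
      rewrite ReD !ReM; ring.
  by apply/funext => y; rewrite ReM.
- rewrite (_ : (fun y => _) = (fun y => Cre (f y) * Cim (g y) + Cim (f y) * Cre (g y))).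
    by apply: is_derive_eq (is_derive_add (is_derive_mul f1 g2) (is_derive_mul f2 g1)) _;
      rewrite ImD !ImM; ring.
  by apply/funext => y; rewrite ImM.
Qed.

Lemma is_cderive_cst x (z : R[i]) : is_cderive x (fun=> z) 0.
Proof. by split; exact: is_derive_cst. Qed.

Lemma is_cderive_scale x z f df : is_cderive x f df ->
  is_cderive x (fun y => z * f y) (z * df).
Proof.
move=> hf; apply: is_cderive_eq (is_cderive_mul (is_cderive_cst x z) hf) _.
by rewrite mul0r add0r.
Qed.

Lemma is_cderive_real x h dh : is_derive x 1 h dh ->
  is_cderive x (fun y => (h y)%:C) dh%:C.
Proof. by move=> hf; split => //=; exact: is_derive_cst. Qed.

Lemma is_cderive_cexp x f df : is_cderive x f df ->
  is_cderive x (fun y => cexp (f y)) (df * cexp (f x)).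
Proof.
move=> [f1 f2].
have E y : cexp (f y) =
    (expR (Cre (f y)) * cos (Cim (f y))) +i* (expR (Cre (f y)) * sin (Cim (f y))).
  by apply: complex_eq; rewrite /cexp ?Re_realM ?Im_realM.
rewrite E; split.
- rewrite (_ : (fun y => _) = (fun y => expR (Cre (f y)) * cos (Cim (f y)))).
    by apply: is_derive_eq (is_derive_expcos f1 f2) _; rewrite ReM/=; ring.
  by apply/funext => y; rewrite E/=.
- rewrite (_ : (fun y => _) = (fun y => expR (Cre (f y)) * sin (Cim (f y)))).
    by apply: is_derive_eq (is_derive_expsin f1 f2) _; rewrite ImM/=; ring.
  by apply/funext => y; rewrite E/=.
Qed.

Lemma is_cderive_cexpM x z : is_cderive x (fun y => cexp (z * y%:C)) (z * cexp (z * x%:C)).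
Proof.
apply: is_cderive_cexp.
have h := is_cderive_scale z (is_cderive_real (is_derive_id x 1)).
by apply: is_cderive_eq h _; rewrite -[X in z * X]/(1 : R[i]) mulr1.
Qed.

Lemma cpowB1 x (s : R[i]) : 0 < x -> cpow x (s - 1) = (x^-1)%:C * cpow x s.
Proof.
move=> x0; rewrite cpowD mulrC.
have -> : (-1 : R[i]) = (-1 : R)%:C by rewrite rmorphN1.
by rewrite cpow_real// powR_inv1 ?ltW.
Qed.

Lemma is_cderive_cpow x (s : R[i]) : 0 < x ->
  is_cderive x (fun y => cpow y s) (s * cpow x (s - 1)).
Proof.
move=> x0; rewrite cpowB1// mulrA; apply: is_cderive_cexp.
exact: is_cderive_scale (is_cderive_real (is_derive1_ln x0)).
Qed.

End complex_calculus.

(** * Poisson kernels *)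

Section exhaustions.
Variable R : realType.
Local Notation mu := (@lebesgue_measure R).
Local Notation T := (measurableTypeR R).
Implicit Types (f F : R -> R).

(** The exhausting intervals are [1/(n + 1), n + 2]; the end n + 2 makes even the one for n = 0
    nondegenerate, as [FTC_exhaust] requires. *)
Let Rp_a (n : nat) : R := n.+1%:R^-1.
Let Rp_b (n : nat) : R := n.+2%:R.

Lemma Rplus_ab n : Rp_a n < Rp_b n.
Proof.
by apply: (@le_lt_trans _ _ 1); rewrite /Rp_a /Rp_b ?invf_le1 ?ltr1n ?ler1n ?ltr0n.
Qed.

Lemma Rplus_nd : nondecreasing_seq (fun n => `[Rp_a n, Rp_b n]%classic).
Proof.
apply/nondecreasing_seqP => n; apply/subsetPset => x /=; rewrite !in_itv/=.
move=> /andP[h1 h2]; apply/andP; split.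
  by apply: le_trans h1; rewrite lef_pV2 ?posrE ?ltr0n// ler_nat.
by apply: le_trans h2 _; rewrite ler_nat.
Qed.

Lemma Rplus_bigcup : \bigcup_n `[Rp_a n, Rp_b n]%classic = @Rplus R.
Proof.
apply/seteqP; split => x.
  move=> [n _ /=]; rewrite in_itv/= => /andP[h _].
  by rewrite RplusE; apply: lt_le_trans h; rewrite invr_gt0 ltr0n.
rewrite RplusE => x0.
exists (maxn (Num.trunc x) (Num.trunc x^-1)) => //=; rewrite in_itv/=; apply/andP; split.
  rewrite -[leRHS]invrK lef_pV2 ?posrE ?ltr0n ?invr_gt0//.
  by apply: ltW; rewrite -truncn_le_nat leq_maxr.
apply: ltW; rewrite -truncn_le_nat; apply: leq_trans (leq_maxl _ _) _.
exact: leqnSn.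
Qed.

Let Rp_a_cvg F (l : R) : F x @[x --> 0^'+] --> l -> F (Rp_a n) @[n --> \oo] --> l.
Proof.
move/cvg_at_rightP; apply; split; first by move=> n; rewrite invr_gt0 ltr0n.
exact: (@cvg_harmonic R).
Qed.

Lemma cvgr_natD (k : nat) : ((k + n)%:R : R) @[n --> \oo] --> +oo.
Proof.
apply/cvgryPge => A; near=> n; apply: (@le_trans _ _ n%:R).
  by near: n; exact: nbhs_infty_ger.
by rewrite ler_nat leq_addl.
Unshelve. all: by end_near. Qed.

Let Rp_b_cvg F (l : R) : F x @[x --> +oo] --> l -> F (Rp_b n) @[n --> \oo] --> l.
Proof.
move/cvg_pinftyP; apply.
exact: (cvgr_natD 2).
Qed.

Lemma Rplus_FTC f F (l0 l1 : R) :
  (forall x : R, 0 < x -> is_derive x 1 F (f x)) ->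
  (forall x : R, 0 < x -> {for x, continuous f}) ->
  F x @[x --> 0^'+] --> l0 -> F x @[x --> +oo] --> l1 ->
  mu.-integrable (@Rplus R) (EFin \o f) ->
  \int[mu]_(x in @Rplus R) f x = l1 - l0.
Proof.
move=> dF cf /Rp_a_cvg F0 /Rp_b_cvg F1 fi.
apply: (FTC_exhaust Rplus_ab Rplus_nd Rplus_bigcup _ _ F0 F1 fi) => x;
  rewrite RplusE; [exact: dF|exact: cf].
Qed.

Lemma ge0_Rplus_FTC f F (l0 l1 : R) :
  (forall x : R, 0 < x -> is_derive x 1 F (f x)) ->
  (forall x : R, 0 < x -> {for x, continuous f}) ->
  F x @[x --> 0^'+] --> l0 -> F x @[x --> +oo] --> l1 ->
  (forall x : R, 0 < x -> 0 <= f x) ->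
  mu.-integrable (@Rplus R) (EFin \o f) /\
  \int[mu]_(x in @Rplus R) f x = l1 - l0.
Proof.
move=> dF cf /Rp_a_cvg F0 /Rp_b_cvg F1 f0.
apply: (ge0_FTC_exhaust Rplus_ab Rplus_nd Rplus_bigcup _ _ F0 F1) => x;
  rewrite RplusE; [exact: dF|exact: cf|exact: f0].
Qed.

Lemma line_ab (n : nat) : - n.+1%:R < n.+1%:R :> R.
Proof. by rewrite gtrN// ltr0n. Qed.

Lemma line_nd : nondecreasing_seq (fun n => `[- n.+1%:R : R, n.+1%:R]%classic).
Proof.
apply/nondecreasing_seqP => n; apply/subsetPset => x /=; rewrite !in_itv/=.
have h : n.+1%:R <= n.+2%:R :> R by rewrite ler_nat.
by move=> /andP[h1 h2]; apply/andP; split; lra.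
Qed.

Lemma line_bigcup : \bigcup_n `[- n.+1%:R : R, n.+1%:R]%classic = setT.
Proof.
apply/seteqP; split => // x _; exists (Num.trunc `|x|) => //=.
by rewrite in_itv/= -ler_norml; apply/ltW; exact: truncnS_gt.
Qed.

Lemma ge0_line_FTC f F (l0 l1 : R) :
  (forall x : R, is_derive x 1 F (f x)) -> continuous f ->
  F x @[x --> -oo] --> l0 -> F x @[x --> +oo] --> l1 ->
  (forall x, 0 <= f x) ->
  mu.-integrable [set: T] (EFin \o f) /\ \int[mu]_x f x = l1 - l0.
Proof.
move=> dF cf F0 F1 f0.
have H : (n.+1%:R : R) @[n --> \oo] --> +oo.
  exact: (cvgr_natD 1).
apply: (ge0_FTC_exhaust line_ab line_nd line_bigcup) => //.
- by move=> x _; exact: cf.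
- by move/cvgNy_compNP/cvg_pinftyP : F0 => /(_ _ H).
- by move/cvg_pinftyP : F1 => /(_ _ H).
Qed.

End exhaustions.

(** * The Poisson kernel in the variables v and ln t *)

Section poisson_kernel.
Variable R : realType.
Local Notation mu := (@lebesgue_measure R).
Local Notation T := (measurableTypeR R).
Implicit Types (e c v t x du : R).

(** The Poisson kernel of the half-plane without the factor 1/pi, so that its total mass is pi. *)
Definition poisson e v : R := e / (e ^+ 2 + v ^+ 2).

Lemma poisson_den_gt0 e v : 0 < e -> 0 < e ^+ 2 + v ^+ 2.
Proof. by move=> e0; rewrite ltr_pwDl ?exprn_gt0 ?sqr_ge0. Qed.

Lemma poisson_ge0 e v : 0 < e -> 0 <= poisson e v.
Proof. by move=> e0; rewrite divr_ge0 ?ltW// poisson_den_gt0. Qed.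

Lemma poissonN e v : poisson e (- v) = poisson e v.
Proof. by rewrite /poisson sqrrN. Qed.

Lemma continuous_poisson e : 0 < e -> continuous (poisson e).
Proof.
move=> e0 v; apply: cvgM; first exact: cvg_cst.
apply: cvgV; first by rewrite gt_eqF// poisson_den_gt0.
apply: cvgD; first exact: cvg_cst.
by apply: cvgM; exact: cvg_id.
Qed.

Lemma measurable_poisson e : 0 < e -> measurable_fun setT (poisson e).
Proof. by move=> e0; apply: continuous_measurable_fun; exact: continuous_poisson. Qed.

(** The inner function u is kept general to serve both for v - c on the line and for ln t - c on the
    half-line. *)
Lemma is_derive_atan_poisson e (u : R -> R) x du : 0 < e -> is_derive x 1 u du ->
  is_derive x 1 (fun y => atan (e^-1 * u y)) (poisson e (u x) * du).
Proof.
move=> e0 hu.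
have h := @is_derive_chain _ _ (fun y => e^-1 * u y) x _ _
  (is_derive1_atan (e^-1 * u x)) (is_derive_scale e^-1 hu).
apply: is_derive_eq h _; rewrite /poisson; field.
by rewrite ?gt_eqF ?poisson_den_gt0//= andbT; have := sqr_ge0 (u x); nra.
Qed.

Lemma cvgNy_atan : (@atan R) x @[x --> -oo] --> - (pi / 2).
Proof.
apply/cvgNy_compNP; apply: cvg_trans (cvgN (@cvgy_atan R)).
by apply: near_eq_cvg; apply: nearW => x /=; rewrite atanN.
Qed.

Lemma cvgy_ln : (@ln R) x @[x --> +oo] --> +oo.
Proof.
apply/cvgryPge => A; near=> x.
have x0 : 0 < x by near: x; apply: nbhs_pinfty_gt; rewrite num_real.
rewrite -[A]expRK ler_ln ?posrE ?expR_gt0//.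
Unshelve. all: by end_near. Qed.

Lemma cvgy_atan_scale e c (F : set_system R) (u : R -> R) {FF : Filter F} :
  0 < e -> u x @[x --> F] --> +oo ->
  atan (e^-1 * (u x - c)) @[x --> F] --> pi / 2.
Proof.
move=> e0 uF; apply: (cvg_comp _ _ _ (@cvgy_atan R)).
apply/cvgryPge => A; near=> x.
rewrite mulrC ler_pdivlMr// lerBrDr; near: x.
by move/cvgryPge : uF; exact.
Unshelve. all: by end_near. Qed.

Lemma cvgNy_atan_scale e c (F : set_system R) (u : R -> R) {FF : Filter F} :
  0 < e -> u x @[x --> F] --> -oo ->
  atan (e^-1 * (u x - c)) @[x --> F] --> - (pi / 2).
Proof.
move=> e0 uF; apply: (cvg_comp _ _ _ cvgNy_atan).
apply/cvgrNyPle => A; near=> x.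
rewrite mulrC ler_pdivrMr// lerBlDr; near: x.
by move/cvgrNyPle : uF; exact.
Unshelve. all: by end_near. Qed.

Lemma integral_poisson e c : 0 < e ->
  mu.-integrable [set: T] (fun v => (poisson e (v - c))%:E) /\
  \int[mu]_v poisson e (v - c) = pi.
Proof.
move=> e0.
have -> : pi = pi / 2 - (- (pi / 2)) :> R by lra.
have := @ge0_line_FTC R (fun v => poisson e (v - c)) (fun v => atan (e^-1 * (v - c))).
apply.
- move=> x; have h := is_derive_sub (is_derive_id x 1) (is_derive_cst c x 1).
  by apply: is_derive_eq (is_derive_atan_poisson e0 h) _; rewrite subr0 mulr1.
- move=> x; apply: (continuous_comp (f := fun v => v - c)); last exact: continuous_poisson.
  by apply: cvgB; [exact: cvg_id|exact: cvg_cst].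
- by apply: cvgNy_atan_scale => //; exact: cvg_id.
- by apply: cvgy_atan_scale => //; exact: cvg_id.
- by move=> x; exact: poisson_ge0.
Qed.

(** This is [integral_poisson] after the substitution v = ln t, obtained directly from the primitive
    in t instead of a change of variables. *)
Lemma integral_poisson_ln e c : 0 < e ->
  mu.-integrable (@Rplus R) (fun t => (poisson e (ln t - c) / t)%:E) /\
  \int[mu]_(t in @Rplus R) (poisson e (ln t - c) / t) = pi.
Proof.
move=> e0.
have -> : pi = pi / 2 - (- (pi / 2)) :> R by lra.
have := @ge0_Rplus_FTC R (fun t => poisson e (ln t - c) / t) (fun t => atan (e^-1 * (ln t - c))).
apply.
- move=> x x0; have h := is_derive_sub (is_derive1_ln x0) (is_derive_cst c x 1).
  by apply: is_derive_eq (is_derive_atan_poisson e0 h) _; rewrite subr0.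
- move=> x x0; apply: cvgM; last by apply: cvgV; [rewrite gt_eqF|exact: cvg_id].
  apply: (continuous_comp (f := fun v => ln v - c)); last exact: continuous_poisson.
  by apply: cvgB; [exact: continuous_ln|exact: cvg_cst].
- by apply: cvgNy_atan_scale => //; exact: lnNy.
- by apply: cvgy_atan_scale => //; exact: cvgy_ln.
- by move=> x x0; apply: divr_ge0; [exact: poisson_ge0|exact: ltW].
Qed.

End poisson_kernel.

(** * The Gamma function *)

Section domination.
Variable R : realType.
Local Notation mu := (@lebesgue_measure R).
Local Notation T := (measurableTypeR R).
Implicit Types (p q t v x : R).

(** From e^a >= 1 + a^2/2 with a = p |v|: the constant 1 + 2/p^2 is such that (1 + 2/p^2)(1 + p^2
    v^2/2) exceeds 1 + v^2. *)
Lemma exp_le_poisson p : 0 < p -> exists2 C : R, 0 < C &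
  forall v, expR (- (p * `|v|)) <= C * poisson 1 v.
Proof.
move=> p0; exists (1 + 2 / p ^+ 2).
  by rewrite ltr_pwDl// divr_ge0// sqr_ge0.
move=> v; rewrite /poisson expr1n mulrA mulr1 ler_pdivlMr; last first.
  by rewrite ltr_pwDl ?sqr_ge0.
rewrite expRN mulrC ler_pdivrMr ?expR_gt0//.
have pv0 : 0 <= p * `|v| by rewrite mulr_ge0// ltW.
apply: (@le_trans _ _ ((1 + 2 / p ^+ 2) * (1 + (p * `|v|) ^+ 2 / 2))); last first.
  rewrite ler_pM2l; last by rewrite ltr_pwDl// divr_ge0// sqr_ge0.
  exact: (@expR_ge1Dxn _ _ 1 pv0).
rewrite exprMn real_normK ?num_real//.
have p2 : 0 < p ^+ 2 by rewrite exprn_gt0.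
rewrite -subr_ge0 (_ : _ - _ = p ^+ 2 * v ^+ 2 / 2 + 2 / p ^+ 2).
  have v2 := sqr_ge0 v; have p2V : 0 < (p ^+ 2)^-1 by rewrite invr_gt0.
  by apply: addr_ge0; [rewrite divr_ge0// mulr_ge0// ltW|rewrite divr_ge0// ltW].
by field; rewrite gt_eqF.
Qed.

Lemma powR_exp t p : 0 < t -> t `^ p = expR (p * ln t).
Proof. by move=> t0; rewrite /powR gt_eqF. Qed.

(** The smaller of t^p and t^{-p} is e^{- p |ln t|}, to which [exp_le_poisson] applies. *)
Lemma powR_le_poisson p : 0 < p -> exists2 C : R, 0 < C &
  forall t h, 0 < t -> h <= t `^ p -> h <= t `^ (- p) -> h <= C * poisson 1 (ln t).
Proof.
move=> p0; have [C C0 HC] := exp_le_poisson p0; exists C => // t h t0 h1 h2.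
apply: le_trans (HC _); have [l0|l0] := leP 0 (ln t).
  by apply: le_trans h2 _; rewrite powR_exp// ger0_norm// mulNr.
by apply: le_trans h1 _; rewrite powR_exp// ltr0_norm// mulrN opprK.
Qed.

Lemma integrable_poisson_ln_div :
  mu.-integrable (@Rplus R) (fun t => (poisson 1 (ln t) / t)%:E).
Proof.
have [h _] := @integral_poisson_ln R 1 0 ltr01.
by apply: eq_integrable h => [|t _]; [exact: measurable_Rplus|rewrite subr0].
Qed.

Lemma integrable_poisson1 : mu.-integrable [set: T] (fun y => (poisson 1 y)%:E).
Proof.
have [h _] := @integral_poisson R 1 0 ltr01.
by apply: eq_integrable h => // t _; rewrite subr0.
Qed.

Lemma measurable_inv_Rplus : measurable_fun (@Rplus R : set T) (fun t => t^-1).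
Proof.
apply: (eq_measurable_fun (fun t => t `^ (-1))).
  by move=> t; rewrite inE RplusE => t0; rewrite powR_inv1 ?ltW.
by apply: measurable_funTS; exact: measurable_powR.
Qed.

(** With respect to dt/t, power decay at both ends suffices: the two bounds together give a multiple
    of a Poisson kernel in ln t. *)
Lemma integrable_Rplus_powR p A (h : T -> R) : 0 < p -> 0 <= A ->
  measurable_fun (@Rplus R : set T) h ->
  (forall t, 0 < t -> `|h t| <= A * t `^ p) ->
  (forall t, 0 < t -> `|h t| <= A * t `^ (- p)) ->
  mu.-integrable (@Rplus R) (fun t => (h t / t)%:E).
Proof.
move=> p0 A0 mh h1 h2; have [C C0 HC] := powR_le_poisson p0.
have ig := integrable_realZ (A * C) (@measurable_Rplus R) integrable_poisson_ln_div.
apply: (le_integrable (@measurable_Rplus R) _ _ ig).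
  apply/measurable_EFinP; apply: measurable_funM => //.
  exact: measurable_inv_Rplus.
move=> t; rewrite RplusE => t0; rewrite /= lee_fin.
rewrite [leRHS]ger0_norm; last first.
  by apply: mulr_ge0; [exact: mulr_ge0 A0 (ltW C0)|apply: divr_ge0; [exact: poisson_ge0|exact: ltW]].
have t'0 : 0 < t^-1 by rewrite invr_gt0.
rewrite normrM (gtr0_norm t'0) mulrA ler_pM2r//.
move: A0; rewrite le_eqVlt => /predU1P[A0|A0].
  by have := h1 _ t0; rewrite -A0 !mul0r.
rewrite -mulrA mulrC -ler_pdivrMr//; apply: HC => //.
  by rewrite ler_pdivrMr// mulrC h1.
by rewrite ler_pdivrMr// mulrC h2.
Qed.

(** The inequality x/q <= e^{x/q}, raised to the power q. *)
Lemma expRN_le_powR q x : 0 < q -> 0 < x -> expR (- x) <= q `^ q * x `^ (- q).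
Proof.
move=> q0 x0; rewrite powRN expRN ler_pdivlMr ?powR_gt0// mulrC ler_pdivrMr ?expR_gt0//.
have -> : expR x = (expR (x / q)) `^ q by rewrite -expRM divfK// gt_eqF.
rewrite -powRM ?expR_ge0 ?(ltW q0)//.
apply: ge0_ler_powR; rewrite ?nnegrE ?mulr_ge0 ?expR_ge0 ?(ltW q0) ?(ltW x0)//.
rewrite -ler_pdivrMl// mulrC; apply: le_trans (expR_ge1Dx _); lra.
Qed.

End domination.

(** * Euler's integral on the right half-plane *)

Section Gamma_function.
Variable R : realType.
Local Notation mu := (@lebesgue_measure R).
Local Notation T := (measurableTypeR R).
Implicit Types (sigma t : R) (s : R[i]).

Definition Gamma_real sigma : R :=
  \int[mu]_(t in @Rplus R) (expR (- t) * t `^ (sigma - 1)).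

Definition Gamma_integrand s t : R[i] := (expR (- t))%:C * cpow t (s - 1).

Lemma powRB1 t sigma : 0 < t -> t `^ (sigma - 1) = t `^ sigma / t.
Proof.
move=> t0; rewrite powRB ?(powRr1 (ltW t0))//.
by rewrite (gt_eqF t0) implybT.
Qed.

Lemma measurable_expRN D : measurable_fun (D : set T) (fun t : T => expR (- t)).
Proof. by apply: measurable_funTS; apply: measurableT_comp => //; exact: measurableT_comp. Qed.

Lemma cmeas_id (D : set T) : cmeas D (fun t : T => t%:C).
Proof. exact: cmeas_real. Qed.

Lemma cmeas_Gamma_integrand s : cmeas (@Rplus R : set T) (Gamma_integrand s).
Proof.
apply: cmeasM; first by apply: cmeas_real; exact: measurable_expRN.
by apply: cmeas_cpow => //; exact: cmeas_cst.
Qed.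

Lemma nrm_Gamma_integrand s t : 0 < t ->
  nrm (Gamma_integrand s t) = expR (- t) * t `^ (Cre s - 1).
Proof.
move=> t0; rewrite nrmM nrm_real ger0_norm ?expR_ge0// nrm_cpow//.
by rewrite ReD ReN.
Qed.

Lemma integrable_Gamma_real sigma : 0 < sigma ->
  mu.-integrable (@Rplus R) (fun t => (expR (- t) * t `^ (sigma - 1))%:E).
Proof.
move=> s0.
(* The term 1 serves near 0, where e^{-t} <= 1. The other is the constant of [expRN_le_powR] with
   exponent 2 sigma, which serves at infinity and turns t^sigma into t^{- sigma}. *)
pose A : R := 1 + (sigma *+ 2) `^ (sigma *+ 2).
have A0 : 0 <= A by rewrite addr_ge0// powR_ge0.
have := @integrable_Rplus_powR R sigma A (fun t => expR (- t) * t `^ sigma) s0 A0.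
move=> H; apply: (eq_integrable (@measurable_Rplus R) _ _ _ (H _ _ _)).
- by move=> t; rewrite inE RplusE => t0; rewrite powRB1// mulrA.
- apply: measurable_funM; first exact: measurable_expRN.
  by apply: measurable_funTS; exact: measurable_powR.
- move=> t t0; rewrite ger0_norm ?mulr_ge0 ?expR_ge0 ?powR_ge0//.
  rewrite ler_wpM2r ?powR_ge0//; apply: (@le_trans _ _ 1).
    by rewrite expR_le1 oppr_le0 ltW.
  by rewrite lerDl powR_ge0.
- move=> t t0; rewrite ger0_norm ?mulr_ge0 ?expR_ge0 ?powR_ge0//.
  have s20 : 0 < sigma *+ 2 by rewrite mulrn_wgt0.
  have h := expRN_le_powR s20 t0.
  apply: (@le_trans _ _ ((sigma *+ 2) `^ (sigma *+ 2) * t `^ (- (sigma *+ 2)) * t `^ sigma)).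
    by rewrite ler_wpM2r ?powR_ge0.
  rewrite -mulrA -powRD; last by rewrite (gt_eqF t0) implybT.
  rewrite (_ : - (sigma *+ 2) + sigma = - sigma); last by rewrite mulr2n; ring.
  by rewrite ler_wpM2r ?powR_ge0// lerDr.
Qed.

Lemma cintegrable_Gamma s : 0 < Cre s -> cintegrable (@Rplus R) (Gamma_integrand s).
Proof.
move=> s0; apply: (cintegrable_le (@measurable_Rplus R) (cmeas_Gamma_integrand s) _
  (integrable_Gamma_real s0)).
by move=> t; rewrite RplusE => t0; rewrite nrm_Gamma_integrand.
Qed.

Lemma Gamma_le s : 0 < Cre s -> nrm (Gamma s) <= Gamma_real (Cre s).
Proof.
move=> s0; apply: (cintegral_nrm_le (@measurable_Rplus R) (cmeas_Gamma_integrand s) _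
  (integrable_Gamma_real s0)).
by move=> t; rewrite RplusE => t0; rewrite nrm_Gamma_integrand.
Qed.

Lemma Gamma_realE sigma : Gamma sigma%:C = (Gamma_real sigma)%:C.
Proof.
rewrite -cintegral_real; apply: eq_cintegral => t; rewrite RplusE => t0.
by rewrite realcM -cpow_real// rmorphB.
Qed.

Lemma Gamma_real_ge0 sigma : 0 <= Gamma_real sigma.
Proof. by apply: Rintegral_ge0 => t _; rewrite mulr_ge0 ?expR_ge0 ?powR_ge0. Qed.

(** On [1, 2] the integrand is at least e^{-2}/2, because t^sigma >= 1 and 1/t >= 1/2 there. *)
Lemma Gamma_real_gt0 sigma : 0 < sigma -> 0 < Gamma_real sigma.
Proof.
move=> s0; pose c : R := expR (- 2) / 2.
have c0 : 0 < c by rewrite divr_gt0// expR_gt0.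
have mI : measurable (`[1, 2]%classic : set T) by exact: measurable_itv.
have sub : `[1, 2]%classic `<=` @Rplus R.
  by move=> x; rewrite RplusE /= in_itv/= => /andP[h _]; exact: lt_le_trans h.
have ii := integrable_Gamma_real s0.
have m12 : mu (`[1, 2]%classic : set R) = 1%:E.
  by rewrite lebesgue_measure_itv/= lte_fin ltr1n -EFinB; congr EFin; lra.
apply: (@lt_le_trans _ _ (\int[mu]_(t in `[1, 2]) c)).
  rewrite Rintegral_cst// (_ : fine _ = 1) ?mulr1//.
  exact: (congr1 fine m12).
apply: (@le_trans _ _ (\int[mu]_(t in `[1, 2]) (expR (- t) * t `^ (sigma - 1)))).
  apply: le_Rintegral => //.
  - apply: measurable_bounded_integrable => //.
      by apply: (@le_lt_trans _ _ 1%E); [rewrite -m12|rewrite ltry].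
    by exists c; split; [rewrite num_real|move=> y cy t _ /=; rewrite ger0_norm ltW].
  - exact: (integrableS (@measurable_Rplus R) mI sub ii).
  - move=> t /=; rewrite in_itv/= => /andP[t1 t2].
    have t0 : 0 < t by apply: lt_le_trans t1.
    rewrite powRB1// ler_pM// ?expR_ge0// ?ler_expR ?lerN2//.
    rewrite ler_pdivlMr//; apply: (@le_trans _ _ 1); first by lra.
    apply: (@le_trans _ _ (1 `^ sigma)); first by rewrite powR1.
    by apply: ge0_ler_powR; rewrite ?nnegrE ?(ltW s0) ?(ltW t0).
rewrite -lee_fin /Rintegral !fineK.
- apply: ge0_subset_integral => //; first exact: measurable_Rplus.
    exact: measurable_int ii.
  by move=> t _; rewrite lee_fin mulr_ge0 ?expR_ge0 ?powR_ge0.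
- exact: (integrable_fin_num (@measurable_Rplus R) ii).
- apply: integrable_fin_num => //; exact: (integrableS (@measurable_Rplus R) mI sub ii).
Qed.

End Gamma_function.

(** * The functional equation of Gamma *)

Section Gamma_recurrence.
Variable R : realType.
Local Notation mu := (@lebesgue_measure R).
Local Notation T := (measurableTypeR R).
Implicit Types (sigma t y M : R) (s : R[i]).

Lemma cvg0_squeeze (F : set_system R) {FF : Filter F} (f g : R -> R) :
  (\forall x \near F, `|f x| <= g x) -> g x @[x --> F] --> 0 ->
  f x @[x --> F] --> 0.
Proof.
move=> fg g0; apply: (@squeeze_cvgr _ _ _ _ (fun x => - g x) g) => //.
  by near=> x; rewrite -ler_norml; near: x.
by rewrite -oppr0; exact: cvgN.
Unshelve. all: by end_near. Qed.

Lemma cRplus_FTC (f F : R -> R[i]) (l0 l1 : R[i]) :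
  (forall x : R, 0 < x -> is_cderive x F (f x)) ->
  (forall x : R, 0 < x -> ccontinuous_at x f) ->
  Cre (F x) @[x --> 0^'+] --> Cre l0 -> Cim (F x) @[x --> 0^'+] --> Cim l0 ->
  Cre (F x) @[x --> +oo] --> Cre l1 -> Cim (F x) @[x --> +oo] --> Cim l1 ->
  cintegrable (@Rplus R) f -> cintegral (@Rplus R) f = l1 - l0.
Proof.
move=> dF cf r0 i0 r1 i1 [fi1 fi2]; apply: complex_eq.
- rewrite ReD ReN /=; apply: Rplus_FTC r0 r1 fi1 => x x0.
    by have [] := dF x x0.
  by have [] := cf x x0.
- rewrite ImD ImN /=; apply: Rplus_FTC i0 i1 fi2 => x x0.
    by have [] := dF x x0.
  by have [] := cf x x0.
Qed.

Lemma cvgy_inv (C : R) : (C * x^-1) @[x --> +oo] --> 0.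
Proof.
rewrite -[X in _ --> X](mulr0 C); apply: cvgM; first exact: cvg_cst.
apply/gtr0_cvgV0; last exact: cvg_id.
by near=> x; near: x; apply: nbhs_pinfty_gt; rewrite num_real.
Unshelve. all: by end_near. Qed.

Lemma ccontinuous_mul x (f g : R -> R[i]) : ccontinuous_at x f ->
  ccontinuous_at x g -> ccontinuous_at x (fun y => f y * g y).
Proof.
move=> [f1 f2] [g1 g2]; split.
- have -> : (fun y => Cre (f y * g y)) =
      (fun y => Cre (f y) * Cre (g y) - Cim (f y) * Cim (g y)).
    by apply/funext => y; rewrite ReM.
  by apply: cvgB; apply: cvgM.
- have -> : (fun y => Cim (f y * g y)) =
      (fun y => Cre (f y) * Cim (g y) + Cim (f y) * Cre (g y)).
    by apply/funext => y; rewrite ImM.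
  by apply: cvgD; apply: cvgM.
Qed.

Lemma ccontinuous_add x (f g : R -> R[i]) : ccontinuous_at x f ->
  ccontinuous_at x g -> ccontinuous_at x (fun y => f y + g y).
Proof.
move=> [f1 f2] [g1 g2]; split.
- have -> : (fun y => Cre (f y + g y)) = (fun y => Cre (f y) + Cre (g y)).
    by apply/funext => y; rewrite ReD.
  exact: cvgD.
- have -> : (fun y => Cim (f y + g y)) = (fun y => Cim (f y) + Cim (g y)).
    by apply/funext => y; rewrite ImD.
  exact: cvgD.
Qed.

Lemma is_cderive_expRN x : is_cderive x (fun y => (expR (- y))%:C) (- expR (- x))%:C.
Proof.
apply: is_cderive_real.
have h := is_derive_mulid x (-1).
have h' := @is_derive_chain _ _ (fun y => -1 * y) x _ _ (is_derive_expR (-1 * x)) h.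
have -> : (fun y : R => expR (- y)) = (fun y => expR (-1 * y)).
  by apply/funext => y; rewrite mulN1r.
by apply: is_derive_eq h' _; rewrite mulrN1 mulN1r.
Qed.

(** Integration by parts in the form that s e^{-t} t^{s - 1} - e^{-t} t^s is the derivative of
    e^{-t} t^s, which vanishes at both ends of the half-line. *)
Lemma GammaS s : 0 < Cre s -> Gamma (s + 1) = s * Gamma s.
Proof.
move=> s0; have s10 : 0 < Cre (s + 1) by rewrite ReD ltr_wpDr.
pose F t : R[i] := (expR (- t))%:C * cpow t s.
pose f t : R[i] := s * Gamma_integrand s t - Gamma_integrand (s + 1) t.
have fi : cintegrable (@Rplus R) f.
  by apply: (cintegrableB (@measurable_Rplus R)); [apply: (cintegrableZ _ (@measurable_Rplus R))|];
    exact: cintegrable_Gamma.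
have nF t : 0 < t -> nrm (F t) = expR (- t) * t `^ Cre s.
  by move=> t0; rewrite nrmM nrm_real ger0_norm ?expR_ge0// nrm_cpow.
have ef t : f t = (- expR (- t))%:C * cpow t s +
    (expR (- t))%:C * (s * cpow t (s - 1)).
  rewrite /f /Gamma_integrand addrK rmorphN.
  by ring.
have dF (x : R) : 0 < x -> is_cderive x F (f x).
  move=> x0; rewrite ef.
  exact: (is_cderive_mul (is_cderive_expRN x) (is_cderive_cpow s x0)).
(* Here [h] stands for the real or the imaginary part, so that one estimate of the modulus treats
   both components. *)
have lim0 (h : R[i] -> R) : (forall z, `|h z| <= nrm z) ->
    h (F x) @[x --> 0^'+] --> 0.
  move=> hz; apply: (@cvg0_squeeze _ _ _ (fun x => x `^ Cre s)); last exact: powR_cvg0.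
  near=> x; have x0 : 0 < x by near: x; exact: nbhs_right_gt.
  apply: le_trans (hz _) _; rewrite nF// ler_piMl ?powR_ge0//.
  by rewrite expR_le1 oppr_le0 ltW.
have limy (h : R[i] -> R) : (forall z, `|h z| <= nrm z) ->
    h (F x) @[x --> +oo] --> 0.
  (* The exponent Re s + 1 in [expRN_le_powR] leaves a multiple of 1/x after multiplication by x^{Re
     s}. *)
  move=> hz; have q0 : 0 < Cre s + 1 by rewrite ltr_wpDr.
  apply: (@cvg0_squeeze _ _ _ (fun x => (Cre s + 1) `^ (Cre s + 1) * x^-1)); last exact: cvgy_inv.
  near=> x; have x0 : 0 < x by near: x; apply: nbhs_pinfty_gt; rewrite num_real.
  apply: le_trans (hz _) _; rewrite nF//.
  apply: (le_trans (ler_wpM2r (powR_ge0 _ _) (expRN_le_powR q0 x0))).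
  rewrite -mulrA ler_wpM2l ?powR_ge0// -powRD; last by rewrite (gt_eqF x0) implybT.
  by rewrite opprD addrAC addNr add0r powR_inv1 ?(ltW x0).
have : cintegral (@Rplus R) f = 0 - 0.
  apply: (@cRplus_FTC f F) => //.
  - move=> x x0; rewrite (_ : f = fun t => (- expR (- t))%:C * cpow t s +
      (expR (- t))%:C * (s * cpow t (s - 1))); last by apply/funext => t; exact: ef.
    have ce := is_cderive_continuous (is_cderive_expRN x).
    have cN := is_cderive_continuous (is_cderive_scale (-1) (is_cderive_expRN x)).
    have c1 := is_cderive_continuous (is_cderive_cpow s x0).
    have c2 := is_cderive_continuous (is_cderive_scale s (is_cderive_cpow (s - 1) x0)).
    apply: ccontinuous_add; last exact: ccontinuous_mul.
    apply: ccontinuous_mul => //; move: cN.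
    by congr (ccontinuous_at _ _); apply/funext => t; rewrite rmorphN mulN1r.
  - exact: (lim0 (@complex.Re R) (@le_Re_nrm R)).
  - exact: (lim0 (@complex.Im R) (@le_Im_nrm R)).
  - exact: (limy (@complex.Re R) (@le_Re_nrm R)).
  - exact: (limy (@complex.Im R) (@le_Im_nrm R)).
have mR := @measurable_Rplus R.
rewrite /f cintegralB//; [|by apply: cintegrableZ => //; exact: cintegrable_Gamma|exact: cintegrable_Gamma].
rewrite cintegralZ//; last exact: cintegrable_Gamma.
by rewrite subr0 => /subr0_eq/esym.
Unshelve. all: by end_near. Qed.

Lemma Gamma_realS sigma : 0 < sigma -> Gamma_real (sigma + 1) = sigma * Gamma_real sigma.
Proof.
move=> s0; have := @GammaS sigma%:C s0.
have -> : sigma%:C + 1 = (sigma + 1)%:C :> R[i] by rewrite rmorphD.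
by rewrite !Gamma_realE -realcM => -[].
Qed.

End Gamma_recurrence.

(** * Lower bounds for Gamma on vertical lines *)

Section Gamma_bounds.
Variable R : realType.
Local Notation mu := (@lebesgue_measure R).
Local Notation T := (measurableTypeR R).
Implicit Types (alpha sigma t y M a b : R).

(** With r = q^2 the right side is 4 (q - 1/q)^2 and ln r = 2 ln q, while |ln q| <= |q - 1/q|
    follows from ln x <= x - 1 at q and 1/q. This replaces the squared logarithm by powers of r,
    whose means against the Gamma density are explicit. *)
Lemma ln_sqr_le r : 0 < r :> R -> ln r ^+ 2 <= 4 * (r - 2 + r^-1).
Proof.
move=> r0; pose q := expR (ln r / 2).
have q0 : 0 < q by exact: expR_gt0.
have rq : r = q ^+ 2 by rewrite /q expr2 -expRD -splitr lnK.
have lnr : ln r = ln q *+ 2 by rewrite rq lnXn.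
have qi0 : 0 < q^-1 by rewrite invr_gt0.
have qq : q * q^-1 = 1 by rewrite divff// gt_eqF.
have e : r - 2 + r^-1 = (q - q^-1) ^+ 2.
  by rewrite rq sqrrB qq exprVn; ring.
rewrite e lnr -[ln q *+ 2]mulr_natl exprMn -natrX.
rewrite ler_pM2l// -[leLHS]real_normK ?num_real// -[leRHS]real_normK ?num_real//.
rewrite ler_pXn2r ?nnegrE//.
have h x : 0 < x :> R -> ln x <= x - 1.
  move=> x0; have := @le_ln1Dx R (x - 1); rewrite addrCA subrr addr0; apply.
  by rewrite ltrBrDl subrr.
have h1 := h _ q0; have := h _ qi0; rewrite lnV ?posrE// => h2.
rewrite ler_norml; have [q1|q1] := leP 1 q.
  have q1' : q^-1 <= 1 by rewrite invf_le1.
  by rewrite ger0_norm; [apply/andP; split|]; lra.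
have q1' : 1 <= q^-1 by rewrite invf_ge1// ltW.
by rewrite ler0_norm; [apply/andP; split|]; lra.
Qed.

Lemma norm_sin_le t : `|sin t| <= `|t|.
Proof.
wlog t0 : t / 0 < t => [h|].
  have [t0|t0|->] := ltrgtP t 0; [|exact: h|by rewrite sin0].
  by rewrite -normrN -sinN -(normrN t); apply: h; rewrite oppr_gt0.
have [|c _] := @MVT R sin cos 0 t t0 (fun x _ => is_derive_sin x).
  by apply: continuous_subspaceT; exact: continuous_sin.
rewrite sin0 !subr0 => ->; rewrite normrM ler_piMl//.
exact: cos_max.
Qed.

(** From cos t = 1 - 2 sin(t/2)^2 and |sin u| <= |u|. *)
Lemma cos_ge t : 1 - t ^+ 2 / 2 <= cos t.
Proof.
have -> : t = (t / 2) *+ 2 by rewrite -mulr_natr divfK.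
set u := t / 2; rewrite cos_mulr2n cos2sin2.
have : sin u ^+ 2 <= u ^+ 2.
  rewrite -[leLHS]real_normK ?num_real// -[leRHS]real_normK ?num_real//.
  rewrite ler_pXn2r ?nnegrE//.
  exact: norm_sin_le.
move=> h; rewrite -(mulr_natl u) exprMn -[(1 - _) *+ 2]mulr_natl; lra.
Qed.

(** This is |1 + i y/a|^2, the factor gained by |Gamma(a + i y)/Gamma(a)|^2 when a increases by
    1. *)
Definition dq a y := 1 + (y / a) ^+ 2.

Lemma dq_ge1 a y : 1 <= dq a y. Proof. by rewrite lerDl sqr_ge0. Qed.

Lemma dq_gt0 a y : 0 < dq a y. Proof. by apply: lt_le_trans (dq_ge1 a y). Qed.

Lemma dq_le alpha a b y : 0 <= alpha -> 0 < a -> 0 < b -> alpha * a <= b ->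
  dq b (alpha * y) <= dq a y.
Proof.
move=> al0 a0 b0 ab; rewrite lerD2l -[leLHS]real_normK ?num_real//.
rewrite -[leRHS]real_normK ?num_real// ler_pXn2r ?nnegrE// !normrM.
rewrite (ger0_norm al0) !(gtr0_norm (_ : 0 < _^-1)) ?invr_gt0//.
rewrite ler_pdivlMr// mulrAC ler_pdivrMr// mulrAC mulrC.
by rewrite ler_wpM2l.
Qed.

(** The modulus on a vertical line is normalized by its value at y = 0, so that the functional
    equation multiplies its square by [dq sigma y] alone. *)
Definition gratio sigma y := nrm (Gamma (sigma +i* y)) / Gamma_real sigma.

Lemma gratio_ge0 sigma y : 0 < sigma -> 0 <= gratio sigma y.
Proof. by move=> s0; rewrite divr_ge0 ?nrm_ge0// Gamma_real_ge0. Qed.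

Lemma gratio_le1 sigma y : 0 < sigma -> gratio sigma y <= 1.
Proof.
move=> s0; rewrite ler_pdivrMr ?Gamma_real_gt0// mul1r.
exact: (@Gamma_le R (sigma +i* y)).
Qed.

Lemma nrm_GammaE sigma y : 0 < sigma ->
  nrm (Gamma (sigma +i* y)) = gratio sigma y * Gamma_real sigma.
Proof. by move=> s0; rewrite divfK// gt_eqF// Gamma_real_gt0. Qed.

Lemma gratioS sigma y : 0 < sigma ->
  gratio (sigma + 1) y ^+ 2 = gratio sigma y ^+ 2 * dq sigma y.
Proof.
move=> s0; rewrite /gratio Gamma_realS//.
have -> : (sigma + 1) +i* y = (sigma +i* y) + 1.
  by apply: complex_eq; rewrite /= ?addr0.
rewrite GammaS// nrmM !exprMn nrm_sqr /= /dq !exprVn exprMn.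
have g0 := Gamma_real_gt0 s0.
by field; rewrite !gt_eqF.
Qed.

Lemma gratio_prod sigma y N : 0 < sigma ->
  gratio (sigma + N%:R) y ^+ 2 =
  gratio sigma y ^+ 2 * \prod_(k < N) dq (sigma + k%:R) y.
Proof.
move=> s0; elim: N => [|N IH]; first by rewrite big_ord0 mulr1 addr0.
rewrite big_ord_recr /= mulrA -IH -gratioS; last by rewrite ltr_wpDr.
by rewrite -addrA -[in LHS]addn1 natrD.
Qed.

(* [|Gamma(M + i y)|] is at least the real part of [M^{- i y} Gamma(M + i y)],
   whose integrand involves [cos (y ln (t / M))]. *)
Lemma gratio_lower M y : 1 < M -> 1 - 2 * y ^+ 2 / (M - 1) <= gratio M y.
Proof.
move=> M1; have M0 : 0 < M by lra.
have M10 : 0 < M - 1 by lra.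
have mR := @measurable_Rplus R.
have gM := Gamma_real_gt0 M0.
have E1 := Gamma_realS M0.
have E2 : Gamma_real M = (M - 1) * Gamma_real (M - 1).
  by rewrite -(Gamma_realS M10) subrK.
rewrite ler_pdivlMr//.
pose z : R[i] := cpow M (0 -i* y).
have nz : nrm z = 1 by rewrite nrm_cpow// powRr0.
have iG : cintegrable (@Rplus R) (Gamma_integrand (M +i* y)) by exact: cintegrable_Gamma.
have izG := cintegrableZ z mR iG.
have -> : nrm (Gamma (M +i* y)) =
    nrm (cintegral (@Rplus R) (fun t => z * Gamma_integrand (M +i* y) t)).
  by rewrite cintegralZ// nrmM nz mul1r.
apply: le_trans (le_trans (ler_norm _) (le_Re_nrm _)).
rewrite -[Cre (cintegral _ _)]/(\int[mu]_(t in @Rplus R) Cre (z * Gamma_integrand (M +i* y) t)).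
pose g p t : R := expR (- t) * t `^ (p - 1).
have ig p : 0 < p -> mu.-integrable (@Rplus R) (EFin \o g p).
  by move=> p0; exact: integrable_Gamma_real.
have M1' : 0 < M + 1 := addr_gt0 M0 ltr01.
(* Coefficients of 1, t and 1/t in 1 - 2 y^2 (t/M - 2 + M/t), which minorizes cos(y ln(t/M)) by
   [cos_ge] and [ln_sqr_le]. Its mean against the Gamma density of parameter M is exactly 1 - 2
   y^2/(M - 1), by the functional equation at M and M - 1. *)
pose c1 := 1 + 4 * y ^+ 2; pose c2 := - (2 * y ^+ 2 / M); pose c3 := - (2 * y ^+ 2 * M).
have i1 := integrable_realZ c1 mR (ig _ M0).
have i2 := integrable_realZ c2 mR (ig _ M1').
have i3 := integrable_realZ c3 mR (ig _ M10).
have i23 : mu.-integrable (@Rplus R) (EFin \o (fun t => c2 * g (M + 1) t + c3 * g (M - 1) t)).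
  exact: (integrableD mR i2 i3).
have i123 : mu.-integrable (@Rplus R)
    (EFin \o (fun t => c1 * g M t + (c2 * g (M + 1) t + c3 * g (M - 1) t))).
  exact: (integrableD mR i1 i23).
apply: (@le_trans _ _ (\int[mu]_(t in @Rplus R)
    (c1 * g M t + (c2 * g (M + 1) t + c3 * g (M - 1) t)))).
  rewrite RintegralD// RintegralD// !RintegralZl//; [|exact: ig..].
  rewrite -![\int[mu]_(x in _) g _ x]/(Gamma_real _) E1 E2 /c1 /c2 /c3.
  rewrite le_eqVlt; apply/orP; left; apply/eqP; field.
  by rewrite !gt_eqF.
apply: le_Rintegral => //; first exact: izG.1.
move=> t; rewrite RplusE => t0.
have -> : Cre (z * Gamma_integrand (M +i* y) t) = g M t * cos (y * (ln t - ln M)).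
  rewrite mulrCA Re_realM -/(g _ _) /g -mulrA; congr (_ * _).
  rewrite ReM !cpow_Re !Re_realM !Im_realM /= !(mul0r, mulr0, subr0, add0r, oppr0, addr0) expR0 !mul1r.
  rewrite powR_exp// mulrBr cosB !mulNr cosN sinN; ring.
have tM : 0 < t / M by rewrite divr_gt0.
have hc := cos_ge (y * (ln t - ln M)).
have hl := ln_sqr_le tM; rewrite ln_div ?posrE// invf_div in hl.
have g0 : 0 <= g M t by rewrite mulr_ge0 ?expR_ge0 ?powR_ge0.
have e1 : g (M + 1) t = t * g M t.
  by rewrite /g addrK powRB1// ; field; rewrite gt_eqF.
have e2 : g (M - 1) t = t^-1 * g M t.
  by rewrite /g (powRB1 (M - 1) t0); ring.
rewrite e1 e2.
have -> : c1 * g M t + (c2 * (t * g M t) + c3 * (t^-1 * g M t)) =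
    g M t * (1 - (2 * y ^+ 2) * (t / M - 2 + M / t)).
  by rewrite /c1 /c2 /c3; field; rewrite !gt_eqF.
rewrite ler_wpM2l//; apply: le_trans hc.
rewrite lerD2l lerN2 exprMn.
have y20 : 0 <= y ^+ 2 by exact: sqr_ge0.
rewrite ler_pdivrMr//; apply: (le_trans (ler_wpM2l y20 hl)).
by rewrite le_eqVlt; apply/orP; left; apply/eqP; ring.
Qed.

End Gamma_bounds.

(** * Comparison of Gamma(s) with Gamma(alpha s) *)

Section Gamma_ratio_bounds.
Variable R : realType.
Implicit Types (alpha sigma t y M a b : R).

Lemma gratio_upper sigma y N : 0 < sigma ->
  gratio sigma y ^+ 2 * \prod_(k < N) dq (sigma + k%:R) y <= 1.
Proof.
move=> s0; rewrite -gratio_prod//; have sN : 0 < sigma + N%:R by rewrite ltr_wpDr.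
by rewrite exprn_ile1// ?gratio_ge0// gratio_le1.
Qed.

Lemma gratio_large sigma y : 0 < sigma -> exists N0 : nat, forall N, (N0 <= N)%N ->
  1 / 4 <= gratio (sigma + N%:R) y ^+ 2.
Proof.
(* For N > 4 y^2 + 1 the bound of [gratio_lower] at sigma + N is at least 1/2. *)
move=> s0; exists (Num.trunc (4 * y ^+ 2 + 1)).+1 => N N0.
have y20 := sqr_ge0 y.
have hN : 4 * y ^+ 2 + 1 < N%:R.
  by apply: lt_le_trans (truncnS_gt _) _; rewrite ler_nat.
have M1 : 1 < sigma + N%:R by lra.
have h := gratio_lower y M1; set r := gratio _ _ in h *.
have : 2 * y ^+ 2 / (sigma + N%:R - 1) <= 1 / 2.
  by rewrite ler_pdivrMr; lra.
move=> h'; have r2 : 1 / 2 <= r by lra.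
have := ler_pM (_ : 0 <= 1 / 2) (_ : 0 <= 1 / 2) r2 r2.
by rewrite -expr2 => hh; apply: le_trans (hh _ _); lra.
Qed.

Lemma dq_ge0 a y : 0 <= dq a y.
Proof. exact/ltW/dq_gt0. Qed.

Lemma prod_dq_gt0 (u : nat -> R) y N : 0 < \prod_(k < N) dq (u k) y.
Proof. by apply: prodr_gt0 => k _; exact: dq_gt0. Qed.

(** Together with [gratio_upper], for N large the product equals the inverse of the squared
    normalized modulus up to a factor 4. This finite statement takes the place of the infinite
    product expansion. *)
Lemma gratio_lower_prod sigma y : 0 < sigma -> exists N0 : nat, forall N, (N0 <= N)%N ->
  1 / 4 <= gratio sigma y ^+ 2 * \prod_(k < N) dq (sigma + k%:R) y.
Proof.
move=> s0; have [N0 H] := gratio_large y s0; exists N0 => N /H.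
by rewrite gratio_prod.
Qed.

(** A zero of Gamma would make the left side of [gratio_lower_prod] vanish for every N. *)
Lemma gratio_gt0 sigma y : 0 < sigma -> 0 < gratio sigma y.
Proof.
move=> s0; rewrite lt_neqAle gratio_ge0// andbT.
have [N0 /(_ N0 (leqnn _)) H] := gratio_lower_prod y s0.
by apply: contraTneq H => <-; rewrite expr0n mul0r -ltNge; lra.
Qed.

Lemma Gamma_neq0 (s : R[i]) : 0 < Cre s -> Gamma s != 0.
Proof.
case: s => sigma y /= s0; rewrite -nrm_eq0 nrm_GammaE// mulf_neq0//.
  by rewrite gt_eqF// gratio_gt0.
by rewrite gt_eqF// Gamma_real_gt0.
Qed.

Lemma dq_anti a b y : 0 < a -> a <= b -> dq b y <= dq a y.
Proof.
move=> a0 ab; have := @dq_le R 1 a b y ler01 a0 (lt_le_trans a0 ab).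
by rewrite !mul1r; exact.
Qed.

(** The four factors with k = 0, ..., 3 are each at least [dq (sigma + 3) y], and a square root
    leaves two of them. The decay is then of order y^{-4}: one factor gives integrability, the other
    can absorb a factor |y|. *)
Lemma Gamma_decay sigma y : 0 < sigma ->
  nrm (Gamma (sigma +i* y)) * dq (sigma + 3) y ^+ 2 <= Gamma_real sigma.
Proof.
move=> s0; rewrite nrm_GammaE// mulrAC ler_piMl ?Gamma_real_ge0//.
have d0 : 0 <= dq (sigma + 3) y by rewrite ltW// dq_gt0.
have X0 : 0 <= gratio sigma y * dq (sigma + 3) y ^+ 2.
  by apply: mulr_ge0; [exact: gratio_ge0|exact: sqr_ge0].
rewrite -(@ler_pXn2r _ 2)// ?nnegrE// expr1n.
apply: le_trans (gratio_upper y 4 s0).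
rewrite exprMn ler_wpM2l ?sqr_ge0// -exprM.
rewrite -[(2 * 2)%N]/4%N -{1}(card_ord 4) -prodr_const.
apply: ler_prod => k _; rewrite d0/=; apply: dq_anti; first by rewrite ltr_wpDr.
by rewrite lerD2l ler_nat -ltnS.
Qed.

Section compare.
Variables (alpha sigma : R).
Hypotheses (alpha0 : 0 < alpha) (sigma0 : 0 < sigma).

Let as0 : 0 < alpha * sigma. Proof. exact: mulr_gt0. Qed.

(** Write X and Y for the normalized moduli of Gamma(s) and Gamma(alpha s), and Q for the product
    belonging to alpha s. Then X^2 d^2 Q <= X^2 [P N] <= 1 <= 4 Y^2 Q for N large; cancelling Q and
    taking roots gives the factor 2. *)
Lemma gratio_compare y (P : nat -> R) d : 0 < d ->
  (exists N1 : nat, forall N, (N1 <= N)%N ->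
    \prod_(k < N) dq (alpha * sigma + k%:R) (alpha * y) * d ^+ 2 <= P N /\
    gratio sigma y ^+ 2 * P N <= 1) ->
  gratio sigma y * d <= 2 * gratio (alpha * sigma) (alpha * y).
Proof.
move=> d0 [N1 H1]; have [N0 H0] := gratio_lower_prod (alpha * y) as0.
have := H0 (maxn N0 N1) (leq_maxl _ _); have [] := H1 (maxn N0 N1) (leq_maxr _ _).
set N := maxn _ _; set Q := \prod_(k < N) _.
have Q0 : 0 < Q by exact: (prod_dq_gt0 (fun k => alpha * sigma + k%:R)).
set X := gratio sigma y; set Y := gratio (alpha * sigma) (alpha * y).
have X0 : 0 <= X by exact: gratio_ge0.
have Y0 : 0 <= Y by exact: gratio_ge0.
move=> hP hX hY.
have Xd0 : 0 <= X * d by apply: mulr_ge0 => //; exact: ltW.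
have Y20 : 0 <= 2 * Y by exact: mulr_ge0.
rewrite -(@ler_pXn2r _ 2)// ?nnegrE//.
rewrite -(ler_pM2l Q0) [(X * d) ^+ 2]exprMn [(2 * Y) ^+ 2]exprMn.
apply: (@le_trans _ _ (X ^+ 2 * P N)).
  by rewrite mulrCA ler_wpM2l ?sqr_ge0.
apply: le_trans hX _; rewrite (_ : 2 ^+ 2 = 4); last by ring.
by rewrite mulrC -mulrA; lra.
Qed.

(** Factor by factor, since alpha (sigma + k) <= alpha sigma + k when alpha <= 1. *)
Lemma gratio_le y : alpha <= 1 ->
  gratio sigma y <= 2 * gratio (alpha * sigma) (alpha * y).
Proof.
move=> a1; rewrite -[leLHS]mulr1.
apply: (@gratio_compare y (fun N => \prod_(k < N) dq (sigma + k%:R) y)) => //.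
exists 0%N => N _; split; last exact: gratio_upper.
rewrite expr1n mulr1; apply: ler_prod => k _; rewrite ltW ?dq_gt0//=.
apply: dq_le; rewrite ?(ltW alpha0)// ?ltr_wpDr//.
rewrite mulrDr lerD2l; have : 0 <= k%:R :> R by []. 
by move=> k0; rewrite -[leRHS]mul1r ler_wpM2r.
Qed.

(* Shifting the product by two factors, which is possible when [alpha < 1],
   leaves two factors to be compared with [dq a y ^+ 2]. *)
Lemma gratio_decay : alpha < 1 -> exists2 a, 0 < a & forall y,
  gratio sigma y * dq a y <= 2 * gratio (alpha * sigma) (alpha * y).
Proof.
move=> a1; have a1' : 0 < 1 - alpha by rewrite subr_gt0.
(* From [n0] on, alpha (N + 2) <= N, so the factor of index N for alpha s is at most the factor of
   index N + 2 for s. *)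
pose n0 := (Num.trunc (2 * alpha / (1 - alpha))).+1.
have hn0 N : (n0 <= N)%N -> alpha * N.+2%:R <= N%:R.
  move=> n0N; have : 2 * alpha / (1 - alpha) < N%:R.
    by apply: lt_le_trans (truncnS_gt _) _; rewrite ler_nat.
  by rewrite ltr_pdivrMr// -[N.+2]addn2 natrD; lra.
(* Parameter of the last of the [n0 + 2] factors at N = [n0]: the two factors left over there, of
   indices [n0] and [n0 + 1], are both at least [dq a y]. *)
exists (sigma + n0.+1%:R); first by rewrite ltr_wpDr.
move=> y; apply: (@gratio_compare y (fun N => \prod_(k < N.+2) dq (sigma + k%:R) y)).
  exact: dq_gt0.
exists n0 => N n0N; split; last exact: gratio_upper.
elim: N n0N => [|N IH]; first by rewrite leqn0.
rewrite leq_eqVlt => /predU1P[<-|]; last first.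
  rewrite ltnS => n0N; rewrite [in leRHS]big_ord_recr [in leLHS]big_ord_recr /= mulrAC.
  apply: ler_pM; [|exact: dq_ge0|exact: IH|].
    by apply: mulr_ge0; [exact/ltW/(prod_dq_gt0 (fun k => alpha * sigma + k%:R))|exact: sqr_ge0].
  apply: dq_le; rewrite ?(ltW alpha0)// ?ltr_wpDr//.
  by rewrite mulrDr lerD2l hn0.
rewrite [in leRHS]big_ord_recr [in leRHS]big_ord_recr /= expr2 mulrA.
apply: ler_pM; [|exact: dq_ge0| |by []].
  by apply: mulr_ge0; [exact/ltW/(prod_dq_gt0 (fun k => alpha * sigma + k%:R))|exact: dq_ge0].
apply: ler_pM; [|exact: dq_ge0| |].
- exact/ltW/(prod_dq_gt0 (fun k => alpha * sigma + k%:R)).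
- apply: ler_prod => k _; rewrite ltW ?dq_gt0//=.
  apply: dq_le; rewrite ?(ltW alpha0)// ?ltr_wpDr//.
  by rewrite mulrDr lerD2l -[leRHS]mul1r ler_wpM2r// ltW.
- by apply: dq_anti; rewrite ?ltr_wpDr// lerD2l ler_nat.
Qed.

Lemma nrm_Gamma_ratio y : nrm (Gamma_ratio alpha (sigma +i* y)) =
  gratio sigma y / gratio (alpha * sigma) (alpha * y) *
  (Gamma_real sigma / Gamma_real (alpha * sigma)).
Proof.
rewrite /Gamma_ratio nrmM nrmV.
have -> : alpha%:C * (sigma +i* y) = (alpha * sigma) +i* (alpha * y).
  by apply: complex_eq; rewrite ?Re_realM ?Im_realM.
rewrite !nrm_GammaE//.
have h1 := gratio_gt0 (alpha * y) as0; have h2 := Gamma_real_gt0 as0.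
by field; rewrite !gt_eqF.
Qed.

Definition ratio_cst := 2 * (Gamma_real sigma / Gamma_real (alpha * sigma)).

(** Boundedness transfers square integrability from the Mellin transform of f to its product with
    the quotient. *)
Lemma Gamma_ratio_le y : alpha <= 1 ->
  nrm (Gamma_ratio alpha (sigma +i* y)) <= ratio_cst.
Proof.
move=> a1; rewrite nrm_Gamma_ratio /ratio_cst ler_wpM2r//.
  by rewrite divr_ge0 ?Gamma_real_ge0.
by rewrite ler_pdivrMr ?gratio_gt0// gratio_le.
Qed.

(** The decay of order y^{-2} makes the contour integral that defines [Phi] absolutely
    convergent. *)
Lemma Gamma_ratio_decay : alpha < 1 -> exists2 a, 0 < a & forall y,
  nrm (Gamma_ratio alpha (sigma +i* y)) * dq a y <= ratio_cst.
Proof.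
move=> a1; have [a a0 H] := gratio_decay a1; exists a => // y.
rewrite nrm_Gamma_ratio /ratio_cst mulrAC ler_wpM2r//.
  by rewrite divr_ge0 ?Gamma_real_ge0.
by rewrite mulrAC ler_pdivrMr ?gratio_gt0.
Qed.

End compare.
End Gamma_ratio_bounds.

(** * Measurability of parametric integrals *)

Section parametric_integrals.
Variable R : realType.
Local Notation mu := (@lebesgue_measure R).
Local Notation T := (measurableTypeR R).
Implicit Types (D : set T).

(* The weight [w] makes the parametric integral integrable in [x], so that its
   measurability comes with Fubini. *)
Lemma cmeas_param D1 D2 (F : T -> T -> R[i]) (a b : T -> R) :
  measurable D1 -> measurable D2 ->
  cmeas (D1 `*` D2) (fun p => F p.1 p.2) ->
  measurable_fun D1 a -> (forall x, D1 x -> 0 <= a x) ->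
  mu.-integrable D2 (EFin \o b) -> (forall y, D2 y -> 0 <= b y) ->
  (forall x y, D1 x -> D2 y -> nrm (F x y) <= a x * b y) ->
  cmeas D1 (fun x => cintegral D2 (F x)).
Proof.
move=> mD1 mD2 mF ma a0 ib b0 Fab.
pose w x : R := poisson 1 x * (1 + a x) `^ (-1).
have w0 x : D1 x -> 0 < w x.
  move=> D1x; rewrite mulr_gt0//; first by rewrite divr_gt0// poisson_den_gt0.
  by rewrite powR_gt0// ltr_pwDl// a0.
have mw : measurable_fun D1 w.
  apply: measurable_funM; first exact: measurable_funTS (measurable_poisson ltr01).
  have m1 : measurable_fun D1 (fun x => 1 + a x).
    by apply: measurable_funD => //; exact: measurable_cst.
  exact: (measurableT_comp (@measurable_powR R (-1)) m1).
have mw12 : cmeas (D1 `*` D2) (fun p => (w p.1)%:C).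
  apply: cmeas_real; apply: (measurable_comp mD1 _ mw); first by move=> _ [p [? ?] <-].
  by apply: measurable_funTS; exact: measurable_fst.
have ip1 : mu.-integrable D1 (EFin \o poisson 1).
  exact: (integrableS (measurableT) mD1 (@subsetT _ _) (integrable_poisson1 R)).
have Fi x : D1 x -> cintegrable D2 (F x).
  move=> D1x; apply: (cintegrable_le mD2 _ _ (integrable_realZ (a x) mD2 ib)).
    by split; [exact: (@measurable_section1 R D1 D2 (fun x y => Cre (F x y)) x D1x mD1 mD2 mF.1)|
      exact: (@measurable_section1 R D1 D2 (fun x y => Cim (F x y)) x D1x mD1 mD2 mF.2)].
  by move=> y D2y; exact: Fab.
have [|wi _ _] := @cfubini R D1 D2 (fun x y => (w x)%:C * F x y) (poisson 1) b mD1 mD2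
  (cmeasM mw12 mF) ip1 ib _.
  move=> x y D1x D2y; rewrite nrmM nrm_real gtr0_norm ?w0//.
  have a1 : 0 < 1 + a x by rewrite ltr_pwDl// a0.
  rewrite /w powR_inv1 ?(ltW a1)// -mulrA.
  have p0 := poisson_ge0 x (@ltr01 R).
  rewrite ler_wpM2l// ler_pdivrMl//; apply: le_trans (Fab _ _ D1x D2y) _.
  by rewrite ler_wpM2r ?b0// lerDr.
have mV : cmeas D1 (fun x => ((w x)^-1)%:C).
  apply: cmeas_real; apply: (eq_measurable_fun (fun x => w x `^ (-1))).
    by move=> x; rewrite inE => D1x; rewrite powR_inv1// ltW// w0.
  exact: (measurableT_comp (@measurable_powR R (-1)) mw).
apply: (eq_cmeas _ (cmeasM mV (cintegrable_cmeas wi))) => x D1x.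
rewrite (cintegralZ _ mD2 (Fi _ D1x)) mulrA -realcM mulVf ?mul1r//.
by rewrite gt_eqF // w0.
Qed.

End parametric_integrals.

(** * The Cahen-Mellin integral *)

Section line_transforms.
Variable R : realType.
Local Notation mu := (@lebesgue_measure R).
Local Notation T := (measurableTypeR R).
Implicit Types (h : T -> R) (e v : R) (s : R[i]).

Lemma Rintegral_line h : mu.-integrable setT (EFin \o h) ->
  \int[mu]_x h x = \int[mu]_(x in @Rplus R) h x + \int[mu]_(x in @Rplus R) h (- x).
Proof.
move=> hi; have mR := @measurable_Rplus R.
pose N : set T := `]-oo, 0]%classic.
have mN : measurable N by exact: measurable_itv.
have UE : [set: T] = @Rplus R `|` N.
  apply/seteqP; split => // x _; rewrite /setU /= RplusE /N /= in_itv/=.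
  by have [?|?] := ltP 0 x; [left|right].
have dis : [disjoint @Rplus R & N].
  apply/eqP/seteqP; split => // x [] /=; rewrite RplusE /N /= in_itv/= => x0.
  by rewrite leNgt x0.
rewrite UE Rintegral_setU -?UE//; congr (_ + _).
have hN : mu.-integrable N (EFin \o h) by exact: (integrableS measurableT mN _ hi).
have n1 : (-1 : R) != 0 by rewrite oppr_eq0 oner_eq0.
rewrite (Rintegral_scale n1 mN hN) normrN normr1 mul1r.
have -> : scl (-1) @^-1` N = `[0, +oo[%classic.
  by apply/seteqP; split => x; rewrite /preimage /N /scl /= !in_itv/= mulN1r oppr_le0 andbT.
have -> : (fun x => h (scl (-1) x)) = (fun x => h (- x)).
  by apply/funext => x; rewrite /scl mulN1r.
rewrite -Rintegral_itv_obnd_cbnd//.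
have := integrable_scale n1 measurableT hi; rewrite preimage_setT.
have -> : (fun x => (EFin \o h) (scl (-1) x)) = EFin \o (fun x => h (- x)).
  by apply/funext => x; rewrite /scl /= mulN1r.
by apply: integrableS.
Qed.

Lemma cintegral_line (f : T -> R[i]) : cintegrable setT f ->
  cintegral setT f = cintegral (@Rplus R) f + cintegral (@Rplus R) (fun x => f (- x)).
Proof.
move=> [i1 i2]; apply: complex_eq; rewrite ?ReD ?ImD /=; exact: Rintegral_line.
Qed.

Lemma cintegral_cexp s : 0 < Cre s ->
  cintegrable (@Rplus R) (fun y => cexp (- s * y%:C)) /\
  cintegral (@Rplus R) (fun y => cexp (- s * y%:C)) = s^-1.
Proof.
move=> s0; have mR := @measurable_Rplus R.
have s_neq0 : s != 0.
  by apply: contraTneq s0 => ->; rewrite ltxx.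
have nE y : nrm (cexp (- s * y%:C)) = expR (- (Cre s * y)).
  by rewrite nrm_cexp Re_Mreal ReN mulNr.
have fi : cintegrable (@Rplus R) (fun y => cexp (- s * y%:C)).
  have [C C0 HC] := exp_le_poisson s0.
  have ip : mu.-integrable (@Rplus R) (EFin \o poisson 1).
    exact: (integrableS measurableT mR (@subsetT _ _) (integrable_poisson1 R)).
  apply: (cintegrable_le mR _ _ (integrable_realZ C mR ip)).
    by apply: cmeas_cexp; apply: cmeasM; [exact: cmeas_cst|exact: cmeas_id].
  move=> y; rewrite RplusE => y0; rewrite nE.
  by have := HC y; rewrite gtr0_norm.
split => //.
pose F y := - s^-1 * cexp (- s * y%:C).
have nF y : nrm (F y) = nrm s^-1 * expR (- (Cre s * y)) by rewrite nrmM nrmN nE.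
have lim0 (h : R[i] -> R) : (forall z, `|h z| <= nrm z) ->
    h (F x) @[x --> +oo] --> 0.
  move=> hz; apply: (@cvg0_squeeze R _ _ _ (fun x => (nrm s^-1 * (Cre s)^-1) * x^-1)); last exact: cvgy_inv.
  near=> x; have x0 : 0 < x by near: x; apply: nbhs_pinfty_gt; rewrite num_real.
  apply: le_trans (hz _) _; rewrite nF -mulrA ler_wpM2l ?nrm_ge0//.
  have sx : 0 < Cre s * x by rewrite mulr_gt0.
  apply: le_trans (expRN_le_powR ltr01 sx) _.
  by rewrite powR1 mul1r powR_inv1 ?(ltW sx)// invfM.
have dF (x : R) : is_cderive x F (cexp (- s * x%:C)).
  apply: is_cderive_eq (is_cderive_scale (- s^-1) (is_cderive_cexpM x (- s))) _.
  by rewrite mulrA mulrNN mulVf// mul1r.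
have F0 : F 0 = - s^-1.
  by rewrite /F mulr0 (cexp_real 0) expR0 mulr1.
have [c1 c2] := is_cderive_continuous (dF 0).
rewrite -[RHS]opprK -[RHS]add0r -F0.
apply: (@cRplus_FTC _ (fun y => cexp (- s * y%:C)) F) => //.
- by move=> x x0; exact: (is_cderive_continuous (is_cderive_cexpM x (- s))).
- exact: (cvg_at_right_filter c1).
- exact: (cvg_at_right_filter c2).
- exact: (lim0 (@complex.Re R) (@le_Re_nrm R)).
- exact: (lim0 (@complex.Im R) (@le_Im_nrm R)).
Unshelve. all: by end_near. Qed.

Definition abel_kernel e v y : R[i] := (expR (- (e * `|y|)))%:C * cexp (0 +i* (v * y)).

Lemma nrm_abel_kernel e v y : nrm (abel_kernel e v y) = expR (- (e * `|y|)).
Proof. by rewrite nrmM nrm_real ger0_norm ?expR_ge0// nrm_cexp expR0 mulr1. Qed.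

Lemma integrable_exp_abs e : 0 < e ->
  mu.-integrable [set: T] (fun y => (expR (- (e * `|y|)))%:E).
Proof.
move=> e0; have [C C0 HC] := exp_le_poisson e0.
apply: (le_integrable measurableT _ _ (integrable_realZ C measurableT (integrable_poisson1 R))).
  apply/measurable_EFinP; apply: measurableT_comp => //.
  by apply: measurableT_comp => //; apply: measurable_funM.
move=> y _; rewrite /= lee_fin ger0_norm ?expR_ge0//.
exact: le_trans (HC y) (ler_norm _).
Qed.

Lemma cmeas_abel_kernel e v : cmeas [set: T] (abel_kernel e v).
Proof.
apply: cmeasM.
  apply: cmeas_real; apply: measurableT_comp => //.
  by apply: measurableT_comp => //; apply: measurable_funM.
by apply: cmeas_cexp; apply: cmeas_Complex.
Qed.

(** The two half-lines contribute 1/(e - i v) and 1/(e + i v), whose sum is 2 e/(e^2 + v^2). *)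
Lemma cintegral_abel_kernel e v : 0 < e ->
  cintegral [set: T] (abel_kernel e v) = (2 * poisson e v)%:C.
Proof.
move=> e0.
have fi : cintegrable [set: T] (abel_kernel e v).
  apply: (cintegrable_le measurableT (@cmeas_abel_kernel e v) _ (integrable_exp_abs e0)).
  by move=> y _; rewrite nrm_abel_kernel.
rewrite cintegral_line//.
have [_ E1] := @cintegral_cexp (e -i* v) e0.
have [_ E2] := @cintegral_cexp (e +i* v) e0.
have -> : cintegral (@Rplus R) (abel_kernel e v) = (e -i* v)^-1.
  rewrite -E1; apply: eq_cintegral => y; rewrite RplusE => y0.
  rewrite /abel_kernel gtr0_norm// -cexp_real -cexpD; congr cexp.
  by apply: complex_eq => /=; ring.
have -> : cintegral (@Rplus R) (fun y => abel_kernel e v (- y)) = (e +i* v)^-1.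
  rewrite -E2; apply: eq_cintegral => y; rewrite RplusE => y0.
  rewrite /abel_kernel normrN gtr0_norm// -cexp_real -cexpD; congr cexp.
  by apply: complex_eq => /=; ring.
have d0 := poisson_den_gt0 v e0.
by apply: complex_eq; rewrite ?ReD ?ImD /= /poisson ?sqrrN; field; rewrite gt_eqF.
Qed.

End line_transforms.

(** * Abel summation of the Cahen-Mellin integral *)

Section Cahen_Mellin.
Variable R : realType.
Local Notation mu := (@lebesgue_measure R).
Local Notation T := (measurableTypeR R).
Implicit Types (D : set (T * T)) (x y t e d sigma a : R).

Lemma measurable_fst' D : measurable_fun D (fun p : T * T => p.1 : R).
Proof. by apply: measurable_funTS; exact: measurable_fst. Qed.

Lemma measurable_snd' D : measurable_fun D (fun p : T * T => p.2 : R).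
Proof. by apply: measurable_funTS; exact: measurable_snd. Qed.

Lemma dqV a y : 0 < a -> (dq a y)^-1 = a * poisson a y.
Proof.
move=> a0; have d0 := poisson_den_gt0 y a0; have q0 := dq_gt0 a y.
rewrite /poisson; apply: (mulfI (lt0r_neq0 q0)); rewrite mulfV ?gt_eqF// /dq.
by field; rewrite !gt_eqF.
Qed.

Lemma integrable_dqV a : 0 < a -> mu.-integrable [set: T] (fun y => ((dq a y)^-1)%:E).
Proof.
move=> a0; have [h _] := @integral_poisson R a 0 a0.
have h' : mu.-integrable [set: T] (EFin \o poisson a).
  by apply: eq_integrable h => // y _; rewrite subr0.
apply: (eq_integrable measurableT _ _ _ (integrable_realZ a measurableT h')) => y _.
by rewrite /= dqV.
Qed.

Lemma cmeas_Gamma_joint sigma D : cmeas D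
  (fun p : T * T => Gamma_integrand (sigma +i* p.1) p.2).
Proof.
apply: cmeasM.
  apply: cmeas_real; apply: (measurableT_comp (@measurable_expRN R setT)).
  exact: measurable_snd'.
apply: cmeas_cpow; first exact: measurable_snd'.
apply: cmeasB; last exact: cmeas_cst.
by apply: cmeas_Complex; [exact: measurable_cst|exact: measurable_fst'].
Qed.

Lemma cmeas_Gamma_line sigma : 0 < sigma ->
  cmeas [set: T] (fun y => Gamma (sigma +i* y)).
Proof.
move=> s0; apply: (@cmeas_param R setT (@Rplus R)
  (fun y t => Gamma_integrand (sigma +i* y) t) (cst 1)
  (fun t => expR (- t) * t `^ (sigma - 1))) => //.
- exact: measurable_Rplus.
- exact: cmeas_Gamma_joint.
- exact: integrable_Gamma_real.
- by move=> t _; rewrite mulr_ge0 ?expR_ge0 ?powR_ge0.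
- by move=> y t _; rewrite RplusE => t0; rewrite nrm_Gamma_integrand// mul1r.
Qed.

Lemma Gamma_line_le sigma y : 0 < sigma ->
  nrm (Gamma (sigma +i* y)) <= Gamma_real sigma * (dq (sigma + 3) y)^-1 ^+ 2.
Proof.
move=> s0; rewrite exprVn ler_pdivlMr ?exprn_gt0 ?dq_gt0//.
exact: Gamma_decay.
Qed.

Lemma dqV_le1 a y : (dq a y)^-1 <= 1.
Proof. by rewrite invf_le1 ?dq_gt0// dq_ge1. Qed.

Lemma dqV_ge0 a y : 0 <= (dq a y)^-1.
Proof. by rewrite invr_ge0 dq_ge0. Qed.

Lemma Gamma_line_le1 sigma y : 0 < sigma ->
  nrm (Gamma (sigma +i* y)) <= Gamma_real sigma * (dq (sigma + 3) y)^-1.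
Proof.
move=> s0; apply: le_trans (Gamma_line_le y s0) _.
by rewrite ler_wpM2l ?Gamma_real_ge0// expr2 ler_piMl ?dqV_ge0// dqV_le1.
Qed.

Lemma integrable_Gamma_bound sigma : 0 < sigma ->
  mu.-integrable [set: T] (fun y => (Gamma_real sigma * (dq (sigma + 3) y)^-1)%:E).
Proof.
move=> s0; have a0 : 0 < sigma + 3 by lra.
exact: (integrable_realZ (Gamma_real sigma) measurableT (integrable_dqV a0)).
Qed.

Lemma cmeas_cpow_line x sigma : cmeas [set: T] (fun y => cpow x (- (sigma +i* y))).
Proof.
apply: cmeas_cpow; first exact: measurable_cst.
by apply: cmeasN; exact: cmeas_Complex.
Qed.

Lemma nrm_cpow_line x sigma y : 0 < x -> nrm (cpow x (- (sigma +i* y))) = x `^ (- sigma).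
Proof. by move=> x0; rewrite nrm_cpow// ReN. Qed.

(** Away from 0 the kernel is at most e times a fixed integrable function, because 1 + v^2 <= (1 +
    d^{-2}) v^2 for |v| >= d. *)
Lemma poisson_tail e d v : 0 < e -> 0 < d -> d <= `|v| ->
  poisson e v <= e * (1 + d ^- 2) * poisson 1 v.
Proof.
move=> e0 d0 dv; rewrite /poisson expr1n -mulrA ler_wpM2l ?(ltW e0)// mulrA mulr1.
have v2 : d ^+ 2 <= v ^+ 2.
  by rewrite -[v ^+ 2]real_normK ?num_real// ler_pXn2r ?nnegrE ?(ltW d0).
have d2 : 0 < d ^+ 2 by rewrite exprn_gt0.
rewrite ler_pdivlMr; last by rewrite ltr_pwDl// sqr_ge0.
rewrite mulrC ler_pdivrMr ?poisson_den_gt0//.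
have e2 : 0 <= e ^+ 2 by exact: sqr_ge0.
apply: (@le_trans _ _ ((1 + d ^- 2) * v ^+ 2)); last first.
  have D0 : 0 <= 1 + d ^- 2 by rewrite addr_ge0// invr_ge0 (ltW d2).
  by rewrite ler_wpM2l// lerDr.
rewrite mulrDl mul1r addrC lerD2l.
by rewrite mulrC ler_pdivlMr// mul1r.
Qed.

Lemma cpow_line_mul x t sigma y : 0 < x -> 0 < t ->
  cpow x (- (sigma +i* y)) * cpow t (sigma +i* y) =
  ((t / x) `^ sigma)%:C * cexp (0 +i* ((ln t - ln x) * y)).
Proof.
move=> x0 t0; have tx : 0 < t / x by rewrite divr_gt0.
have E : - (sigma +i* y) * (ln x)%:C + (sigma +i* y) * (ln t)%:C =
    (sigma * ln (t / x))%:C + (0 +i* ((ln t - ln x) * y)).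
  by rewrite ln_div ?posrE//; apply: complex_eq => /=; ring.
rewrite (powR_exp _ tx) -(cexp_real (sigma * _)) -(cexpD (sigma * _)%:C) -E.
by rewrite [RHS](cexpD _ _).
Qed.

Section fixed.
Variables (sigma x : R).
Hypotheses (sigma0 : 0 < sigma) (x0 : 0 < x).

(** The function whose Poisson mean appears after Fubini: e^{-t} from Euler's integral and
    (t/x)^sigma from the two powers on the line. Its value at t = x is e^{-x}. *)
Let phi t := expR (- t) * (t / x) `^ sigma.
Let S y : R[i] := sigma +i* y.
Let h y := Gamma (S y) * cpow x (- S y).

(** Continuity at x is measured in ln t, the variable in which the Poisson kernel concentrates. *)
Let phi_continuous d : 0 < d -> exists2 r, 0 < r &
  forall t, 0 < t -> `|ln t - ln x| < r -> `|phi t - phi x| <= d.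
Proof.
move=> d0; pose psi v := expR (- expR v) * expR (sigma * (v - ln x)).
have cpsi : {for ln x, continuous psi}.
  apply: cvgM.
    apply: (continuous_comp (f := fun v => - expR v)); last exact: continuous_expR.
    by apply: cvgN; exact: continuous_expR.
  apply: (continuous_comp (f := fun v => sigma * (v - ln x))); last exact: continuous_expR.
  by apply: cvgM; [exact: cvg_cst|apply: cvgB; [exact: cvg_id|exact: cvg_cst]].
have E t : 0 < t -> phi t = psi (ln t).
  move=> t0; rewrite /phi /psi lnK ?posrE// powR_exp ?divr_gt0//.
  by rewrite ln_div.
move/cvgrPdist_le : cpsi => /(_ _ d0) /nbhs_ballP[r /= r0 Hr]; exists r => // t t0 tr.
rewrite distrC !E//; apply: Hr.
by rewrite /ball /= distrC.
Qed.

Let phi_bound : exists2 B, 0 < B & forall t, 0 < t -> `|phi t - phi x| <= B.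
Proof.
(* The first term bounds phi by [expRN_le_powR] with exponent sigma; the final 1 gives strict
   positivity. *)
pose B := sigma `^ sigma * x `^ (- sigma) + phi x + 1.
have px : 0 <= phi x by rewrite mulr_ge0 ?expR_ge0 ?powR_ge0.
exists B; first by rewrite ltr_wpDl// addr_ge0// mulr_ge0 ?powR_ge0.
move=> t t0; apply: (le_trans (ler_normB _ _)); rewrite (ger0_norm px).
have pt : 0 <= phi t by rewrite mulr_ge0 ?expR_ge0 ?powR_ge0.
rewrite (ger0_norm pt) -[leLHS]addr0 lerD// lerD2r.
have xi : 0 <= x^-1 by rewrite invr_ge0 ltW.
rewrite /phi powRM ?(ltW t0)// -[x^-1]powR_inv1 ?(ltW x0)// -powRrM mulN1r mulrA.
rewrite ler_wpM2r ?powR_ge0//.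
apply: (le_trans (ler_wpM2r (powR_ge0 _ _) (expRN_le_powR sigma0 t0))).
by rewrite -mulrA -powRD ?(gt_eqF t0) ?implybT// addNr powRr0 mulr1.
Qed.

Let measurable_phi : measurable_fun (@Rplus R : set T) phi.
Proof.
apply: measurable_funM; first exact: measurable_expRN.
have m1 : measurable_fun (@Rplus R : set T) (fun t : T => t / x).
  by apply: measurable_funM => //; exact: measurable_cst.
exact: (measurableT_comp (@measurable_powR R sigma) m1).
Qed.

Let integrable_phi_poisson e : 0 < e -> mu.-integrable (@Rplus R)
    (EFin \o (fun t => phi t * (poisson e (ln t - ln x) / t))).
Proof.
move=> e0; have mR := @measurable_Rplus R.
have [B B0 HB] := phi_bound; have [ip _] := integral_poisson_ln (ln x) e0.
have px : 0 <= phi x by rewrite mulr_ge0 ?expR_ge0 ?powR_ge0.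
apply: (le_integrable mR _ _ (integrable_realZ (B + phi x) mR ip)).
  apply/measurable_EFinP; apply: measurable_funM; last first.
    by apply/measurable_EFinP; exact: measurable_int ip.
  exact: measurable_phi.
move=> t; rewrite RplusE => t0; rewrite /= lee_fin normrM [leRHS]normrM.
rewrite ler_wpM2r// [leRHS]ger0_norm ?addr_ge0 ?(ltW B0)//.
by rewrite -[phi t](subrK (phi x)) (le_trans (ler_normD _ _))// lerD ?HB// ger0_norm.
Qed.

(* Abel summation: with the factor [e^{- e |y|}], Fubini turns the integral into
   a Poisson mean of [phi] in the variable [ln t], which tends to [phi x]. *)
Let abelized e := cintegral [set: T] (fun y => (expR (- (e * `|y|)))%:C * h y).

Let cmeas_h : cmeas [set: T] h.
Proof. by apply: cmeasM; [exact: cmeas_Gamma_line|exact: cmeas_cpow_line]. Qed.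

Let nrm_h y : nrm (h y) = nrm (Gamma (S y)) * x `^ (- sigma).
Proof. by rewrite nrmM nrm_cpow_line. Qed.

Let cmeas_exp_abs e : cmeas [set: T] (fun y => (expR (- (e * `|y|)))%:C).
Proof.
apply: cmeas_real; apply: measurableT_comp => //.
by apply: measurableT_comp => //; apply: measurable_funM.
Qed.

Let abelizedE e : 0 < e -> abelized e =
  (2 * \int[mu]_(t in @Rplus R) (phi t * (poisson e (ln t - ln x) / t)))%:C.
Proof.
move=> e0; have mR := @measurable_Rplus R.
pose F (y t : T) : R[i] := (expR (- (e * `|y|)))%:C * cpow x (- S y) * Gamma_integrand (S y) t.
have iG := integrable_Gamma_real sigma0.
have ie := integrable_exp_abs e0.
have [||_ _ E] := @cfubini R setT (@Rplus R) F
  (fun y => x `^ (- sigma) * expR (- (e * `|y|))) (fun t => expR (- t) * t `^ (sigma - 1))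
  measurableT mR _ (integrable_realZ _ measurableT ie) iG.
- apply: cmeasM; last exact: cmeas_Gamma_joint.
  have /= := @cmeas_comp _ _ _ _ R setT (setT `*` @Rplus R)
    (fun y : T => (expR (- (e * `|y|)))%:C * cpow x (- S y)) (fun p : T * T => p.1).
  apply => //; first exact: measurable_fst'.
  by apply: cmeasM; [exact: cmeas_exp_abs|exact: cmeas_cpow_line].
- move=> y t _; rewrite RplusE => t0.
  rewrite nrmM nrm_Gamma_integrand// nrmM (nrm_cpow_line sigma y x0) nrm_real.
  by rewrite ger0_norm ?expR_ge0// [X in X * _]mulrC.
transitivity (cintegral setT (fun y => cintegral (@Rplus R) (F y))).
  apply: eq_cintegral => y _.
  have iGy := cintegrable_Gamma (sigma0 : 0 < Cre (S y)).
  rewrite (cintegralZ ((expR (- (e * `|y|)))%:C * cpow x (- S y)) mR iGy) -mulrA.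
  by congr (_ * _); rewrite mulrC.
have iphi : mu.-integrable (@Rplus R)
    (EFin \o (fun t => phi t * (poisson e (ln t - ln x) / t))).
  exact: integrable_phi_poisson.
apply: (etrans E); rewrite -(RintegralZl _ mR iphi).
apply: etrans (cintegral_real _ _); apply: eq_cintegral => t; rewrite RplusE => t0.
have fi : cintegrable [set: T] (abel_kernel e (ln t - ln x)).
  apply: (cintegrable_le measurableT (cmeas_abel_kernel _ _) _ ie).
  by move=> y _; rewrite nrm_abel_kernel.
transitivity (cintegral setT (fun y : T => (phi t / t)%:C * abel_kernel e (ln t - ln x) y)).
  apply: eq_cintegral => y _.
  rewrite /F /abel_kernel /Gamma_integrand (cpowB1 (S y) t0).
  have E1 := cpow_line_mul sigma y x0 t0; rewrite -/(S y) in E1.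
  transitivity ((expR (- (e * `|y|)))%:C * (expR (- t))%:C * (t^-1)%:C *
    (cpow x (- S y) * cpow t (S y))); first by ring.
  by rewrite E1 /phi !realcM; ring.
apply: (etrans (cintegralZ (phi t / t)%:C measurableT fi)).
rewrite (cintegral_abel_kernel _ e0); move: (phi t) => p.
by rewrite -realcM; congr (_%:C); ring.
Qed.

(** The regularized integral is within e [K1] of the integral and within 2 d pi + e [K2] of 2 pi
    e^{-x}, where [K2] depends on d only. First e tends to 0, then d. *)
Lemma Cahen_Mellin : cintegral [set: T] h = (2 * pi * expR (- x))%:C.
Proof.
have mR := @measurable_Rplus R.
have a0 : 0 < sigma + 3 by rewrite addr_gt0.
set a := sigma + 3 in a0.
have iG := integrable_Gamma_bound sigma0.
have hi : cintegrable [set: T] h.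
  apply: (cintegrable_le measurableT cmeas_h _ (integrable_realZ (x `^ (- sigma)) measurableT iG)).
  by move=> y _; rewrite nrm_h mulrC ler_wpM2l ?powR_ge0// Gamma_line_le1.
have phix : phi x = expR (- x).
  by rewrite /phi divff ?gt_eqF// powR1 mulr1.
pose K1 := \int[mu]_(y in setT) (a * x `^ (- sigma) * (Gamma_real sigma * (dq a y)^-1)).
(* Here 1 - e^{- e |y|} <= e |y|, and the factor |y| is absorbed by one of the two inverse factors
   [dq] in the decay of Gamma. *)
have st1 e : 0 < e -> nrm (abelized e - cintegral setT h) <= e * K1.
  move=> e0.
  have i1 : cintegrable [set: T] (fun y => (expR (- (e * `|y|)))%:C * h y).
    apply: (cintegrable_le measurableT (cmeasM (cmeas_exp_abs e) cmeas_h) _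
      (cintegrable_nrm measurableT hi)).
    move=> y _; rewrite nrmM nrm_real ger0_norm ?expR_ge0// ler_piMl ?nrm_ge0//.
    by rewrite expR_le1 oppr_le0 mulr_ge0// ltW.
  rewrite -cintegralB// /K1 -RintegralZl//; last exact: integrable_realZ.
  apply: cintegral_nrm_le => //.
  - exact: cmeasB (cmeasM (cmeas_exp_abs e) cmeas_h) cmeas_h.
  - move=> y _.
    rewrite -[X in _ - X]mul1r -mulrBl nrmM nrm_h.
    have -> : (expR (- (e * `|y|)))%:C - 1 = (expR (- (e * `|y|)) - 1)%:C :> R[i].
      by rewrite rmorphB.
    rewrite nrm_real.
    have b1 : `|expR (- (e * `|y|)) - 1| <= e * `|y|.
      have ey : 0 <= e * `|y| by rewrite mulr_ge0// ltW.
      rewrite ler0_norm ?subr_le0 ?expR_le1 ?oppr_le0// opprB lerBlDr -lerBlDl.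
      by have := expR_ge1Dx (- (e * `|y|)); lra.
    have b2 : `|y| * (dq a y)^-1 <= a.
      rewrite ler_pdivrMr ?dq_gt0// mulrC -ler_pdivrMr// /dq.
      have -> : (y / a) ^+ 2 = (`|y| / a) ^+ 2.
        by rewrite !exprMn real_normK ?num_real.
      by have := sqr_ge0 (`|y| / a - 1 / 2); rewrite sqrrB; lra.
    have b3 := Gamma_line_le y sigma0; rewrite -/a in b3.
    have x1 := powR_ge0 x (- sigma); have G0 := Gamma_real_ge0 sigma.
    have q0 := dqV_ge0 a y; have n0 := nrm_ge0 (Gamma (sigma +i* y)).
    apply: (@le_trans _ _ (e * `|y| * (Gamma_real sigma * (dq a y)^-1 ^+ 2 * x `^ (- sigma)))).
      by apply: ler_pM => //; [exact: mulr_ge0|rewrite ler_wpM2r].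
    move: (x `^ _) (Gamma_real sigma) (dq a y)^-1 x1 G0 q0 b2 => X G q X0 G0 q0 b2.
    have -> : e * `|y| * (G * q ^+ 2 * X) = (`|y| * q) * (e * X * G * q) by ring.
    have -> : e * (a * X * (G * q)) = a * (e * X * G * q) by ring.
    by apply: ler_wpM2r => //; rewrite !mulr_ge0 ?(ltW e0).
  - exact: (integrable_realZ _ measurableT (integrable_realZ _ measurableT iG)).
clearbody K1.
(* The Poisson mean of phi(t) - phi(x) is split at |ln t - ln x| = r: inside, phi varies by at most
   d; outside, [poisson_tail] provides a factor e. *)
have st2 d : 0 < d -> exists K2, forall e, 0 < e ->
    nrm (abelized e - (2 * pi * expR (- x))%:C) <= 2 * (d * pi) + e * K2.
  move=> d0; have [r r0 Hr] := phi_continuous d0; have [B B0 HB] := phi_bound.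
  exists (2 * (B * (1 + r ^- 2) * pi)) => e e0.
  have [ip Ip] := integral_poisson_ln (ln x) e0.
  have [ip1 Ip1] := integral_poisson_ln (ln x) (@ltr01 R).
  have id := integrable_realZ d mR ip.
  have iB := integrable_realZ (e * (B * (1 + r ^- 2))) mR ip1.
  have iphi : mu.-integrable (@Rplus R)
      (EFin \o (fun t => phi t * (poisson e (ln t - ln x) / t))).
    exact: integrable_phi_poisson.
  rewrite abelizedE// -rmorphB nrm_real /= -mulrA -mulrBr normrM ger0_norm//.
  rewrite [e * (2 * _)]mulrCA -phix.
  have -> : pi * phi x = \int[mu]_(t in @Rplus R) (phi x * (poisson e (ln t - ln x) / t)).
    by rewrite RintegralZl// Ip mulrC.
  rewrite -RintegralB//; last exact: integrable_realZ.
  rewrite -mulrDr ler_pM2l//.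
  have -> : d * pi + e * (B * (1 + r ^- 2) * pi) = \int[mu]_(t in @Rplus R)
     (d * (poisson e (ln t - ln x) / t) +
      e * (B * (1 + r ^- 2)) * (poisson 1 (ln t - ln x) / t)).
    by rewrite RintegralD// !RintegralZl// Ip Ip1 !mulrA.
  apply: (le_trans (le_normr_Rintegral mR _)).
    exact: (integrableB mR iphi (integrable_realZ (phi x) mR ip)).
  apply: le_Rintegral => //.
  - exact: (integrable_norm (integrableB mR iphi (integrable_realZ (phi x) mR ip))).
  - exact: (integrableD mR id iB).
  - move=> t; rewrite RplusE => t0; rewrite -mulrBl normrM.
    have ti : 0 < t^-1 by rewrite invr_gt0.
    have p0 := poisson_ge0 (ln t - ln x) e0; have p1 := poisson_ge0 (ln t - ln x) (@ltr01 R).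
    have pt0 : 0 <= poisson e (ln t - ln x) / t by exact: mulr_ge0 p0 (ltW ti).
    rewrite (ger0_norm pt0) [d * _]mulrA [e * _ * (_ / t)]mulrA -mulrDl mulrA ler_pM2r//.
    have ri : 0 <= r ^- 2 by rewrite invr_ge0 exprn_ge0 ?(ltW r0).
    have [tr|tr] := ltP `|ln t - ln x| r.
      apply: (@le_trans _ _ (d * poisson e (ln t - ln x))); first by rewrite ler_wpM2r ?Hr.
      rewrite lerDl; apply: mulr_ge0 => //; apply: mulr_ge0; first exact: ltW.
      by apply: mulr_ge0; [exact: ltW|exact: addr_ge0].
    have pt := poisson_tail e0 r0 tr.
    apply: (@le_trans _ _ (B * (e * (1 + r ^- 2) * poisson 1 (ln t - ln x)))).
      by apply: ler_pM => //; exact: HB.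
    have -> : B * (e * (1 + r ^- 2) * poisson 1 (ln t - ln x)) =
      e * (B * (1 + r ^- 2)) * poisson 1 (ln t - ln x) by ring.
    by rewrite lerDr; apply: mulr_ge0 => //; exact: ltW.
apply/eqP; rewrite -subr_eq0 -nrm_eq0 eq_le nrm_ge0 andbT.
have key d : 0 < d -> nrm (cintegral setT h - (2 * pi * expR (- x))%:C) <= 2 * (d * pi).
  move=> d0; have [K2 HK2] := st2 _ d0.
  have bound e : 0 < e -> nrm (cintegral setT h - (2 * pi * expR (- x))%:C) <=
      2 * (d * pi) + e * (K1 + K2).
    move=> e0; have h1 := st1 _ e0; have h2 := HK2 _ e0.
    have -> : cintegral setT h - (2 * pi * expR (- x))%:C =
      - (abelized e - cintegral setT h) + (abelized e - (2 * pi * expR (- x))%:C) by ring.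
    apply: le_trans (nrmD _ _) _; rewrite nrmN [e * _]mulrDr addrCA.
    exact: lerD h1 h2.
  apply/ler_addgt0Pr => r r0.
  (* This choice of e makes e (K1 + K2) <= r, whatever the sign of K1 + K2. *)
  have := bound (r / (1 + `|K1 + K2|)); rewrite divr_gt0 ?ltr_pwDl// => /(_ isT) hh.
  apply: le_trans hh _; rewrite lerD2l mulrAC ler_pdivrMr ?ltr_pwDl// ler_pM2l//.
  by apply: le_trans (ler_norm _) _; rewrite lerDr.
apply/ler_addgt0Pr => r r0; rewrite add0r.
have pi0 := pi_gt0 R.
have := key (r / (2 * pi)); rewrite divr_gt0 ?mulr_gt0// => /(_ isT).
have E (p : R) : 0 < p -> 2 * (r / (2 * p) * p) = r.
  by move=> p0; field; rewrite gt_eqF.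
by rewrite E.
Qed.

End fixed.
End Cahen_Mellin.

(** * Integral representations of K *)

Section K_function.
Variable R : realType.
Local Notation mu := (@lebesgue_measure R).
Local Notation T := (measurableTypeR R).
Implicit Types (x t u y p q gamma : R) (s z : R[i]).

Lemma cosh_ge1 u : 1 <= cosh u.
Proof.
rewrite /cosh ler_pdivlMr// mul1r.
have := sqr_ge0 (expR (u / 2) - expR (- (u / 2))).
rewrite sqrrB -!expRD !expr2 -!expRD -!splitr.
rewrite -opprD -splitr subrr expR0; lra.
Qed.

Lemma cosh_gt0 u : 0 < cosh u.
Proof. exact: lt_le_trans (cosh_ge1 u). Qed.

Lemma cosh_ge_exp u : expR u / 2 <= cosh u.
Proof. by rewrite /cosh ler_pM2r ?invr_gt0// lerDl expR_ge0. Qed.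

Lemma measurable_cosh : measurable_fun setT (@cosh R : T -> R).
Proof.
apply: measurable_funM => //; apply: measurable_funD => //.
exact: measurable_expRN.
Qed.

Lemma measurable_cosh_powR p : measurable_fun setT (fun u : T => cosh u `^ p).
Proof. exact: (measurableT_comp (@measurable_powR R p) measurable_cosh). Qed.

Lemma integrable_cosh_powR p : 0 < p ->
  mu.-integrable (@Rplus R) (fun u => (cosh u `^ (- p))%:E).
Proof.
move=> p0; have mR := @measurable_Rplus R.
have [C C0 HC] := exp_le_poisson p0.
have ip : mu.-integrable (@Rplus R) (EFin \o poisson 1).
  exact: (integrableS measurableT mR (@subsetT _ _) (integrable_poisson1 R)).
apply: (le_integrable mR _ _ (integrable_realZ (2 `^ p * C) mR ip)).
  by apply/measurable_EFinP; apply: measurable_funTS; exact: measurable_cosh_powR.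
move=> u; rewrite RplusE => u0; rewrite /= lee_fin ger0_norm ?powR_ge0//.
apply: le_trans (ler_norm _).
have := HC u; rewrite gtr0_norm// => hC.
rewrite -mulrA; apply: (@le_trans _ _ (2 `^ p * expR (- (p * u)))); last first.
  by rewrite ler_wpM2l ?powR_ge0.
have e0 : 0 < expR u / 2 by rewrite divr_gt0// expR_gt0.
rewrite powRN expRN -[2 `^ p]invrK -invfM lef_pV2 ?posrE ?powR_gt0 ?cosh_gt0//; last first.
  by rewrite mulr_gt0 ?expR_gt0// invr_gt0 powR_gt0.
have -> : (2 `^ p)^-1 * expR (p * u) = (expR u / 2) `^ p.
  rewrite powRM ?expR_ge0// -expRM mulrC [u * p]mulrC; congr (_ * _).
  by rewrite -powRN -[in RHS]powR_inv1// -powRrM mulN1r.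
by apply: ge0_ler_powR; rewrite ?nnegrE ?(ltW p0) ?(ltW e0) ?(ltW (cosh_gt0 u)) ?cosh_ge_exp.
Qed.

Definition cosh_cst p := \int[mu]_(u in @Rplus R) (cosh u `^ (- p)).

Section fixed.
Variables (alpha tau : R).
Hypothesis alpha0 : 0 < alpha.

(** For index i tau and real argument the integrand of K is real, since cosh(i tau u) = cos(tau
    u). *)
Definition K_integrand x u := expR (- (x * cosh u `^ alpha)) * cos (tau * u).

Definition Kfun x : R[i] := K alpha (0 +i* tau) x%:C.

Lemma KfunE x : Kfun x = cintegral (@Rplus R) (fun u => (K_integrand x u)%:C).
Proof.
apply: eq_cintegral => u _; rewrite /K_integrand realcM; congr (_ * _).
  by rewrite -rmorphN -realcM cexp_real mulNr.
rewrite /ccosh.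
have -> : (0 +i* tau) * u%:C = 0 +i* (tau * u) :> R[i].
  by apply: complex_eq; rewrite ?Re_Mreal ?Im_Mreal /= ?mul0r.
rewrite /cexp /= oppr0 expR0 cosN sinN -mulrDr.
have -> : cos (tau * u) +i* sin (tau * u) + cos (tau * u) -i* sin (tau * u) =
    (cos (tau * u))%:C * 2%:R :> R[i].
  by apply: complex_eq; rewrite ?ReD ?ImD ?ReM ?ImM /=; ring.
by rewrite mul1r mulfK// pnatr_eq0.
Qed.

Lemma coshpow_gt0 u : 0 < cosh u `^ alpha.
Proof. exact: powR_gt0 (cosh_gt0 u). Qed.

Lemma K_integrand_le x u : `|K_integrand x u| <= expR (- (x * cosh u `^ alpha)).
Proof.
rewrite normrM ger0_norm ?expR_ge0// ler_piMr ?expR_ge0//; exact: cos_max.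
Qed.

(** The bound separates x from u and leaves the exponent q free: a small q is used near x = 0, a
    large one at infinity. *)
Lemma expRN_coshpow_le q x u : 0 < q -> 0 < x ->
  expR (- (x * cosh u `^ alpha)) <= q `^ q * x `^ (- q) * cosh u `^ (- (alpha * q)).
Proof.
move=> q0 x0; have c0 := coshpow_gt0 u.
apply: le_trans (expRN_le_powR q0 (mulr_gt0 x0 c0)) _.
by rewrite powRM ?(ltW x0) ?(ltW c0)// mulrA -powRrM mulrN.
Qed.

Lemma measurable_K_joint (D : set (T * T)) :
  cmeas D (fun p : T * T => (K_integrand p.1 p.2)%:C).
Proof.
apply: cmeas_real; apply: measurable_funM.
  have m1 : measurable_fun D (fun p : T * T => p.1 * cosh p.2 `^ alpha : R).
    apply: measurable_funM; first exact: measurable_fst'.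
    have m0 : measurable_fun D (snd : T * T -> T) by exact: measurable_snd'.
    exact: (measurableT_comp (measurable_cosh_powR alpha) m0).
  exact: (measurableT_comp (@measurable_expRN R setT) m1).
have m2 : measurable_fun D (fun p : T * T => tau * p.2 : R).
  by apply: measurable_funM; [exact: measurable_cst|exact: measurable_snd'].
by apply: (measurableT_comp _ m2); apply: continuous_measurable_fun; exact: continuous_cos.
Qed.

Definition K_cst q := q `^ q * cosh_cst (alpha * q).

Lemma K_cst_ge0 q : 0 <= K_cst q.
Proof.
by rewrite mulr_ge0 ?powR_ge0//; apply: Rintegral_ge0 => u _; exact: powR_ge0.
Qed.

Lemma cmeas_K : cmeas (@Rplus R : set T) Kfun.
Proof.
rewrite (_ : Kfun = (fun x => cintegral (@Rplus R) (fun u => (K_integrand x u)%:C))); last first.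
  by apply/funext => x; exact: KfunE.
have mR := @measurable_Rplus R.
apply: (@cmeas_param R _ _ (fun x u => (K_integrand x u)%:C)
  (fun x => 1 `^ 1 * x `^ (- 1)) (fun u => cosh u `^ (- (alpha * 1)))) => //.
- exact: measurable_K_joint.
- apply: measurable_funM; first exact: measurable_cst.
  by apply: measurable_funTS; exact: measurable_powR.
- by move=> x _; rewrite mulr_ge0 ?powR_ge0.
- by apply: integrable_cosh_powR; rewrite mulr1.
- by move=> u _; exact: powR_ge0.
- move=> x u; rewrite !RplusE => x0 u0; rewrite nrm_real.
  exact: le_trans (K_integrand_le _ _) (expRN_coshpow_le _ ltr01 x0).
Qed.

Lemma cmeas_K_section x : cmeas (@Rplus R : set T) (fun u => (K_integrand x u)%:C).
Proof.
apply: cmeas_real; apply: measurable_funTS; apply: measurable_funM.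
  have m1 : measurable_fun setT (fun u : T => x * cosh u `^ alpha : R).
    by apply: measurable_funM => //; exact: measurable_cosh_powR.
  exact: (measurableT_comp (@measurable_expRN R setT) m1).
have m2 : measurable_fun setT (fun u : T => tau * u : R) by exact: mulrl_measurable.
by apply: (measurableT_comp _ m2); apply: continuous_measurable_fun; exact: continuous_cos.
Qed.

Lemma K_le q x : 0 < q -> 0 < x -> nrm (Kfun x) <= K_cst q * x `^ (- q).
Proof.
move=> q0 x0; have mR := @measurable_Rplus R.
have aq : 0 < alpha * q by rewrite mulr_gt0.
rewrite KfunE /K_cst mulrAC -RintegralZl//; last exact: integrable_cosh_powR.
apply: cintegral_nrm_le => //.
- exact: cmeas_K_section.
- move=> u _; rewrite nrm_real.
  exact: le_trans (K_integrand_le _ _) (expRN_coshpow_le _ q0 x0).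
- exact: (integrable_realZ _ mR (integrable_cosh_powR aq)).
Qed.

(** The function C(z) of the overview. *)
Definition cosh_transform z : R[i] :=
  cintegral (@Rplus R) (fun u => (cos (tau * u))%:C * cpow (cosh u) (- z)).

Lemma cosh_transform_integrand_le z u :
  nrm ((cos (tau * u))%:C * cpow (cosh u) (- z)) <= cosh u `^ (- Cre z).
Proof.
rewrite nrmM nrm_real nrm_cpow ?cosh_gt0// ReN ler_piMl ?powR_ge0//.
exact: cos_max.
Qed.

Lemma measurable_cos_mul (D : set T) : measurable_fun D (fun u : T => cos (tau * u)).
Proof.
apply: measurable_funTS.
have m2 : measurable_fun setT (fun u : T => tau * u : R) by exact: mulrl_measurable.
by apply: (measurableT_comp _ m2); apply: continuous_measurable_fun; exact: continuous_cos.
Qed.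

Lemma cmeas_cosh_transform_integrand z (D : set T) :
  cmeas D (fun u : T => (cos (tau * u))%:C * cpow (cosh u) (- z)).
Proof.
apply: cmeasM; first by apply: cmeas_real; exact: measurable_cos_mul.
by apply: cmeas_cpow; [apply: measurable_funTS; exact: measurable_cosh|exact: cmeas_cst].
Qed.

Lemma cosh_transform_le z : 0 < Cre z -> nrm (cosh_transform z) <= cosh_cst (Cre z).
Proof.
move=> z0; apply: cintegral_nrm_le; first exact: measurable_Rplus.
- exact: cmeas_cosh_transform_integrand.
- by move=> u _; exact: cosh_transform_integrand_le.
- exact: integrable_cosh_powR.
Qed.

Lemma cintegral_exp_cpow (c : R) s : 0 < c -> 0 < Cre s ->
  cintegrable (@Rplus R) (fun x => (expR (- (x * c)))%:C * cpow x (s - 1)) /\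
  cintegral (@Rplus R) (fun x => (expR (- (x * c)))%:C * cpow x (s - 1)) =
  cpow c (- s) * Gamma s.
Proof.
move=> c0 s0; have mR := @measurable_Rplus R.
have [i1 E] := cintegral_Rplus_scale c0 (cintegrable_Gamma s0).
have E0 x : 0 < x -> Gamma_integrand s (c * x) =
    cpow c (s - 1) * ((expR (- (x * c)))%:C * cpow x (s - 1)).
  by move=> x0; rewrite /Gamma_integrand cpowM// [c * x]mulrC; ring.
have i2 : cintegrable (@Rplus R) (fun x => (expR (- (x * c)))%:C * cpow x (s - 1)).
  apply: (eq_cintegrable mR _ (cintegrableZ (cpow c (s - 1))^-1 mR i1)) => x.
  by rewrite RplusE => x0; rewrite E0// mulKf// cpow_neq0.
split; first exact: i2.
have -> : Gamma s = cintegral (@Rplus R) (Gamma_integrand s) by [].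
rewrite E.
have -> : cintegral (@Rplus R) (fun x => Gamma_integrand s (c * x)) =
    cpow c (s - 1) * cintegral (@Rplus R) (fun x => (expR (- (x * c)))%:C * cpow x (s - 1)).
  rewrite -(cintegralZ _ mR i2); apply: eq_cintegral => x.
  by rewrite RplusE => x0; exact: E0.
rewrite cpowB1// cpowN; have cn0 : c%:C != 0 :> R[i] by apply: realc_neq0; rewrite gt_eqF.
rewrite realcV; have := cpow_neq0 c s.
move: (cpow c s) (cintegral _ _) (c%:C) cn0 => w I d d0 w0.
by field; rewrite w0 d0.
Qed.

Lemma Mellin_K s : 0 < Cre s ->
  cintegral (@Rplus R) (fun x => Kfun x * cpow x (s - 1)) =
  Gamma s * cosh_transform (alpha%:C * s).
Proof.
move=> s0; have mR := @measurable_Rplus R.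
(* With Re s = 2 q, the exponents q and 3 q in [expRN_coshpow_le] bound the integrand, up to the
   factor 1/x, by multiples of x^q and x^{-q}. As cosh >= 1, both bounds have the common factor
   cosh(u)^{- alpha q}. *)
pose q := Cre s / 2; have q0 : 0 < q by rewrite divr_gt0.
have [C C0 HC] := powR_le_poisson q0.
have q30 : 0 < q *+ 3 by rewrite mulrn_wgt0.
have Es : Cre s = q + q by rewrite /q -splitr.
pose A := q `^ q + (q *+ 3) `^ (q *+ 3).
have A0 : 0 < A by rewrite addr_gt0// powR_gt0.
pose F (x u : T) : R[i] := (K_integrand x u)%:C * cpow x (s - 1).
pose a (x : T) : R := A * C * (poisson 1 (ln x) / x).
pose b (u : T) : R := cosh u `^ (- (alpha * q)).
have ia := integrable_realZ (A * C) mR (integrable_poisson_ln_div R).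
have aq0 : 0 < alpha * q by rewrite mulr_gt0.
have ib := integrable_cosh_powR aq0.
have b0 u : 0 < b u by rewrite powR_gt0// cosh_gt0.
have [||_ _ E] := @cfubini R (@Rplus R) (@Rplus R) F a b mR mR _ ia ib.
- apply: cmeasM; first exact: measurable_K_joint.
  apply: cmeas_cpow; [exact: measurable_fst'|exact: cmeas_cst].
- move=> x u; rewrite !RplusE => x0 u0; rewrite nrmM nrm_real nrm_cpow//.
  apply: (le_trans (ler_wpM2r (powR_ge0 _ _) (K_integrand_le _ _))).
  rewrite ReD ReN powRB1//.
  have x'0 : 0 < x^-1 by rewrite invr_gt0.
  have -> : a x * b u = (A * b u * (C * poisson 1 (ln x))) * x^-1 by rewrite /a; ring.
  rewrite [leLHS]mulrA ler_pM2r// -ler_pdivrMl ?mulr_gt0//.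
  apply: HC => //; rewrite ler_pdivrMl ?mulr_gt0//.
    have h := expRN_coshpow_le u q0 x0.
    apply: (le_trans (ler_wpM2r (powR_ge0 _ _) h)).
    have -> : q `^ q * x `^ (- q) * cosh u `^ (- (alpha * q)) * x `^ (Cre s) =
        q `^ q * b u * x `^ q.
      have -> : x `^ q = x `^ (- q) * x `^ (Cre s).
        by rewrite -powRD ?(gt_eqF x0) ?implybT// Es addKr.
      by rewrite /b; ring.
    apply: ler_wpM2r; first exact: powR_ge0.
    apply: ler_wpM2r; first exact: ltW (b0 u).
    by rewrite /A lerDl powR_ge0.
  have h := expRN_coshpow_le u q30 x0.
  apply: (le_trans (ler_wpM2r (powR_ge0 _ _) h)).
  have -> : (q *+ 3) `^ (q *+ 3) * x `^ (- (q *+ 3)) *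
      cosh u `^ (- (alpha * (q *+ 3))) * x `^ (Cre s) =
      (q *+ 3) `^ (q *+ 3) * cosh u `^ (- (alpha * (q *+ 3))) * x `^ (- q).
    have -> : x `^ (- q) = x `^ (- (q *+ 3)) * x `^ (Cre s).
      by rewrite -powRD ?(gt_eqF x0) ?implybT// Es !mulrS; congr (_ `^ _); ring.
    by ring.
  apply: ler_wpM2r; first exact: powR_ge0.
  apply: ler_pM; [exact: powR_ge0|exact: powR_ge0|by rewrite /A lerDr powR_ge0|].
  rewrite /b; apply: ler_powR; first exact: cosh_ge1.
  by rewrite lerN2 ler_pM2l// !mulrS; lra.
transitivity (cintegral (@Rplus R) (fun x => cintegral (@Rplus R) (F x))).
  apply: eq_cintegral => x; rewrite RplusE => x0.
  have iK : cintegrable (@Rplus R) (fun u => (K_integrand x u)%:C).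
    have a10 : 0 < alpha * 1 by rewrite mulr1.
    apply: (cintegrable_le mR (cmeas_K_section x) _
      (integrable_realZ (1 `^ 1 * x `^ (- 1)) mR (integrable_cosh_powR a10))).
    move=> u _; rewrite nrm_real.
    exact: le_trans (K_integrand_le _ _) (expRN_coshpow_le _ ltr01 x0).
  rewrite KfunE mulrC -(cintegralZ _ mR iK).
  by apply: eq_cintegral => u _; rewrite mulrC.
apply: (etrans E).
have s'0 : 0 < Cre (alpha%:C * s) by rewrite Re_realM mulr_gt0.
have iC : cintegrable (@Rplus R) (fun u => (cos (tau * u))%:C * cpow (cosh u) (- (alpha%:C * s))).
  apply: (cintegrable_le mR (@cmeas_cosh_transform_integrand _ _) _ (integrable_cosh_powR s'0)).
  by move=> u _; exact: cosh_transform_integrand_le.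
rewrite -(cintegralZ _ mR iC); apply: eq_cintegral => u _.
have c0 := coshpow_gt0 u.
transitivity (cintegral (@Rplus R) (fun x : T => (cos (tau * u))%:C *
   ((expR (- (x * cosh u `^ alpha)))%:C * cpow x (s - 1)))).
  by apply: eq_cintegral => x _; rewrite /F /K_integrand realcM; ring.
have [i2 E2] := cintegral_exp_cpow c0 s0.
by rewrite (cintegralZ _ mR i2) E2 cpow_powR mulrN; ring.
Qed.

End fixed.
End K_function.

(** * Mellin inversion and weighted integrability of K *)

Section Mellin_inversion.
Variable R : realType.
Local Notation mu := (@lebesgue_measure R).
Local Notation T := (measurableTypeR R).
Variables (alpha tau gamma : R).
Hypotheses (alpha0 : 0 < alpha) (gamma0 : 0 < gamma).
Implicit Types (D : set T) (x y : R) (f : T -> R[i]).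

(** By [Mellin_K], the Mellin transform of K_{alpha,i tau} at gamma + i y. *)
Definition K_Mellin y : R[i] :=
  Gamma (gamma +i* y) * cosh_transform tau (alpha%:C * (gamma +i* y)).

Let ag0 : 0 < alpha * gamma. Proof. exact: mulr_gt0. Qed.

Let Re_line y : Cre (alpha%:C * (gamma +i* y)) = alpha * gamma.
Proof. by rewrite Re_realM. Qed.

Lemma cmeas_cosh_transform_line : cmeas [set: T]
  (fun y => cosh_transform tau (alpha%:C * (gamma +i* y))).
Proof.
apply: (@cmeas_param R setT (@Rplus R)
  (fun y u => (cos (tau * u))%:C * cpow (cosh u) (- (alpha%:C * (gamma +i* y))))
  (cst 1) (fun u => cosh u `^ (- (alpha * gamma)))) => //.
- exact: measurable_Rplus.
- have m2 : measurable_fun (setT `*` @Rplus R) (snd : T * T -> T) by exact: measurable_snd'.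
  apply: cmeasM.
    by apply: cmeas_real; exact: (measurableT_comp (@measurable_cos_mul R tau setT) m2).
  apply: cmeas_cpow; first exact: (measurableT_comp (@measurable_cosh R) m2).
  apply: cmeasN; apply: cmeasM; first exact: cmeas_cst.
  by apply: cmeas_Complex; [exact: measurable_cst|exact: measurable_fst'].
- exact: integrable_cosh_powR.
- by move=> u _; exact: powR_ge0.
- move=> y u _ _; rewrite mul1r.
  by apply: le_trans (cosh_transform_integrand_le _ _ _) _; rewrite Re_line.
Qed.

Lemma cosh_transform_line_le y :
  nrm (cosh_transform tau (alpha%:C * (gamma +i* y))) <= cosh_cst (alpha * gamma).
Proof.
by apply: (le_trans (cosh_transform_le _ _)); rewrite Re_line.
Qed.

Lemma cosh_cst_ge0 p : 0 <= cosh_cst p :> R.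
Proof. by apply: Rintegral_ge0 => u _; exact: powR_ge0. Qed.

Lemma cmeas_K_Mellin : cmeas [set: T] K_Mellin.
Proof. exact: cmeasM (cmeas_Gamma_line gamma0) cmeas_cosh_transform_line. Qed.

Definition K_Mellin_bound y : R :=
  cosh_cst (alpha * gamma) * (Gamma_real gamma * (dq (gamma + 3) y)^-1).

Lemma K_Mellin_le y : nrm (K_Mellin y) <= K_Mellin_bound y.
Proof.
rewrite nrmM mulrC; apply: ler_pM; rewrite ?nrm_ge0//; first exact: cosh_transform_line_le.
exact: Gamma_line_le1.
Qed.

Lemma K_Mellin_bound_ge0 y : 0 <= K_Mellin_bound y.
Proof. exact: le_trans (nrm_ge0 _) (K_Mellin_le y). Qed.

Lemma integrable_K_Mellin_bound :
  mu.-integrable [set: T] (EFin \o K_Mellin_bound).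
Proof. exact: (integrable_realZ _ measurableT (integrable_Gamma_bound gamma0)). Qed.

Lemma Gamma_cpow_line_le z y : 0 < z ->
  nrm (Gamma (gamma +i* y) * cpow z (- (gamma +i* y))) <=
  z `^ (- gamma) * (Gamma_real gamma * (dq (gamma + 3) y)^-1).
Proof.
move=> z0; rewrite nrmM (nrm_cpow_line gamma y z0) mulrC.
by rewrite ler_wpM2l ?powR_ge0// Gamma_line_le1.
Qed.

Lemma K_Mellin_inversion x : 0 < x ->
  (2 * pi)%:C * Kfun alpha tau x =
  cintegral [set: T] (fun y => K_Mellin y * cpow x (- (gamma +i* y))).
Proof.
move=> x0; have mR := @measurable_Rplus R.
pose F (u y : T) : R[i] := (Gamma (gamma +i* y) * cpow x (- (gamma +i* y))) *
  ((cos (tau * u))%:C * cpow (cosh u) (- (alpha%:C * (gamma +i* y)))).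
have ia := integrable_cosh_powR ag0.
have ib := integrable_realZ (x `^ (- gamma)) measurableT (integrable_Gamma_bound gamma0).
have cGx : cmeas [set: T] (fun y => Gamma (gamma +i* y) * cpow x (- (gamma +i* y))).
  by apply: cmeasM; [exact: cmeas_Gamma_line|exact: cmeas_cpow_line].
have [||_ _ E] := @cfubini R (@Rplus R) setT F _ _ mR measurableT _ ia ib.
- have m1 : measurable_fun (@Rplus R `*` setT) (fst : T * T -> T) by exact: measurable_fst'.
  apply: cmeasM.
    have /= := @cmeas_comp _ _ _ _ R setT (@Rplus R `*` setT) _ snd measurableT _ _ cGx.
    by apply => //; exact: measurable_snd'.
  apply: cmeasM.
    by apply: cmeas_real; exact: (measurableT_comp (@measurable_cos_mul R tau setT) m1).
  apply: cmeas_cpow; first exact: (measurableT_comp (@measurable_cosh R) m1).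
  apply: cmeasN; apply: cmeasM; first exact: cmeas_cst.
  by apply: cmeas_Complex; [exact: measurable_cst|exact: measurable_snd'].
- move=> u y _ _; rewrite nrmM mulrC; apply: ler_pM; rewrite ?nrm_ge0//.
    by apply: le_trans (cosh_transform_integrand_le _ _ _) _; rewrite Re_line.
  exact: Gamma_cpow_line_le.
transitivity (cintegral (@Rplus R) (fun u => cintegral setT (F u))); last first.
  apply: (etrans E); apply: eq_cintegral => y _.
  have iC : cintegrable (@Rplus R) (fun u => (cos (tau * u))%:C *
      cpow (cosh u) (- (alpha%:C * (gamma +i* y)))).
    apply: (cintegrable_le mR (@cmeas_cosh_transform_integrand _ _ _ _) _ ia) => u _.
    by apply: le_trans (cosh_transform_integrand_le _ _ _) _; rewrite Re_line.
  by apply: (etrans (cintegralZ _ mR iC)); rewrite /K_Mellin mulrAC.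
have iK : cintegrable (@Rplus R) (fun u => (K_integrand alpha tau x u)%:C).
  have a10 : 0 < alpha * 1 by rewrite mulr1.
  apply: (cintegrable_le mR (cmeas_K_section _ _ x) _
    (integrable_realZ (1 `^ 1 * x `^ (- 1)) mR (integrable_cosh_powR a10))).
  move=> u _; rewrite nrm_real.
  exact: le_trans (K_integrand_le _ _ _ _) (expRN_coshpow_le _ _ ltr01 x0).
rewrite KfunE -(cintegralZ _ mR iK); apply: eq_cintegral => u _.
have c0 := coshpow_gt0 alpha u; have xc0 : 0 < x * cosh u `^ alpha by exact: mulr_gt0.
have iG : cintegrable [set: T] (fun y => Gamma (gamma +i* y) *
    cpow (x * cosh u `^ alpha) (- (gamma +i* y))).
  apply: (cintegrable_le measurableT _ _ (integrable_realZ ((x * cosh u `^ alpha) `^ (- gamma))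
      measurableT (integrable_Gamma_bound gamma0))).
    by apply: cmeasM; [exact: cmeas_Gamma_line|exact: cmeas_cpow_line].
  by move=> y _; exact: (Gamma_cpow_line_le y xc0).
transitivity (cintegral setT (fun y : T => (cos (tau * u))%:C * (Gamma (gamma +i* y) *
    cpow (x * cosh u `^ alpha) (- (gamma +i* y))))); last first.
  apply: eq_cintegral => y _; rewrite (cpowM _ x0 c0) cpow_powR mulrN /F; ring.
apply: esym; apply: (etrans (cintegralZ _ measurableT iG)).
rewrite (Cahen_Mellin gamma0 xc0) /K_integrand -!realcM; congr (_%:C).
by rewrite mulrCA [cos _ * _]mulrC -mulrA.
Qed.

(** [K_le] with exponents p/2 and 3p/2 bounds |K(x)| x^p by multiples of x^{p/2} and x^{-p/2}. *)
Lemma integrable_K_power p : 0 < p ->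
  mu.-integrable (@Rplus R) (fun x => (nrm (Kfun alpha tau x) * x `^ (p - 1))%:E).
Proof.
move=> p0; have mR := @measurable_Rplus R.
have h0 : 0 < p / 2 by rewrite divr_gt0.
have t0 : 0 < p + p / 2 by rewrite addr_gt0.
have A0 : 0 <= K_cst alpha (p / 2) + K_cst alpha (p + p / 2) by rewrite addr_ge0 ?K_cst_ge0.
have mh : measurable_fun (@Rplus R : set T) (fun x : T => nrm (Kfun alpha tau x) * x `^ p).
  apply: measurable_funM; first by apply: measurable_nrm; exact: cmeas_K.
  by apply: measurable_funTS; exact: measurable_powR.
have key q x : 0 < q -> 0 < x -> nrm (Kfun alpha tau x) * x `^ p <= K_cst alpha q * x `^ (p - q).
  move=> q0 x0; rewrite [p - q]addrC powRD ?(gt_eqF x0) ?implybT// mulrA.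
  by rewrite ler_wpM2r ?powR_ge0// K_le.
have h1 : forall x, 0 < x -> `|nrm (Kfun alpha tau x) * x `^ p| <=
    (K_cst alpha (p / 2) + K_cst alpha (p + p / 2)) * x `^ (p / 2).
  move=> x x0; rewrite ger0_norm ?mulr_ge0 ?powR_ge0 ?nrm_ge0//.
  apply: le_trans (key _ _ h0 x0) _.
  rewrite {2}(splitr p) addrK ler_wpM2r ?powR_ge0// lerDl K_cst_ge0//.
have h2 : forall x, 0 < x -> `|nrm (Kfun alpha tau x) * x `^ p| <=
    (K_cst alpha (p / 2) + K_cst alpha (p + p / 2)) * x `^ (- (p / 2)).
  move=> x x0; rewrite ger0_norm ?mulr_ge0 ?powR_ge0 ?nrm_ge0//.
  apply: le_trans (key _ _ t0 x0) _.
  by rewrite opprD addNKr ler_wpM2r ?powR_ge0// lerDr K_cst_ge0.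
apply: (eq_integrable mR _ _ _ (integrable_Rplus_powR h0 A0 mh h1 h2)) => x.
by rewrite inE RplusE => x0; rewrite /= powRB1// mulrA.
Qed.

(** One factor |K| is bounded by a multiple of x^{-p/2}, which leaves |K(x)| x^{p/2 - 1} to
    integrate. *)
Lemma K_in_L2 p : 0 < p ->
  in_L2 (@Rplus R) (fun x => x `^ (p - 1)) (Kfun alpha tau).
Proof.
move=> p0; have mR := @measurable_Rplus R; split; first exact: cmeas_K.
have h0 : 0 < p / 2 by rewrite divr_gt0.
have i1 := integrable_realZ (K_cst alpha (p / 2)) mR (integrable_K_power h0).
have /integrableP[_ foo] := i1.
apply: le_lt_trans foo; apply: ge0_le_integral => //.
- by move=> x _; rewrite lee_fin mulr_ge0 ?powR_ge0 ?sqr_ge0.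
- apply/measurable_EFinP; apply: measurable_funM.
    by apply: measurable_funTS; exact: measurable_powR.
  by apply: measurable_funX; apply: measurable_nrm; exact: cmeas_K.
- by apply: measurableT_comp => //; exact: measurable_int i1.
- move=> x; rewrite RplusE => x0; rewrite lee_fin /=; apply: le_trans (ler_norm _).
  have hK := K_le tau alpha0 h0 x0.
  have -> : x `^ (p - 1) * nrm (Kfun alpha tau x) ^+ 2 =
      nrm (Kfun alpha tau x) * (nrm (Kfun alpha tau x) * x `^ (p - 1)) by ring.
  rewrite [leRHS]mulrCA; apply: ler_wpM2l; first exact: nrm_ge0.
  apply: (@le_trans _ _ (K_cst alpha (p / 2) * x `^ (- (p / 2)) * x `^ (p - 1))).
    by rewrite ler_wpM2r ?powR_ge0.
  rewrite -mulrA -powRD ?(gt_eqF x0) ?implybT//.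
  by have -> : - (p / 2) + (p - 1) = p / 2 - 1 by lra.
Qed.

End Mellin_inversion.

(** * Weighted L_2 spaces *)

Section square_integrable.
Variable R : realType.
Local Notation mu := (@lebesgue_measure R).
Local Notation T := (measurableTypeR R).
Implicit Types (D E : set T) (w : T -> R) (f g u v : T -> R[i]).

Lemma in_L2_integrable D w f : measurable D -> measurable_fun D w ->
  (forall x, D x -> 0 <= w x) -> in_L2 D w f ->
  mu.-integrable D (fun x => (w x * nrm (f x) ^+ 2)%:E).
Proof.
move=> mD mw w0 [mf foo]; apply/integrableP; split.
  apply/measurable_EFinP; apply: measurable_funM => //.
  by apply: measurable_funX; exact: measurable_nrm.
apply: le_lt_trans foo; rewrite le_eqVlt; apply/orP; left; apply/eqP.
apply: eq_integral => x; rewrite inE => Dx; rewrite gee0_abs// lee_fin.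
by rewrite mulr_ge0 ?sqr_ge0 ?w0.
Qed.

Lemma in_L2_sub D E w f : measurable D -> measurable E -> E `<=` D ->
  measurable_fun D w -> (forall x, D x -> 0 <= w x) ->
  in_L2 D w f -> in_L2 E w f.
Proof.
move=> mD mE ED mw w0 [mf foo]; split; first exact: (cmeas_sub mD ED mf).
apply: le_lt_trans foo; apply: ge0_subset_integral => //.
  apply/measurable_EFinP; apply: measurable_funM => //.
  by apply: measurable_funX; exact: measurable_nrm.
by move=> x Dx; rewrite lee_fin mulr_ge0 ?sqr_ge0 ?w0.
Qed.

Section pairing.
Variables (D : set T) (w w' : T -> R).
Hypotheses (mD : measurable D) (mw : measurable_fun D w) (mw' : measurable_fun D w')
  (w0 : forall x, D x -> 0 < w x) (ww' : forall x, D x -> w' x = (w x)^-1).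

Let w'0 x : D x -> 0 <= w' x.
Proof. by move=> Dx; rewrite ww'// invr_ge0 ltW// w0. Qed.

(** The square (r w a - b)^2 >= 0, divided by r w. *)
Let young x (a b r : R) : D x -> 0 < r -> 0 <= a -> 0 <= b ->
  2 * (a * b) <= r * (w x * a ^+ 2) + r^-1 * (w' x * b ^+ 2).
Proof.
move=> Dx r0 a0 b0; rewrite ww'// !mulrA -invfM.
have c0 : 0 < r * w x by rewrite mulr_gt0 ?w0.
move: (r * w x) c0 => c c0.
rewrite -subr_ge0 -(pmulr_rge0 _ c0).
have -> : c * (c * a * a + c^-1 * b * b - 2 * a * b) = (c * a - b) ^+ 2.
  by field; rewrite gt_eqF.
exact: sqr_ge0.
Qed.

Lemma L2_pairing_integrable u v : in_L2 D w u -> in_L2 D w' v ->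
  cintegrable D (fun x => u x * v x).
Proof.
move=> hu hv; have iu := in_L2_integrable mD mw (fun x Dx => ltW (w0 Dx)) hu.
have iv := in_L2_integrable mD mw' w'0 hv.
apply: (cintegrable_le mD _ _ (integrableD mD iu iv)); first exact: cmeasM hu.1 hv.1.
move=> x Dx; rewrite nrmM.
have := young Dx ltr01 (nrm_ge0 (u x)) (nrm_ge0 (v x)).
rewrite invr1 !mul1r; apply: le_trans; rewrite ler_peMl ?mulr_ge0 ?nrm_ge0//.
by rewrite ler1n.
Qed.

(* Optimizing [r] is the Cauchy-Schwarz inequality. *)
Lemma L2_pairing_le u v (r : R) : in_L2 D w u -> in_L2 D w' v -> 0 < r ->
  2 * nrm (cintegral D (fun x => u x * v x)) <=
  r * fine (sqnorm D w u) + r^-1 * fine (sqnorm D w' v).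
Proof.
move=> hu hv r0; have iu := in_L2_integrable mD mw (fun x Dx => ltW (w0 Dx)) hu.
have iv := in_L2_integrable mD mw' w'0 hv.
have iuv := L2_pairing_integrable hu hv.
have inuv := cintegrable_nrm mD iuv.
apply: (@le_trans _ _ (2 * \int[mu]_(x in D) nrm (u x * v x))).
  by rewrite ler_pM2l// le_nrm_cintegral.
have -> : fine (sqnorm D w u) = \int[mu]_(x in D) (w x * nrm (u x) ^+ 2) by [].
have -> : fine (sqnorm D w' v) = \int[mu]_(x in D) (w' x * nrm (v x) ^+ 2) by [].
rewrite -!RintegralZl// -RintegralD//; [|exact: integrable_realZ..].
apply: le_Rintegral => //; first exact: integrable_realZ.
  exact: (integrableD mD (integrable_realZ _ mD iu) (integrable_realZ _ mD iv)).
by move=> x Dx; rewrite nrmM; apply: young; rewrite ?nrm_ge0.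
Qed.

Lemma L2_pairing_cvg u v (vn : nat -> T -> R[i]) : in_L2 D w u -> in_L2 D w' v ->
  (forall n, cmeas D (vn n)) ->
  (forall n, cintegrable D (fun x => u x * vn n x)) ->
  sqnorm D w' (fun x => vn n x - v x) @[n --> \oo] --> 0%E ->
  nrm (cintegral D (fun x => u x * vn n x) - cintegral D (fun x => u x * v x))
    @[n --> \oo] --> 0.
Proof.
move=> hu hv mvn ivn cvn; apply/cvgrPdist_le => e e0.
pose U := fine (sqnorm D w u).
have U0 : 0 <= U.
  by apply: fine_ge0; apply: integral_ge0 => x Dx; rewrite lee_fin mulr_ge0 ?sqr_ge0 ?(ltW (w0 _)).
(* With this r the first term of [L2_pairing_le] is at most e, and the second one is too as soon as
   the squared norm of v_n - v is below r e. *)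
pose r := e / (U + 1); have r0 : 0 < r by rewrite divr_gt0// ltr_wpDl.
have rU : r * U <= e.
  rewrite /r mulrAC ler_pdivrMr ?ltr_wpDl// ler_pM2l// lerDl//.
have re : 0 < r * e by rewrite mulr_gt0.
near=> n.
have sn : (sqnorm D w' (fun x => vn n x - v x)%R < (r * e)%:E)%E.
  near: n; have /fine_cvgP[fn /cvgrPdist_lt/(_ _ re) cn] := cvn.
  near=> n; have fnn : (sqnorm D w' (fun x => vn n x - v x)%R \is a fin_num) by near: n.
  rewrite -(fineK fnn) lte_fin; apply: le_lt_trans (ler_norm _) _.
  by rewrite -normrN -sub0r; near: n.
have s0 : (0 <= sqnorm D w' (fun x => vn n x - v x)%R)%E.
  by apply: integral_ge0 => x Dx; rewrite lee_fin mulr_ge0 ?sqr_ge0 ?w'0.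
have hd : in_L2 D w' (fun x => vn n x - v x).
  by split; [exact: cmeasB (mvn n) hv.1|exact: lt_trans sn (ltry _)].
rewrite sub0r normrN ger0_norm ?nrm_ge0// -(ler_pM2l (@ltr0Sn R 1)).
rewrite -(cintegralB mD (ivn n) (L2_pairing_integrable hu hv)).
have -> : cintegral D (fun x => u x * vn n x - u x * v x) =
    cintegral D (fun x => u x * (vn n x - v x)).
  by apply: eq_cintegral => x _; rewrite mulrBr.
apply: (le_trans (L2_pairing_le hu hd r0)).
have fs : fine (sqnorm D w' (fun x => vn n x - v x)) <= r * e.
  rewrite -lee_fin fineK; first exact: ltW.
  by rewrite ge0_fin_numE//; exact: lt_trans sn (ltry _).
rewrite mulr2n mulrDl mul1r; apply: lerD => //.
by rewrite ler_pdivrMl.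
Unshelve. all: by end_near. Qed.

End pairing.

Lemma ccvg_unique (a : nat -> R[i]) l m :
  nrm (a n - l) @[n --> \oo] --> 0 -> nrm (a n - m) @[n --> \oo] --> 0 -> l = m.
Proof.
move=> al am; apply/eqP; rewrite -subr_eq0 -nrm_eq0 eq_le nrm_ge0 andbT.
have h : nrm (a n - l) + nrm (a n - m) @[n --> \oo] --> (0 : R).
  by rewrite -[0](addr0 0); exact: cvgD.
apply: (cvgr_to_ge h); apply: nearW => n.
by rewrite -(nrmN (a n - l)) opprB; apply: le_trans (nrmD _ _); rewrite addrA subrK.
Qed.

Lemma ccvg_of_ReIm (a : nat -> R[i]) (l : R[i]) : Cre (a n) @[n --> \oo] --> Cre l ->
  Cim (a n) @[n --> \oo] --> Cim l -> nrm (a n - l) @[n --> \oo] --> 0.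
Proof.
move=> a1 a2; have norm0 (b : nat -> R) m : b n @[n --> \oo] --> m ->
    `|b n - m| @[n --> \oo] --> 0.
  move=> bm; rewrite -[0](@normr0 R R) -(subrr m); apply: cvg_norm.
  by apply: cvgB => //; exact: cvg_cst.
apply: (@squeeze_cvgr _ _ _ _ (fun=> 0)
  (fun n => `|Cre (a n) - Cre l| + `|Cim (a n) - Cim l|)).
- apply: nearW => n; rewrite nrm_ge0; apply: le_trans (le_nrm_ReIm _) _.
  by rewrite ReD ImD ReN ImN.
- exact: cvg_cst.
- by rewrite -[0](addr0 0); apply: cvgD; exact: norm0.
Qed.

Lemma ccvg_exhaust (E : nat -> set T) D f :
  (forall n, measurable (E n)) -> nondecreasing_seq E -> \bigcup_n E n = D ->
  cintegrable D f ->
  nrm (cintegral (E n) f - cintegral D f) @[n --> \oo] --> 0.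
Proof.
move=> mE ndE UE [i1 i2]; apply: ccvg_of_ReIm.
- exact: (cvg_integral_exhaust mE ndE UE i1).
- exact: (cvg_integral_exhaust mE ndE UE i2).
Qed.

Lemma cvg_at_nat (F : R -> \bar R) (l : \bar R) : F t @[t --> +oo] --> l ->
  F n.+1%:R @[n --> \oo] --> l.
Proof. by move=> Fl; exact: (cvg_comp _ _ (@cvgr_natD R 1) Fl). Qed.

End square_integrable.

(** * Parseval formulas *)

Section Parseval.
Variable R : realType.
Local Notation mu := (@lebesgue_measure R).
Local Notation T := (measurableTypeR R).
Implicit Types (D E : set T) (x y t gamma : R) (f : T -> R[i]) (s : R[i]).

Lemma one_minus_line gamma y : 1 - (gamma +i* y) = (1 - gamma) +i* (- y) :> R[i].
Proof. by apply: complex_eq => /=; rewrite ?sub0r. Qed.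

Lemma mellin_on_lineE D f gamma y : mellin_on D f (1 - (gamma +i* y)) =
  cintegral D (fun t => f t * cpow t (- (gamma +i* y))).
Proof. by rewrite /mellin_on addrAC subrr add0r. Qed.

Lemma in_L1_cmeas D gamma f : D `<=` @Rplus R -> in_L1 D (fun x => x `^ (- gamma)) f -> cmeas D f.
Proof.
move=> DR /cintegrable_cmeas mf.
have m1 : cmeas D (fun x => (x `^ gamma)%:C).
  by apply: cmeas_real; apply: measurable_funTS; exact: measurable_powR.
apply: (eq_cmeas _ (cmeasM m1 mf)) => x /DR; rewrite RplusE => x0.
by rewrite mulrA -realcM -powRD ?(gt_eqF x0) ?implybT// addrN powRr0 mul1r.
Qed.

Lemma in_L1_nrm D gamma f : measurable D -> in_L1 D (fun x => x `^ (- gamma)) f ->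
  mu.-integrable D (fun x => (x `^ (- gamma) * nrm (f x))%:E).
Proof.
move=> mD fi; apply: (eq_integrable mD _ _ _ (cintegrable_nrm mD fi)) => x _.
by rewrite nrmM nrm_real ger0_norm ?powR_ge0.
Qed.

Lemma cmeas_mellin_joint D E gamma f : D `<=` @Rplus R -> measurable D -> cmeas D f ->
  cmeas (D `*` E) (fun p : T * T => f p.1 * cpow p.1 (- (gamma +i* p.2))).
Proof.
move=> DR mD mf; apply: cmeasM.
  have /= := @cmeas_comp _ _ _ _ R D (D `*` E) f fst mD _ _ mf.
  by apply; [move=> x [] | exact: measurable_fst'].
apply: cmeas_cpow; first exact: measurable_fst'.
by apply: cmeasN; apply: cmeas_Complex; [exact: measurable_cst|exact: measurable_snd'].
Qed.

Lemma mellin_integrand_le D gamma f y t : D `<=` @Rplus R -> D t ->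
  nrm (f t * cpow t (- (gamma +i* y))) <= t `^ (- gamma) * nrm (f t).
Proof.
move=> DR /DR; rewrite RplusE => t0.
by rewrite nrmM (nrm_cpow_line gamma y t0) mulrC.
Qed.

Lemma cmeas_mellin_on_line D gamma f : D `<=` @Rplus R -> measurable D ->
  in_L1 D (fun x => x `^ (- gamma)) f ->
  cmeas [set: T] (fun y => mellin_on D f (1 - (gamma +i* y))).
Proof.
move=> DR mD fi; have mf := in_L1_cmeas DR fi.
rewrite (_ : (fun _ => _) = (fun y => cintegral D (fun t => f t * cpow t (- (gamma +i* y)))));
  last by apply/funext => y; exact: mellin_on_lineE.
apply: (@cmeas_param R setT D (fun y t => f t * cpow t (- (gamma +i* y))) (fun=> 1)
  (fun t => t `^ (- gamma) * nrm (f t))) => //.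
- apply: (@cmeas_comp _ _ _ _ R (D `*` setT) (setT `*` D)
    (fun p : T * T => f p.1 * cpow p.1 (- (gamma +i* p.2))) (fun p : T * T => (p.2, p.1))).
  + exact: measurableX.
  + by move=> [y t] [_ /= Dt].
  + by apply: measurable_funTS; exact: measurable_swap.
  + exact: cmeas_mellin_joint.
- exact: in_L1_nrm.
- by move=> t _; rewrite mulr_ge0 ?powR_ge0 ?nrm_ge0.
- by move=> y t _ Dt; rewrite mul1r; exact: mellin_integrand_le DR Dt.
Qed.

Lemma mellin_on_line_le D gamma f y : D `<=` @Rplus R -> measurable D ->
  in_L1 D (fun x => x `^ (- gamma)) f ->
  nrm (mellin_on D f (1 - (gamma +i* y))) <=
  \int[mu]_(t in D) (t `^ (- gamma) * nrm (f t)).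
Proof.
move=> DR mD fi; rewrite mellin_on_lineE; apply: cintegral_nrm_le => //.
- apply: cmeasM; first exact: in_L1_cmeas DR fi.
  by apply: cmeas_cpow => //; exact: cmeas_cst.
- by move=> t Dt; exact: mellin_integrand_le DR Dt.
- exact: in_L1_nrm.
Qed.

Lemma ccvg_scale (c : R[i]) (a : nat -> R[i]) l :
  nrm (a n - l) @[n --> \oo] --> 0 -> nrm (c * a n - c * l) @[n --> \oo] --> 0.
Proof.
move=> al; rewrite -(mulr0 (nrm c)).
rewrite (_ : (fun _ => _) = (fun n => nrm c * nrm (a n - l))); last first.
  by apply/funext => n; rewrite -mulrBr nrmM.
by apply: cvgM => //; exact: cvg_cst.
Qed.

(** The truncation [1/N, N] of [is_mellin] at N = n + 1. *)
Definition Rsym n : set T := `[n.+1%:R^-1, n.+1%:R]%classic.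

Lemma measurable_Rsym n : measurable (Rsym n). Proof. exact: measurable_itv. Qed.

Lemma Rsym_nd : nondecreasing_seq Rsym.
Proof.
apply/nondecreasing_seqP => n; apply/subsetPset => x /=; rewrite /Rsym /= !in_itv/=.
move=> /andP[h1 h2]; apply/andP; split.
  by apply: le_trans h1; rewrite lef_pV2 ?posrE ?ltr0n// ler_nat.
by apply: le_trans h2 _; rewrite ler_nat.
Qed.

Lemma Rsym_sub n : Rsym n `<=` @Rplus R.
Proof.
move=> x; rewrite /Rsym /= in_itv/= => /andP[h _].
by rewrite RplusE; apply: lt_le_trans h; rewrite invr_gt0 ltr0n.
Qed.

Lemma Rsym_bigcup : \bigcup_n Rsym n = @Rplus R.
Proof.
apply/seteqP; split => x; first by move=> [n _ /Rsym_sub].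
rewrite -Rplus_bigcup => -[n _ /=]; rewrite in_itv/= => /andP[h1 h2].
exists n.+1 => //; rewrite /Rsym /= in_itv/= h2 andbT.
by apply: le_trans h1; rewrite lef_pV2 ?posrE ?ltr0n// ler_nat.
Qed.

Lemma powR_weightV x p : x `^ (1 - p) = (x `^ (p - 1))^-1.
Proof. by rewrite -powRN opprB. Qed.

Lemma measurable_powR' D p : measurable_fun D (fun x : T => x `^ p : R).
Proof. by apply: measurable_funTS; exact: measurable_powR. Qed.

Lemma lebesgue_itv_lty (a b : R) : (lebesgue_measure (`[a, b]%classic : set R) < +oo)%E.
Proof. by rewrite lebesgue_measure_itv; case: ifP => _; rewrite ltry. Qed.

(** Cauchy-Schwarz against x^{- gamma}: its squared modulus times the dual weight x^{2 gamma - 1} is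
    1/x, which is at most n + 1 on the truncated interval. *)
Lemma in_L2_in_L1_Rsym n gamma f :
  in_L2 (@Rplus R) (fun x => x `^ (1 - 2 * gamma)) f ->
  in_L1 (Rsym n) (fun x => x `^ (- gamma)) f.
Proof.
move=> f2; have mR := @measurable_Rplus R; have mE := measurable_Rsym n.
have fE : in_L2 (Rsym n) (fun x => x `^ (1 - 2 * gamma)) f.
  apply: (in_L2_sub mR mE (@Rsym_sub n) _ _ f2); first exact: measurable_powR'.
  by move=> x _; exact: powR_ge0.
have w0 x : Rsym n x -> 0 < x `^ (2 * gamma - 1).
  by move/Rsym_sub; rewrite RplusE => x0; rewrite powR_gt0.
apply: (L2_pairing_integrable (u := fun x => (x `^ (- gamma))%:C) mE
  (measurable_powR' _) (measurable_powR' _) w0 _ _ fE).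
  by move=> x _; exact: powR_weightV.
split; first by apply: cmeas_real; exact: measurable_powR'.
apply: (@le_lt_trans _ _ (\int[mu]_(x in Rsym n) (n.+1%:R)%:E)%E); last first.
  by rewrite integral_cst//; apply: lte_mul_pinfty => //; exact: lebesgue_itv_lty.
apply: ge0_le_integral => //.
- by move=> x _; rewrite lee_fin mulr_ge0 ?powR_ge0 ?sqr_ge0.
- apply/measurable_EFinP; apply: measurable_funM; first exact: measurable_powR'.
  by apply: measurable_funX; apply: measurable_nrm; apply: cmeas_real; exact: measurable_powR'.
- move=> x Ex; have := Ex => /Rsym_sub; rewrite RplusE => x0.
  rewrite lee_fin nrm_real ger0_norm ?powR_ge0// -powR_mulrn ?powR_ge0// -powRrM.
  rewrite -powRD ?(gt_eqF x0) ?implybT//.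
  have -> : 2 * gamma - 1 + - gamma * 2 = -1 by ring.
  rewrite powR_inv1 ?(ltW x0)// -[leRHS]invrK lef_pV2 ?posrE ?invr_gt0//.
  by move: Ex; rewrite /Rsym /= in_itv/= => /andP[].
Qed.

End Parseval.

(** * Parseval formulas for the pairing of K with f *)

Section K_Parseval.
Variable R : realType.
Local Notation mu := (@lebesgue_measure R).
Local Notation T := (measurableTypeR R).
Variables (alpha tau gamma : R).
Hypotheses (alpha0 : 0 < alpha) (gamma0 : 0 < gamma).
Implicit Types (D : set T) (x y : R) (f : T -> R[i]) (fs : R[i] -> R[i]).

Local Notation Ka := (Kfun alpha tau).
Local Notation KM := (K_Mellin alpha tau gamma).

Let twopi0 : (2 * pi)%:C != 0 :> R[i].
Proof. by apply: realc_neq0; rewrite mulf_neq0// gt_eqF// pi_gt0. Qed.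

(** Mellin inversion of K is inserted and the integrals are exchanged, with the product of x^{-
    gamma} |f(x)| and [K_Mellin_bound] as majorant. A general D is allowed so that the truncations
    of the L_2 case are covered. *)
Lemma K_Parseval_L1 D f : D `<=` @Rplus R -> measurable D ->
  in_L1 D (fun x => x `^ (- gamma)) f ->
  [/\ cintegrable D (fun x => Ka x * f x),
      cintegrable [set: T] (fun y => KM y * mellin_on D f (1 - (gamma +i* y))) &
      (2 * pi)%:C * cintegral D (fun x => Ka x * f x) =
      cintegral [set: T] (fun y => KM y * mellin_on D f (1 - (gamma +i* y)))].
Proof.
move=> DR mD fi; have mf := in_L1_cmeas DR fi.
pose F (x y : T) : R[i] := KM y * (f x * cpow x (- (gamma +i* y))).
have ib := integrable_K_Mellin_bound alpha gamma0.
have [||i1 i2 E] := @cfubini R D setT F _ _ mD measurableT _ (in_L1_nrm mD fi) ib.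
- apply: cmeasM; last exact: cmeas_mellin_joint.
  have mK := cmeas_K_Mellin tau alpha0 gamma0.
  have /= := @cmeas_comp _ _ _ _ R setT (D `*` setT) _ snd measurableT _ _ mK.
  by apply => //; exact: measurable_snd'.
- move=> x y Dx _; rewrite nrmM mulrC; apply: ler_pM; rewrite ?nrm_ge0//.
    exact: mellin_integrand_le DR Dx.
  exact: K_Mellin_le.
have E1 x : D x -> cintegral setT (F x) = (2 * pi)%:C * (Ka x * f x).
  move=> /DR; rewrite RplusE => x0; rewrite mulrA (K_Mellin_inversion tau alpha0 gamma0 x0).
  have iKc : cintegrable [set: T] (fun y => KM y * cpow x (- (gamma +i* y))).
    apply: (cintegrable_le measurableT _ _ (integrable_realZ (x `^ (- gamma)) measurableT ib)).
      by apply: cmeasM; [exact: cmeas_K_Mellin|exact: cmeas_cpow_line].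
    move=> y _; rewrite nrmM (nrm_cpow_line gamma y x0) mulrC.
    by apply: ler_wpM2l; [exact: powR_ge0|exact: K_Mellin_le].
  apply: (etrans _ (mulrC _ _)); apply: (etrans _ (cintegralZ (f x) measurableT iKc)).
  by apply: eq_cintegral => y _; exact: mulrCA.
have E2 y : cintegral D (F^~ y) = KM y * mellin_on D f (1 - (gamma +i* y)).
  have iM : cintegrable D (fun x => f x * cpow x (- (gamma +i* y))).
    apply: (cintegrable_le mD _ _ (in_L1_nrm mD fi)).
      apply: cmeasM; first exact: mf.
      by apply: cmeas_cpow; [exact: measurable_id|exact: cmeas_cst].
    by move=> x Dx; exact: mellin_integrand_le DR Dx.
  by rewrite mellin_on_lineE; exact: (cintegralZ _ mD iM).
have i0 : cintegrable D (fun x => Ka x * f x).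
  apply: (eq_cintegrable mD _ (cintegrableZ ((2 * pi)%:C)^-1 mD i1)) => x Dx.
  by rewrite (E1 _ Dx) mulKf.
split; [exact: i0|by apply: (eq_cintegrable measurableT _ i2) => y _; exact: E2|].
apply: (etrans (esym (cintegralZ _ mD i0))); apply: (etrans (esym (eq_cintegral E1))).
by apply: (etrans E); apply: eq_cintegral => y _; exact: E2.
Qed.

Lemma cmeas_opp f : cmeas [set: T] f -> cmeas [set: T] (fun y => f (- y)).
Proof.
by move=> mf; apply: (@cmeas_comp _ _ _ _ R setT setT f (fun y : T => - y)) => //; exact: oppr_measurable.
Qed.

(** The majorant [K_Mellin_bound] is even, bounded and integrable, hence square integrable. *)
Lemma K_Mellin_opp_in_L2 : in_L2 [set: T] (fun=> 1) (fun y => KM (- y)).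
Proof.
split; first by apply: cmeas_opp; exact: cmeas_K_Mellin.
have := integrable_K_Mellin_bound alpha gamma0.
move=> /(integrable_realZ (cosh_cst (alpha * gamma) * Gamma_real gamma) measurableT) i1.
have /integrableP[_ foo] := i1; apply: le_lt_trans foo.
apply: ge0_le_integral => //.
- by move=> y _; rewrite lee_fin mul1r sqr_ge0.
- apply/measurable_EFinP; apply: measurable_funM => //; apply: measurable_funX.
  by apply: measurable_nrm; apply: cmeas_opp; exact: cmeas_K_Mellin.
- by apply: measurableT_comp => //; exact: measurable_int i1.
move=> y _; rewrite lee_fin mul1r /=; apply: le_trans (ler_norm _).
have B0 := K_Mellin_bound_ge0 tau alpha0 gamma0 y.
have hb : nrm (KM (- y)) <= K_Mellin_bound alpha gamma y.
  by apply: (le_trans (K_Mellin_le _ alpha0 gamma0 _)); rewrite /K_Mellin_bound /dq mulNr sqrrN.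
rewrite expr2; apply: ler_pM; rewrite ?nrm_ge0//; apply: (le_trans hb).
rewrite /K_Mellin_bound mulrA ler_piMr ?dqV_le1//.
by apply: mulr_ge0; [exact: cosh_cst_ge0|exact: Gamma_real_ge0].
Qed.

(* [fs] is given on [Re s = 1 - gamma], where [1 - s] has ordinate [- y]; the
   integrals over [y] are therefore reflected. *)
Lemma K_Parseval_L2 f fs : in_L2 (@Rplus R) (fun x => x `^ (1 - 2%:R * gamma)) f ->
  mean_square_limit [set: R] (fun=> 1)
     (fun N y => mellin_on `[N^-1, N] f (Defs.vline (1 - gamma) y))
     (fun y => fs (Defs.vline (1 - gamma) y)) ->
  [/\ cintegrable (@Rplus R) (fun x => Ka x * f x),
      cintegrable [set: T] (fun y => KM y * fs (1 - (gamma +i* y))) &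
      (2 * pi)%:C * cintegral (@Rplus R) (fun x => Ka x * f x) =
      cintegral [set: T] (fun y => KM y * fs (1 - (gamma +i* y)))].
Proof.
move=> f2 [fs2 lim]; have mR := @measurable_Rplus R.
have K2 := K_in_L2 tau alpha0 (mulr_gt0 (@ltr0Sn R 1) gamma0).
have w0 x : @Rplus R x -> 0 < x `^ (2 * gamma - 1).
  by rewrite RplusE => x0; rewrite powR_gt0.
have iKf : cintegrable (@Rplus R) (fun x => Ka x * f x).
  apply: (L2_pairing_integrable mR (measurable_powR' _) (measurable_powR' _) w0 _ K2 f2).
  by move=> x _; exact: powR_weightV.
have opp_line y : (1 - gamma) +i* y = 1 - (gamma +i* (- y)) :> R[i].
  by rewrite one_minus_line opprK.
have m1 : measurable_fun [set: T] (fun=> 1 : R) by exact: measurable_cst.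
have i1V (y : T) : [set: T] y -> 1 = 1^-1 :> R by rewrite invr1.
have l01 (y : T) : [set: T] y -> 0 < 1 :> R by [].
have P n := K_Parseval_L1 (@Rsym_sub R n) (@measurable_Rsym R n) (in_L2_in_L1_Rsym n f2).
pose v n y := mellin_on (@Rsym R n) f (Defs.vline (1 - gamma) y).
have Pn n : cintegrable [set: T] (fun y => KM (- y) * v n y) /\
    (2 * pi)%:C * cintegral (@Rsym R n) (fun x => Ka x * f x) =
    cintegral [set: T] (fun y => KM (- y) * v n y).
  have [_ i2 ->] := P n; have [i3 ->] := cintegral_reflect i2.
  have E : (fun y => KM (- y) * mellin_on (@Rsym R n) f (1 - (gamma +i* - y))) =
    (fun y => KM (- y) * v n y) by apply/funext => y; rewrite /v -opp_line.
  by rewrite -E.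
have iu := L2_pairing_integrable measurableT m1 m1 l01 i1V K_Mellin_opp_in_L2 fs2.
have [i3 E3] := cintegral_reflect iu.
have E4 : (fun y => KM (- - y) * fs (Defs.vline (1 - gamma) (- y))) =
    (fun y => KM y * fs (1 - (gamma +i* y))).
  by apply/funext => y; rewrite opprK /Defs.vline one_minus_line.
split; [exact: iKf|by rewrite -E4|].
apply: (etrans _ (etrans E3 (congr1 _ E4))).
(* Both sides are limits of the truncated identities: the left one by exhaustion of the half-line,
   the right one by continuity of the pairing with [K_Mellin]. *)
have c0 := ccvg_exhaust (@measurable_Rsym R) (@Rsym_nd R) (@Rsym_bigcup R) iKf.
have c1 := ccvg_scale (2 * pi)%:C c0.
have {}c1 : nrm (cintegral [set: T] (fun y => KM (- y) * v n y) -
    (2 * pi)%:C * cintegral (@Rplus R) (fun x => Ka x * f x)) @[n --> \oo] --> 0.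
  move: c1; apply: cvg_trans; apply: near_eq_cvg; apply: nearW => n.
  by congr (nrm (_ - _)); exact: (Pn n).2.
apply: (ccvg_unique c1).
apply: (L2_pairing_cvg measurableT m1 m1 l01 i1V K_Mellin_opp_in_L2 fs2).
- move=> n; have := cmeas_opp (cmeas_mellin_on_line (@Rsym_sub R n)
    (@measurable_Rsym R n) (in_L2_in_L1_Rsym n f2)).
  by apply: eq_cmeas => y _; rewrite /v -opp_line.
- by move=> n; exact: (Pn n).1.
- exact: cvg_at_nat lim.
Qed.

Lemma K_Parseval f fs : is_mellin gamma f fs ->
  [/\ cintegrable (@Rplus R) (fun x => Ka x * f x),
      cintegrable [set: T] (fun y => KM y * fs (1 - (gamma +i* y))) &
      (2 * pi)%:C * cintegral (@Rplus R) (fun x => Ka x * f x) =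
      cintegral [set: T] (fun y => KM y * fs (1 - (gamma +i* y)))].
Proof.
move=> [[f1 Hfs]|[f2 lim]]; last exact: K_Parseval_L2.
have [i1 i2 E] := K_Parseval_L1 (@subset_refl _ _) (@measurable_Rplus R) f1.
have E4 : (fun y => KM y * mellin_on (@Rplus R) f (1 - (gamma +i* y))) =
    (fun y => KM y * fs (1 - (gamma +i* y))).
  by apply/funext => y; rewrite one_minus_line -[_ +i* - y]/(Defs.vline (1 - gamma) (- y)) Hfs.
by rewrite -E4.
Qed.

End K_Parseval.

(** * Pairing of K with the contour integral G_alpha f *)

Section G_transform.
Variable R : realType.
Local Notation mu := (@lebesgue_measure R).
Local Notation T := (measurableTypeR R).
Variables (alpha gamma : R).
Hypotheses (alpha0 : 0 < alpha) (gamma0 : 0 < gamma).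
Implicit Types (D : set T) (x y tau : R) (f g h : T -> R[i]) (fs : R[i] -> R[i]).

Lemma ag_gt0 : 0 < alpha * gamma. Proof. exact: mulr_gt0. Qed.

(** The inverse is written as the conjugate divided by the squared modulus, with real powers for the
    division. *)
Lemma cmeasV D f : (forall x, D x -> f x != 0) -> cmeas D f -> cmeas D (fun x => (f x)^-1).
Proof.
move=> f0 [m1 m2].
have mn : measurable_fun D (fun x => nrm (f x) `^ (-1) : R).
  have := @measurable_nrm _ _ _ D f (conj m1 m2).
  exact: (measurableT_comp (@measurable_powR R (-1))).
have mc : cmeas D (fun x => (nrm (f x) `^ (-1))%:C * (nrm (f x) `^ (-1))%:C *
    (Cre (f x) +i* - Cim (f x))).
  apply: cmeasM; first by apply: cmeasM; exact: cmeas_real.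
  by apply: cmeas_Complex => //; exact: measurableT_comp.
apply: (eq_cmeas _ mc) => x Dx; have fx0 := f0 _ Dx.
rewrite powR_inv1 ?nrm_ge0// -realcM -invfM -expr2 nrm_sqr realcV.
apply: (mulfI fx0); rewrite mulfV//.
have n0 : (Cre (f x) ^+ 2 + Cim (f x) ^+ 2)%:C != 0 :> R[i].
  by apply: realc_neq0; rewrite -nrm_sqr expf_neq0// nrm_eq0.
rewrite mulrCA (_ : f x * _ = (Cre (f x) ^+ 2 + Cim (f x) ^+ 2)%:C) ?mulVf//.
by case: (f x) => a b; apply: complex_eq => /=; ring.
Qed.

Lemma scale_line y : alpha%:C * (gamma +i* y) = (alpha * gamma) +i* (alpha * y) :> R[i].
Proof. by apply: complex_eq; rewrite ?Re_realM ?Im_realM. Qed.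

Lemma Re_scale_line y : Cre (alpha%:C * (gamma +i* y)) = alpha * gamma.
Proof. by rewrite scale_line. Qed.

Lemma cmeas_Gamma_ratio_line : cmeas [set: T] (fun y => Gamma_ratio alpha (gamma +i* y)).
Proof.
apply: cmeasM; first exact: cmeas_Gamma_line.
apply: cmeasV; first by move=> y _; apply: Gamma_neq0; rewrite Re_scale_line ag_gt0.
have mG := cmeas_Gamma_line ag_gt0.
have h := @cmeas_comp _ _ _ _ R setT setT _ (fun y : T => alpha * y : T) measurableT
  (fun _ _ => I) (@mulrl_measurable R setT alpha) mG.
by apply: (eq_cmeas _ h) => y _; rewrite scale_line.
Qed.

Lemma cmeas_cpow_scale_line D x : cmeas D (fun y : T => cpow x (alpha%:C * (gamma +i* y))).
Proof.
apply: cmeas_cpow; first exact: measurable_cst.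
apply: cmeasM; first exact: cmeas_cst.
by apply: cmeas_Complex; [exact: measurable_cst|exact: measurable_id].
Qed.

Lemma cmeas_cpow_scale_joint (D : set (T * T)) :
  cmeas D (fun p : T * T => cpow p.1 (alpha%:C * (gamma +i* p.2) - 1)).
Proof.
apply: cmeas_cpow; first exact: measurable_fst'.
apply: cmeasB; last exact: cmeas_cst.
apply: cmeasM; first exact: cmeas_cst.
by apply: cmeas_Complex; [exact: measurable_cst|exact: measurable_snd'].
Qed.

Lemma nrm_cpow_scale_line x y : 0 < x ->
  nrm (cpow x (alpha%:C * (gamma +i* y) - 1)) = x `^ (alpha * gamma - 1).
Proof. by move=> x0; rewrite nrm_cpow// ReD ReN Re_scale_line. Qed.

(** The density h is left free: it is the quotient times the Mellin transform of f in the pairing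
    with K, and the same divided by 2 pi in the construction of the mean square limit. *)
Definition contour_integral D h x : R[i] :=
  cintegral D (fun y => h y * cpow x (alpha%:C * (gamma +i* y) - 1)).

Lemma contour_integrable D h x : measurable D -> cintegrable D h -> 0 < x ->
  cintegrable D (fun y => h y * cpow x (alpha%:C * (gamma +i* y) - 1)).
Proof.
move=> mD ih x0; apply: (cintegrable_le mD _ _
  (integrable_realZ (x `^ (alpha * gamma - 1)) mD (cintegrable_nrm mD ih))).
  apply: cmeasM; first exact: cintegrable_cmeas.
  apply: cmeas_cpow; first exact: measurable_cst.
  apply: cmeasB; last exact: cmeas_cst.
  apply: cmeasM; first exact: cmeas_cst.
  by apply: cmeas_Complex; [exact: measurable_cst|exact: measurable_id].
by move=> y _; rewrite nrmM (nrm_cpow_scale_line y x0) mulrC.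
Qed.

Lemma cmeas_contour_joint D h : measurable D -> cintegrable D h ->
  cmeas (@Rplus R `*` D)
    (fun p : T * T => h p.2 * cpow p.1 (alpha%:C * (gamma +i* p.2) - 1)).
Proof.
move=> mD ih; apply: cmeasM; last exact: cmeas_cpow_scale_joint.
apply: (@cmeas_comp _ _ _ _ R D (@Rplus R `*` D) h snd mD _ _ (cintegrable_cmeas ih)).
  by move=> p [].
exact: measurable_snd'.
Qed.

Lemma cmeas_contour_integral D h : measurable D -> cintegrable D h ->
  cmeas (@Rplus R : set T) (contour_integral D h).
Proof.
move=> mD ih; apply: (@cmeas_param R (@Rplus R) D
  (fun x y => h y * cpow x (alpha%:C * (gamma +i* y) - 1))
  (fun x => x `^ (alpha * gamma - 1)) (fun y => nrm (h y)) (@measurable_Rplus R) mD).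
- exact: cmeas_contour_joint.
- exact: measurable_powR'.
- by move=> x _; exact: powR_ge0.
- exact: cintegrable_nrm.
- by move=> y _; exact: nrm_ge0.
- move=> x y; rewrite RplusE => x0 _.
  by rewrite nrmM (nrm_cpow_scale_line y x0) mulrC.
Qed.

Lemma K_contour_integral tau D h : measurable D -> cintegrable D h ->
  cintegrable (@Rplus R) (fun x => Kfun 1 tau x * contour_integral D h x) /\
  cintegral (@Rplus R) (fun x => Kfun 1 tau x * contour_integral D h x) =
  cintegral D (fun y => h y * (Gamma (alpha%:C * (gamma +i* y)) *
    cosh_transform tau (alpha%:C * (gamma +i* y)))).
Proof.
move=> mD ih; have mR := @measurable_Rplus R.
pose F (x y : T) : R[i] :=
  Kfun 1 tau x * (h y * cpow x (alpha%:C * (gamma +i* y) - 1)).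
have ia := integrable_K_power tau (@ltr01 R) ag_gt0.
have [||i1 i2 E] := @cfubini R (@Rplus R) D F _ _ mR mD _ ia (cintegrable_nrm mD ih).
- apply: cmeasM; last exact: cmeas_contour_joint.
  apply: (@cmeas_comp _ _ _ _ R (@Rplus R) (@Rplus R `*` D) (Kfun 1 tau) fst mR).
  + by move=> p [].
  + exact: measurable_fst'.
  + exact: cmeas_K.
- move=> x y; rewrite RplusE => x0 _; rewrite nrmM nrmM (nrm_cpow_scale_line y x0).
  by rewrite [nrm (h y) * _]mulrC mulrA.
have E1 x : @Rplus R x -> cintegral D (F x) = Kfun 1 tau x * contour_integral D h x.
  by rewrite RplusE => x0; exact: (cintegralZ _ mD (contour_integrable mD ih x0)).
have E2 y : cintegral (@Rplus R) (F^~ y) = h y * (Gamma (alpha%:C * (gamma +i* y)) *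
    cosh_transform tau (alpha%:C * (gamma +i* y))).
  have s0 : 0 < Cre (alpha%:C * (gamma +i* y)) by rewrite Re_scale_line ag_gt0.
  have M := Mellin_K tau (@ltr01 R) s0; rewrite rmorph1 mul1r in M.
  have iM : cintegrable (@Rplus R) (fun x : T =>
      Kfun 1 tau x * cpow x (alpha%:C * (gamma +i* y) - 1)).
    apply: (cintegrable_le mR _ _ ia).
      apply: cmeasM; first exact: cmeas_K.
      by apply: cmeas_cpow; [exact: measurable_id|exact: cmeas_cst].
    by move=> x; rewrite RplusE => x0; rewrite nrmM (nrm_cpow_scale_line y x0).
  rewrite -M; apply: (etrans _ (cintegralZ (h y) mR iM)).
  by apply: eq_cintegral => x _; exact: mulrCA.
split; first exact: (eq_cintegrable mR E1 i1).
apply: (etrans (esym (eq_cintegral E1))); apply: (etrans E).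
by apply: eq_cintegral => y _; exact: E2.
Qed.

Let ratio_fs fs y := Gamma_ratio alpha (gamma +i* y) * fs (1 - (gamma +i* y)).

(** The cancellation on which the theorem rests; it is legitimate because Gamma has no zero in the
    right half-plane. *)
Lemma ratio_K_Mellin tau y : Gamma_ratio alpha (gamma +i* y) *
  (Gamma (alpha%:C * (gamma +i* y)) * cosh_transform tau (alpha%:C * (gamma +i* y))) =
  K_Mellin alpha tau gamma y.
Proof.
have G0 : Gamma (alpha%:C * (gamma +i* y)) != 0.
  by apply: Gamma_neq0; rewrite Re_scale_line ag_gt0.
by rewrite /Gamma_ratio mulrA divfK.
Qed.

Let twopi0 : (2 * pi)%:C != 0 :> R[i].
Proof. by apply: realc_neq0; rewrite mulf_neq0// gt_eqF// pi_gt0. Qed.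

Lemma G_mellin_contour D fs x : G_mellin_on alpha gamma D fs x =
  ((2 * pi)^-1)%:C * contour_integral D (ratio_fs fs) x.
Proof. by []. Qed.

Lemma K_G_mellin tau D fs : measurable D -> cintegrable D (ratio_fs fs) ->
  cintegrable (@Rplus R) (fun x => Kfun 1 tau x * G_mellin_on alpha gamma D fs x) /\
  (2 * pi)%:C * cintegral (@Rplus R) (fun x => Kfun 1 tau x * G_mellin_on alpha gamma D fs x) =
  cintegral D (fun y => K_Mellin alpha tau gamma y * fs (1 - (gamma +i* y))).
Proof.
move=> mD ih; have mR := @measurable_Rplus R.
have [i1 E] := K_contour_integral tau mD ih.
have E0 : (fun x => Kfun 1 tau x * G_mellin_on alpha gamma D fs x) =
    (fun x => ((2 * pi)^-1)%:C * (Kfun 1 tau x * contour_integral D (ratio_fs fs) x)).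
  by apply/funext => x; rewrite G_mellin_contour mulrCA.
rewrite E0; split; first exact: cintegrableZ.
rewrite (cintegralZ _ mR i1) realcV mulVKf// E.
apply: eq_cintegral => y _; rewrite /ratio_fs -(ratio_K_Mellin tau).
by rewrite mulrAC.
Qed.

Definition represents_FKL f g := forall tau,
  [/\ cintegrable (@Rplus R) (fun x => K alpha (0 +i* tau) x%:C * f x),
      cintegrable (@Rplus R) (fun x => K 1 (0 +i* tau) x%:C * g x)
    & FKL alpha f tau = FKL 1 g tau].

Lemma represents_G_mellin f fs g : is_mellin gamma f fs ->
  vline_L1 gamma (fun s => Gamma_ratio alpha s * fs (1 - s)) ->
  (forall x, 0 < x -> g x = G_mellin_on alpha gamma [set: R] fs x) ->
  represents_FKL f g.
Proof.
move=> ff hL1 gE tau; have mR := @measurable_Rplus R.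
have [iKf _ E1] := K_Parseval tau alpha0 gamma0 ff.
have ih : cintegrable [set: T] (ratio_fs fs).
  by apply: (eq_cintegrable measurableT _ hL1) => y _; rewrite mul1r.
have [iKG E2] := K_G_mellin tau measurableT ih.
have E3 x : @Rplus R x -> Kfun 1 tau x * G_mellin_on alpha gamma [set: R] fs x =
    K 1 (0 +i* tau) x%:C * g x.
  by rewrite RplusE => x0; rewrite gE.
split; [exact: iKf|exact: (eq_cintegrable mR E3 iKG)|].
rewrite /FKL -(eq_cintegral E3); apply: (mulfI twopi0).
exact: etrans E1 (esym E2).
Qed.

(** Cauchy-Schwarz against the constant 1, which is square integrable on a bounded interval. *)
Lemma in_L2_integrable_itv (a b : R) h : in_L2 [set: T] (fun=> 1) h ->
  cintegrable (`[a, b]%classic : set T) h.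
Proof.
move=> h2; have mI : measurable (`[a, b]%classic : set T) by exact: measurable_itv.
have m1 D : measurable_fun D (fun=> 1 : R) by exact: measurable_cst.
have i1V (y : T) : `[a, b]%classic y -> 1 = 1^-1 :> R by rewrite invr1.
have l01 (y : T) : `[a, b]%classic y -> 0 < 1 :> R by [].
have hI := in_L2_sub measurableT mI (@subsetT _ _) (m1 _) (fun _ _ => ler01) h2.
have o2 : in_L2 (`[a, b]%classic : set T) (fun=> 1) (fun=> 1 : R[i]).
  split; first exact: cmeas_cst.
  rewrite /sqnorm; under eq_integral do rewrite (nrm_real (1 : R)) normr1 expr1n mulr1.
  by rewrite integral_cst// mul1e; exact: lebesgue_itv_lty.
have := L2_pairing_integrable mI (m1 _) (m1 _) l01 i1V o2 hI.
by apply: eq_cintegrable => // y _; rewrite mul1r.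
Qed.

(** The identity holds on the truncated contours [-(n + 1), n + 1]. The pairings of K_{i tau} with
    the truncations converge because K_{i tau} lies in L_2(x^{2 alpha gamma - 1} dx), dual to the
    space of the mean square limit; the contour side converges because [K_Mellin] times [fs] is
    integrable on the whole line. *)
Lemma represents_mean_square f fs g : is_mellin gamma f fs ->
  vline_L2 gamma (fun s => Gamma_ratio alpha s * fs (1 - s)) ->
  mean_square_limit (@Rplus R) (fun x => x `^ (1 - 2%:R * alpha * gamma))
    (fun t => G_mellin_on alpha gamma `[- t, t] fs) g ->
  represents_FKL f g.
Proof.
move=> ff hL2 [g2 lim] tau; have mR := @measurable_Rplus R.
have [iKf iM E1] := K_Parseval tau alpha0 gamma0 ff.
pose I n : set T := `[- n.+1%:R : R, n.+1%:R]%classic.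
have mI n : measurable (I n) by exact: measurable_itv.
have ih n : cintegrable (I n) (ratio_fs fs) := in_L2_integrable_itv _ _ hL2.
have p0 : 0 < 2 * alpha * gamma by rewrite -mulrA mulr_gt0// ag_gt0.
have K2 := K_in_L2 tau (@ltr01 R) p0.
have w0 x : @Rplus R x -> 0 < x `^ (2 * alpha * gamma - 1).
  by rewrite RplusE => x0; rewrite powR_gt0.
have wV x : @Rplus R x -> x `^ (1 - 2 * alpha * gamma) = (x `^ (2 * alpha * gamma - 1))^-1.
  by move=> _; exact: powR_weightV.
have iKg := L2_pairing_integrable mR (measurable_powR' _) (measurable_powR' _) w0 wV K2 g2.
have P n := K_G_mellin tau (mI n) (ih n).
have c1 := L2_pairing_cvg mR (measurable_powR' _) (measurable_powR' _) w0 wV K2 g2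
  (vn := fun n => G_mellin_on alpha gamma (I n) fs).
have {}c1 := ccvg_scale (2 * pi)%:C (c1 (fun n => cmeasM (cmeas_cst _ _)
  (cmeas_contour_integral (mI n) (ih n))) (fun n => (P n).1) (cvg_at_nat lim)).
have c2 := ccvg_exhaust mI (@line_nd R) (@line_bigcup R) iM.
split; [exact: iKf|exact: iKg|].
apply: (mulfI twopi0); apply: (etrans E1).
apply: (ccvg_unique c2); move: c1; apply: cvg_trans; apply: near_eq_cvg; apply: nearW => n.
by congr (nrm (_ - _)); exact: (P n).2.
Qed.

Lemma cpow_div_powR t x p (s : R[i]) : 0 < t -> 0 < x ->
  cpow (t / x `^ p) (- s) = cpow t (- s) * cpow x (p%:C * s).
Proof.
move=> t0 x0; have xp0 : 0 < (x `^ p)^-1 by rewrite invr_gt0 powR_gt0.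
rewrite (cpowM _ t0 xp0) -cpow_powR -[(x `^ p)^-1]powR_inv1 ?powR_ge0//.
by rewrite (cpow_powR _ (-1)) rmorphN1 mulN1r opprK.
Qed.

(** Fubini in t and y; the absolute convergence in y that it needs comes from the quadratic decay of
    the quotient for alpha < 1. *)
Lemma G_kernel_mellin f x : alpha < 1 -> in_L1 (@Rplus R) (fun x => x `^ (- gamma)) f ->
  0 < x -> G_kernel alpha gamma f x =
  G_mellin_on alpha gamma [set: R] (mellin_on (@Rplus R) f) x.
Proof.
move=> a1 fi x0; have mR := @measurable_Rplus R.
have [a a0 Ha] := Gamma_ratio_decay alpha0 gamma0 a1.
pose C : R := ratio_cst alpha gamma.
have rle y : nrm (Gamma_ratio alpha (gamma +i* y)) <= C * (dq a y)^-1.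
  by rewrite ler_pdivlMr ?dq_gt0// Ha.
have ir := integrable_realZ C measurableT (integrable_dqV a0).
have ib := integrable_realZ (x `^ (alpha * gamma)) measurableT ir.
have mf := in_L1_cmeas (@subset_refl _ _) fi.
have inf := in_L1_nrm mR fi.
pose r (y : T) := Gamma_ratio alpha (gamma +i* y) * cpow x (alpha%:C * (gamma +i* y)).
have mr : cmeas [set: T] r.
  by apply: cmeasM; [exact: cmeas_Gamma_ratio_line|exact: cmeas_cpow_scale_line].
have r_le y : nrm (r y) <= x `^ (alpha * gamma) * (C * (dq a y)^-1).
  rewrite nrmM (nrm_cpow _ x0) Re_scale_line mulrC.
  by apply: ler_wpM2l; [exact: powR_ge0|exact: rle].
pose F (t y : T) : R[i] := r y * (f t * cpow t (- (gamma +i* y))).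
have [||i1 i2 E] := @cfubini R (@Rplus R) setT F _ _ mR measurableT _ inf ib.
- apply: cmeasM; last exact: (cmeas_mellin_joint setT gamma (@subset_refl _ _) mR mf).
  apply: (@cmeas_comp _ _ _ _ R setT (@Rplus R `*` setT) r snd measurableT _ _ mr).
    by move=> p [].
  exact: measurable_snd'.
- move=> t y Rt _; rewrite nrmM mulrC; apply: ler_pM; [exact: nrm_ge0|exact: nrm_ge0| |exact: r_le].
  exact: mellin_integrand_le (@subset_refl _ _) Rt.
have E1 t : @Rplus R t -> cintegral setT (F t) =
    (2 * pi)%:C * (Phi alpha gamma (t / x `^ alpha) * f t).
  rewrite RplusE => t0.
  have u0 : 0 < t / x `^ alpha := divr_gt0 t0 (powR_gt0 alpha x0).
  have iP : cintegrable [set: T] (fun y => Gamma_ratio alpha (gamma +i* y) *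
      cpow (t / x `^ alpha) (- (gamma +i* y))).
    apply: (cintegrable_le measurableT _ _
      (integrable_realZ ((t / x `^ alpha) `^ (- gamma)) measurableT ir)).
      by apply: cmeasM; [exact: cmeas_Gamma_ratio_line|exact: cmeas_cpow_line].
    move=> y _; rewrite nrmM (nrm_cpow_line gamma y u0) mulrC.
    by apply: ler_wpM2l; [exact: powR_ge0|exact: rle].
  rewrite /Phi /vline_integral realcV -mulrA (mulVKf twopi0).
  apply: (etrans _ (mulrC _ _)); apply: (etrans _ (cintegralZ (f t) measurableT iP)).
  apply: eq_cintegral => y _; rewrite /F /r.
  rewrite (cpow_div_powR _ _ t0 x0).
  by move: (Gamma_ratio _ _) (cpow x _) (cpow t _) (f t) => A B C' D'; ring.
have E2 y : cintegral (@Rplus R) (F^~ y) = r y * mellin_on (@Rplus R) f (1 - (gamma +i* y)).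
  have iM : cintegrable (@Rplus R) (fun t => f t * cpow t (- (gamma +i* y))).
    apply: (cintegrable_le mR _ _ inf).
      apply: cmeasM; first exact: mf.
      by apply: cmeas_cpow; [exact: measurable_id|exact: cmeas_cst].
    by move=> t Rt; exact: mellin_integrand_le (@subset_refl _ _) Rt.
  by rewrite mellin_on_lineE; exact: (cintegralZ _ mR iM).
have iPhi : cintegrable (@Rplus R) (fun t => Phi alpha gamma (t / x `^ alpha) * f t).
  apply: (eq_cintegrable mR _ (cintegrableZ ((2 * pi)%:C)^-1 mR i1)) => t Rt.
  by rewrite (E1 _ Rt) mulKf.
have E3 : (2 * pi)%:C * cintegral (@Rplus R) (fun t => Phi alpha gamma (t / x `^ alpha) * f t) =
    cintegral setT (fun y : T => r y * mellin_on (@Rplus R) f (1 - (gamma +i* y))).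
  apply: (etrans (esym (cintegralZ _ mR iPhi))); apply: (etrans (esym (eq_cintegral E1))).
  by apply: (etrans E); apply: eq_cintegral => y _; exact: E2.
have i3 : cintegrable setT (fun y : T => r y * mellin_on (@Rplus R) f (1 - (gamma +i* y))).
  by apply: (eq_cintegrable measurableT _ i2) => y _; exact: E2.
rewrite /G_kernel /G_mellin_on /vline_integral; apply: (mulfI twopi0).
rewrite mulrCA E3 [((2 * pi)^-1)%:C]realcV (mulVKf twopi0); apply: (etrans (esym (cintegralZ _ measurableT i3))).
apply: eq_cintegral => y _; rewrite (cpowB1 _ x0).
rewrite /r /Defs.vline; move: (Gamma_ratio _ _) (cpow x _) (mellin_on _ _ _) => A B D'; ring.
Qed.

(** This reduces to the absolutely convergent contour integral: on the line the Mellin transform of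
    f is bounded by the weighted L_1 norm of f, and the quotient is integrable. *)
Lemma represents_G_kernel f g : alpha < 1 ->
  in_L1 (@Rplus R) (fun x => x `^ (- gamma)) f ->
  (forall x, 0 < x -> g x = G_kernel alpha gamma f x) -> represents_FKL f g.
Proof.
move=> a1 fi gE; have mR := @measurable_Rplus R.
apply: (@represents_G_mellin f (mellin_on (@Rplus R) f)); first by left.
  have [a a0 Ha] := Gamma_ratio_decay alpha0 gamma0 a1.
  pose M : R := \int[mu]_(t in @Rplus R) (t `^ (- gamma) * nrm (f t)).
  have ir := integrable_realZ (M * ratio_cst alpha gamma) measurableT (integrable_dqV a0).
  apply: (cintegrable_le measurableT _ _ ir).
    apply: cmeasM; first exact: cmeas_cst.
    apply: cmeasM; first exact: cmeas_Gamma_ratio_line.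
    exact: (cmeas_mellin_on_line (@subset_refl _ _) mR fi).
  move=> y _; rewrite mul1r nrmM mulrC -mulrA; apply: ler_pM; [exact: nrm_ge0|exact: nrm_ge0| |].
    exact: (mellin_on_line_le _ (@subset_refl _ _) mR fi).
  by rewrite ler_pdivlMr ?dq_gt0// Ha.
by move=> x x0; rewrite gE// G_kernel_mellin.
Qed.

Lemma is_G_represents f g : is_G alpha gamma f g -> represents_FKL f g.
Proof.
move=> [[/andP[_ a1] f1 gE]|[fs [ff hL1 gE]]|[fs [ff hL2 lim]]].
- exact: represents_G_kernel.
- exact: represents_G_mellin ff hL1 gE.
- exact: represents_mean_square ff hL2 lim.
Qed.

End G_transform.

(** * Bessel inequality and completeness *)

Section log_abel_kernel.
Variable R : realType.
Local Notation mu := (@lebesgue_measure R).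
Local Notation T := (measurableTypeR R).
Implicit Types (D : set T) (x v e : R) (s : R[i]).

Lemma ccvg_ReIm (a : nat -> R[i]) l : nrm (a n - l) @[n --> \oo] --> 0 ->
  Cre (a n) @[n --> \oo] --> Cre l /\ Cim (a n) @[n --> \oo] --> Cim l.
Proof.
move=> al; have key (g : R[i] -> R) : (forall z w, g (z - w) = g z - g w) ->
    (forall z, `|g z| <= nrm z) -> g (a n) @[n --> \oo] --> g l.
  move=> gB gle; apply/cvgrPdist_le => e e0.
  move/cvgrPdist_le : al => /(_ _ e0); apply: filterS => n.
  by rewrite sub0r normrN ger0_norm ?nrm_ge0// distrC -gB; exact: le_trans.
by split; apply: key => [z w|z]; rewrite ?ReD ?ReN ?ImD ?ImN ?le_Re_nrm ?le_Im_nrm.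
Qed.

Lemma cFTC_exhaust (a b : nat -> R) D (f F : R -> R[i]) (l0 l1 : R[i]) :
  (forall n, a n < b n) -> nondecreasing_seq (fun n => `[a n, b n]%classic) ->
  \bigcup_n `[a n, b n]%classic = D ->
  (forall x, D x -> is_cderive x F (f x)) ->
  (forall x, D x -> ccontinuous_at x f) ->
  nrm (F (a n) - l0) @[n --> \oo] --> 0 -> nrm (F (b n) - l1) @[n --> \oo] --> 0 ->
  cintegrable D f -> cintegral D f = l1 - l0.
Proof.
move=> ab nd UD dF cf /ccvg_ReIm[a1 a2] /ccvg_ReIm[b1 b2] [i1 i2]; apply: complex_eq.
- rewrite ReD ReN /=; apply: (FTC_exhaust (F := fun y => Cre (F y)) ab nd UD _ _ a1 b1 i1) => x Dx.
    by have [] := dF x Dx.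
  by have [] := cf x Dx.
- rewrite ImD ImN /=; apply: (FTC_exhaust (F := fun y => Cim (F y)) ab nd UD _ _ a2 b2 i2) => x Dx.
    by have [] := dF x Dx.
  by have [] := cf x Dx.
Qed.

(** As e^{- e |ln x|} is min(x, 1/x)^e, this is the integrand of the Mellin transform of that factor
    at i v. *)
Definition log_abel e v x : R[i] :=
  (expR (- (e * `|ln x|)))%:C * cpow x ((0 +i* v) - 1).

Lemma nrm_log_abel e v x : 0 < x -> nrm (log_abel e v x) = expR (- (e * `|ln x|)) / x.
Proof.
move=> x0; rewrite nrmM nrm_real ger0_norm ?expR_ge0// nrm_cpow// ReD ReN add0r.
by rewrite powR_inv1 ?(ltW x0).
Qed.

Lemma measurable_exp_ln D e : measurable_fun D (fun x : T => expR (- (e * `|ln x|)) : R).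
Proof.
apply: measurable_funTS; apply: measurableT_comp => //.
apply: measurableT_comp => //; apply: measurable_funM => //.
by apply: measurableT_comp => //; exact: measurable_ln.
Qed.

Lemma cmeas_log_abel D e v : cmeas D (log_abel e v).
Proof.
apply: cmeasM; first by apply: cmeas_real; exact: measurable_exp_ln.
by apply: cmeas_cpow; [exact: measurable_id|exact: cmeas_cst].
Qed.

Lemma integrable_log_abel e : 0 < e ->
  mu.-integrable (@Rplus R) (fun x => (expR (- (e * `|ln x|)) / x)%:E).
Proof.
move=> e0; have mR := @measurable_Rplus R; have [C C0 HC] := exp_le_poisson e0.
apply: (le_integrable mR _ _ (integrable_realZ C mR (integrable_poisson_ln_div R))).
  apply/measurable_EFinP; apply: measurable_funM; first exact: measurable_exp_ln.
  exact: measurable_inv_Rplus.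
move=> x; rewrite RplusE => x0; rewrite /= lee_fin.
have xi : 0 <= x^-1 by rewrite invr_ge0 ltW.
rewrite ger0_norm ?mulr_ge0 ?expR_ge0//; apply: le_trans (ler_norm _).
by rewrite mulrA ler_wpM2r ?HC.
Qed.

Lemma cintegrable_log_abel e v : 0 < e -> cintegrable (@Rplus R) (log_abel e v).
Proof.
move=> e0; apply: (cintegrable_le (@measurable_Rplus R) (@cmeas_log_abel _ e v) _
  (integrable_log_abel e0)).
by move=> x; rewrite RplusE => x0; rewrite nrm_log_abel.
Qed.

Lemma is_cderive_cpow_div s x : s != 0 -> 0 < x ->
  is_cderive x (fun y => s^-1 * cpow y s) (cpow x (s - 1)).
Proof.
move=> s0 x0; apply: is_cderive_eq (is_cderive_scale s^-1 (is_cderive_cpow s x0)) _.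
by rewrite mulKf.
Qed.

Lemma cvg_powR_inv (p : R) : 0 < p -> (n.+2%:R : R) `^ (- p) @[n --> \oo] --> (0 : R).
Proof.
move=> p0; apply: (cvg_comp (fun n => n.+2%:R : R) (fun x => x `^ (- p)) (@cvgr_natD R 2)).
apply/cvgrPdist_le => e e0; near=> x.
have x0 : 0 < x by near: x; apply: nbhs_pinfty_gt; rewrite num_real.
rewrite sub0r normrN ger0_norm ?powR_ge0//.
have h : e `^ (- p^-1) <= x by near: x; apply: nbhs_pinfty_ge; rewrite num_real.
rewrite powRN -[leRHS]invrK lef_pV2 ?posrE ?powR_gt0 ?invr_gt0//.
have -> : e^-1 = (e `^ (- p^-1)) `^ p.
  by rewrite -powRrM mulNr mulVf ?gt_eqF// powR_inv1// ltW.
by apply: ge0_ler_powR; rewrite ?nnegrE ?powR_ge0 ?(ltW p0) ?(ltW x0).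
Unshelve. all: by end_near. Qed.

Lemma cintegral_power_unit s : 0 < Cre s ->
  cintegrable (`]0, 1]%classic : set T) (fun x => cpow x (s - 1)) ->
  cintegral (`]0, 1]%classic : set T) (fun x => cpow x (s - 1)) = s^-1.
Proof.
move=> s0 fi; have sn0 : s != 0 by apply: contraTneq s0 => ->; rewrite ltxx.
(* The index n + 2 keeps the interval [a n, 1] nondegenerate at n = 0. *)
pose a n : R := n.+2%:R^-1.
rewrite -[RHS]subr0; apply: (@cFTC_exhaust a (fun=> 1) _ _ (fun y => s^-1 * cpow y s)) fi.
- by move=> n; rewrite invf_lt1 ?ltr1n ?ltr0n.
- apply/nondecreasing_seqP => n; apply/subsetPset => x /=; rewrite !in_itv/=.
  move=> /andP[h ->]; rewrite andbT; apply: le_trans h.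
  by rewrite lef_pV2 ?posrE ?ltr0n// ler_nat.
- apply/seteqP; split => x /=; rewrite in_itv/=.
    move=> [n _ /=]; rewrite in_itv/= => /andP[h ->]; rewrite andbT.
    by apply: lt_le_trans h; rewrite invr_gt0 ltr0n.
  move=> /andP[x0 x1]; have : @Rplus R x by rewrite RplusE.
  rewrite -Rplus_bigcup => -[n _ /=]; rewrite in_itv/= => /andP[h _].
  exists n => //=; rewrite in_itv/= x1 andbT; apply: le_trans h.
  by rewrite lef_pV2 ?posrE ?ltr0n// ler_nat.
- by move=> x /=; rewrite in_itv/= => /andP[x0 _]; exact: is_cderive_cpow_div.
- move=> x /=; rewrite in_itv/= => /andP[x0 _].
  exact: is_cderive_continuous (is_cderive_cpow (s - 1) x0).
- rewrite (_ : (fun n => _) = (fun n => nrm s^-1 * (n.+2%:R : R) `^ (- Cre s))).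
    by rewrite -(mulr0 (nrm s^-1)); apply: cvgM; [exact: cvg_cst|exact: cvg_powR_inv].
  apply/funext => n; rewrite subr0 nrmM nrm_cpow ?invr_gt0 ?ltr0n//.
  by rewrite /a -[n.+2%:R^-1]powR_inv1 ?ler0n// -powRrM mulN1r.
- rewrite (_ : (fun n => _) = (fun=> 0)); first exact: cvg_cst.
  by apply/funext => n; rewrite cpow1 mulr1 subrr nrm0.
Qed.

Lemma cintegral_power_tail s : 0 < Cre s ->
  cintegrable (`[1, +oo[%classic : set T) (fun x => cpow x (- s - 1)) ->
  cintegral (`[1, +oo[%classic : set T) (fun x => cpow x (- s - 1)) = s^-1.
Proof.
move=> s0 fi; have sn0 : - s != 0 by rewrite oppr_eq0; apply: contraTneq s0 => ->; rewrite ltxx.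
pose b n : R := n.+2%:R.
have -> : s^-1 = 0 - (- s)^-1 by rewrite invrN opprK add0r.
apply: (@cFTC_exhaust (fun=> 1) b _ _ (fun y => (- s)^-1 * cpow y (- s))) fi.
- by move=> n; rewrite ltr1n.
- apply/nondecreasing_seqP => n; apply/subsetPset => x /=; rewrite !in_itv/=.
  move=> /andP[-> h] /=; apply: le_trans h _; by rewrite ler_nat.
- apply/seteqP; split => x /=; rewrite in_itv/= andbT.
    by move=> [n _ /=]; rewrite in_itv/= => /andP[].
  move=> x1; have : @Rplus R x by rewrite RplusE (lt_le_trans ltr01).
  rewrite -Rplus_bigcup => -[n _ /=]; rewrite in_itv/= => /andP[_ h].
  by exists n => //=; rewrite in_itv/= x1.
- move=> x /=; rewrite in_itv/= andbT => x1.
  exact: is_cderive_cpow_div (lt_le_trans ltr01 x1).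
- move=> x /=; rewrite in_itv/= andbT => x1.
  exact: is_cderive_continuous (is_cderive_cpow (- s - 1) (lt_le_trans ltr01 x1)).
- rewrite (_ : (fun n => _) = (fun=> 0)); first exact: cvg_cst.
  by apply/funext => n; rewrite cpow1 mulr1 subrr nrm0.
- rewrite (_ : (fun n => _) = (fun n => nrm (- s)^-1 * (n.+2%:R : R) `^ (- Cre s))).
    by rewrite -(mulr0 (nrm (- s)^-1)); apply: cvgM; [exact: cvg_cst|exact: cvg_powR_inv].
  by apply/funext => n; rewrite subr0 nrmM nrm_cpow ?ltr0n// ReN.
Qed.

(** The parts over ]0, 1] and [1, +oo[ contribute 1/(e + i v) and 1/(e - i v). *)
Lemma cintegral_log_abel e v : 0 < e ->
  cintegral (@Rplus R) (log_abel e v) = (2 * poisson e v)%:C.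
Proof.
move=> e0; have mR := @measurable_Rplus R; have [i1 i2] := cintegrable_log_abel v e0.
have UE : @Rplus R = (`]0, 1[ `|` `[1, +oo[)%classic :> set T.
  apply/seteqP; split => x; rewrite /setU /mkset RplusE /= !in_itv/= andbT.
    by move=> x0; have [x1|x1] := ltP x 1; [left; rewrite x0|right].
  by move=> [/andP[]//|x1]; exact: lt_le_trans x1.
have s1 : (`]0, 1]%classic : set T) `<=` @Rplus R.
  by move=> x /=; rewrite in_itv/= => /andP[x0 _]; rewrite RplusE.
have s2 : (`[1, +oo[%classic : set T) `<=` @Rplus R.
  by move=> x /=; rewrite in_itv/= andbT => x1; rewrite RplusE (lt_le_trans ltr01).
have m1 : measurable (`]0, 1]%classic : set T) by exact: measurable_itv.
have m2 : measurable (`[1, +oo[%classic : set T) by exact: measurable_itv.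
have split_real (f : T -> R) : mu.-integrable (@Rplus R) (EFin \o f) ->
    \int[mu]_(x in @Rplus R) f x =
    \int[mu]_(x in `]0, 1]) f x + \int[mu]_(x in `[1, +oo[) f x.
  move=> fi; rewrite UE Rintegral_setU -?UE//; last first.
    apply/eqP/seteqP; split => // x [] /=; rewrite !in_itv/= andbT => /andP[_ x1].
    by rewrite leNgt x1.
  congr (_ + _); apply: Rintegral_itv_bndo_bndc.
  by apply: (integrableS mR _ _ fi) => //; move=> x /=; rewrite in_itv/= => /andP[x0 _]; rewrite RplusE.
have E : cintegral (@Rplus R) (log_abel e v) =
    cintegral (`]0, 1]%classic : set T) (log_abel e v) +
    cintegral (`[1, +oo[%classic : set T) (log_abel e v).
  by apply: complex_eq; rewrite ?ReD ?ImD /=; exact: split_real.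
have E1 x : (`]0, 1]%classic : set T) x -> log_abel e v x = cpow x ((e +i* v) - 1).
  move=> /= /itvP x01; have x0 : 0 < x by rewrite x01.
  rewrite /log_abel ler0_norm ?ln_le0 ?x01// mulrN opprK -powR_exp// -cpow_real// -cpowD.
  by congr (cpow x _); apply: complex_eq => /=; ring.
have E2 x : (`[1, +oo[%classic : set T) x -> log_abel e v x = cpow x (- (e -i* v) - 1).
  move=> /= /itvP x1; have x0 : 0 < x by rewrite (lt_le_trans ltr01) ?x1.
  rewrite /log_abel ger0_norm ?ln_ge0 ?x1// -mulNr -powR_exp// -cpow_real// -cpowD.
  by congr (cpow x _); apply: complex_eq => /=; ring.
have j1 := eq_cintegrable m1 E1 (cintegrable_sub mR m1 s1 (conj i1 i2)).
have j2 := eq_cintegrable m2 E2 (cintegrable_sub mR m2 s2 (conj i1 i2)).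
rewrite E (eq_cintegral E1) (eq_cintegral E2) cintegral_power_unit// cintegral_power_tail//.
have d0 := poisson_den_gt0 v e0.
by apply: complex_eq; rewrite ?ReD ?ImD /= /poisson ?sqrrN; field; rewrite gt_eqF.
Qed.

End log_abel_kernel.

(** * Complex conjugation *)

Section conjugation.
Variable R : realType.
Local Notation mu := (@lebesgue_measure R).
Local Notation T := (measurableTypeR R).
Implicit Types (D : set T) (z w : R[i]) (x v : R).

Definition cj z : R[i] := Cre z -i* Cim z.

Lemma cjM z w : cj (z * w) = cj z * cj w.
Proof. by case: z w => [a b] [c d]; apply: complex_eq => /=; ring. Qed.

Lemma nrm_cj z : nrm (cj z) = nrm z.
Proof. by case: z => a b; rewrite /cj /= sqrrN. Qed.

Lemma mul_cj z : z * cj z = (nrm z ^+ 2)%:C.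
Proof. by rewrite nrm_sqr; case: z => a b; apply: complex_eq => /=; ring. Qed.

Lemma cj_cpow x v : cj (cpow x (0 +i* v)) = cpow x (0 -i* v).
Proof.
rewrite !cpow_Re /= mulNr cosN sinN mul0r expR0.
by apply: complex_eq; rewrite /cj ?Re_realM ?Im_realM /= ?mul1r.
Qed.

Lemma cmeas_cj d (U : measurableType d) (D : set U) (f : U -> R[i]) : cmeas D f -> cmeas D (fun u => cj (f u)).
Proof. by move=> [f1 f2]; apply: cmeas_Complex => //; exact: measurableT_comp. Qed.

Lemma cj_cintegral D (f : T -> R[i]) : measurable D -> cintegrable D f ->
  cj (cintegral D f) = cintegral D (fun x => cj (f x)).
Proof.
move=> mD [i1 i2]; apply: complex_eq => //=.
rewrite -mulN1r -RintegralZl//.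
by apply: eq_Rintegral => x _; rewrite mulN1r.
Qed.

Lemma le_Rintegral_sub D (f : T -> R) : measurable D ->
  mu.-integrable [set: T] (EFin \o f) -> (forall x, 0 <= f x) ->
  \int[mu]_(x in D) f x <= \int[mu]_x f x.
Proof.
move=> mD fi f0; have fD := integrableS measurableT mD (@subsetT _ _) fi.
rewrite -lee_fin /Rintegral !fineK; try exact: integrable_fin_num.
apply: ge0_subset_integral => //; first exact: measurable_int fi.
by move=> x _; rewrite lee_fin.
Qed.

End conjugation.

(** * The Bessel inequality for Mellin type integrals *)

Section Bessel.
Variable R : realType.
Local Notation mu := (@lebesgue_measure R).
Local Notation T := (measurableTypeR R).
Variables (alpha : R) (D : set T) (h : T -> R[i]).
Hypotheses (alpha0 : 0 < alpha) (mD : measurable D) (ih : cintegrable D h)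
  (h2 : mu.-integrable D (fun y => (nrm (h y) ^+ 2)%:E))
  (D_lty : (mu D < +oo)%E).
Implicit Types (x y v e : R).

(** The contour integral stripped of its factor x^{alpha gamma - 1}: the Fourier integral of h over
    D at the frequency alpha ln x. *)
Definition chirp x : R[i] := cintegral D (fun y => h y * cpow x (0 +i* (alpha * y))).

Definition L1norm : R := \int[mu]_(y in D) nrm (h y).

(** No square root is taken: this is the square of the norm. *)
Definition L2norm : R := \int[mu]_(y in D) (nrm (h y) ^+ 2).

Lemma nrm_cpow_i x v : 0 < x -> nrm (cpow x (0 +i* v)) = 1.
Proof. by move=> x0; rewrite nrm_cpow// powRr0. Qed.

Lemma cmeas_cpow_i E x (f : T -> R) : measurable_fun E f ->
  cmeas E (fun y : T => cpow x (0 +i* f y)).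
Proof. by move=> mf; apply: cmeas_cpow; [exact: measurable_cst|exact: cmeas_Complex]. Qed.

Lemma measurable_scale_id (E : set T) : measurable_fun E (fun y : T => alpha * y : R).
Proof. by apply: measurable_funTS; exact: mulrl_measurable. Qed.

Lemma integrable_nrm_h : mu.-integrable D (EFin \o (fun y => nrm (h y))).
Proof. exact: cintegrable_nrm. Qed.

Lemma chirp_integrable x : 0 < x ->
  cintegrable D (fun y => h y * cpow x (0 +i* (alpha * y))).
Proof.
move=> x0; apply: (cintegrable_le mD _ _ integrable_nrm_h).
  apply: cmeasM; first exact: cintegrable_cmeas.
  by apply: cmeas_cpow_i; exact: measurable_scale_id.
by move=> y _; rewrite nrmM nrm_cpow_i// mulr1.
Qed.

Lemma chirp_le x : 0 < x -> nrm (chirp x) <= L1norm.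
Proof.
move=> x0; apply: (cintegral_nrm_le mD _ _ integrable_nrm_h).
  exact: cintegrable_cmeas (chirp_integrable x0).
by move=> y _; rewrite nrmM nrm_cpow_i// mulr1.
Qed.

Lemma cmeas_h_snd (E : set T) : cmeas (E `*` D) (fun p : T * T => h p.2).
Proof.
apply: (@cmeas_comp _ _ _ _ R D (E `*` D) h snd mD _ _ (cintegrable_cmeas ih)).
  by move=> p [].
exact: measurable_snd'.
Qed.

Lemma cmeas_chirp : cmeas (@Rplus R : set T) chirp.
Proof.
apply: (@cmeas_param R (@Rplus R) D (fun x y => h y * cpow x (0 +i* (alpha * y)))
  (fun=> 1) (fun y => nrm (h y)) (@measurable_Rplus R) mD).
- apply: cmeasM; first exact: cmeas_h_snd.
  apply: cmeas_cpow; first exact: measurable_fst'.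
  apply: cmeas_Complex; first exact: measurable_cst.
  by apply: measurable_funM; [exact: measurable_cst|exact: measurable_snd'].
- exact: measurable_cst.
- by [].
- exact: integrable_nrm_h.
- by move=> y _; exact: nrm_ge0.
- by move=> x y; rewrite RplusE => x0 _; rewrite nrmM nrm_cpow_i// mulr1 mul1r.
Qed.

Lemma young_half (a b p : R) : 0 <= p ->
  a * (b * p) <= 2^-1 * (a ^+ 2 * p + b ^+ 2 * p).
Proof.
move=> p0; rewrite -mulrDl !mulrA; apply: ler_wpM2r => //.
by have := sqr_ge0 (a - b); rewrite sqrrB; lra.
Qed.

Section regularized.
Variable e : R.
Hypothesis e0 : 0 < e.

(** At this stage [chirp] is only known to be bounded, so |chirp|^2/x gets the factor e^{- e |ln x|}
    to become integrable at both ends. *)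
Definition abel_energy_density x : R := expR (- (e * `|ln x|)) / x * nrm (chirp x) ^+ 2.

Lemma measurable_log_abel_joint (E : set (T * T)) (f : T * T -> R) :
  measurable_fun E f -> E `<=` (@Rplus R `*` setT) -> measurable E ->
  cmeas E (fun p : T * T => log_abel e (f p) p.1).
Proof.
move=> mf ER mE; apply: cmeasM.
  apply: cmeas_real; have m1 : measurable_fun E (fst : T * T -> T) by exact: measurable_fst'.
  exact: (measurableT_comp (@measurable_exp_ln R setT e) m1).
apply: cmeas_cpow; first exact: measurable_fst'.
by apply: cmeasB; [apply: cmeas_Complex => //; exact: measurable_cst|exact: cmeas_cst].
Qed.

Lemma cmeas_cj_chirp_fst : cmeas (@Rplus R `*` D) (fun p : T * T => cj (chirp p.1)).
Proof.
apply: cmeas_cj; apply: (@cmeas_comp _ _ _ _ R (@Rplus R) (@Rplus R `*` D) chirp fst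
  (@measurable_Rplus R) _ _ cmeas_chirp).
  by move=> p [].
exact: measurable_fst'.
Qed.

Lemma log_abelE v x : 0 < x ->
  log_abel e v x = (expR (- (e * `|ln x|)) / x)%:C * cpow x (0 +i* v).
Proof. by move=> x0; rewrite /log_abel (cpowB1 _ x0) mulrA realcM. Qed.

Definition abel_pairing y : R[i] :=
  cintegral (@Rplus R) (fun x => log_abel e (alpha * y) x * cj (chirp x)).

Lemma log_abel_chirp_le v x : @Rplus R x ->
  nrm (log_abel e v x * cj (chirp x)) <= L1norm * (expR (- (e * `|ln x|)) / x).
Proof.
rewrite RplusE => x0; rewrite nrmM nrm_cj (nrm_log_abel e v x0) mulrC.
have r0 : 0 <= expR (- (e * `|ln x|)) / x.
  by apply: mulr_ge0; [exact: expR_ge0|rewrite invr_ge0 ltW].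
by apply: ler_wpM2r => //; exact: chirp_le.
Qed.

Lemma log_abel_chirp_integrable v :
  cintegrable (@Rplus R) (fun x => log_abel e v x * cj (chirp x)).
Proof.
have mR := @measurable_Rplus R.
apply: (cintegrable_le mR _ _ (integrable_realZ L1norm mR (integrable_log_abel e0))).
  by apply: cmeasM; [exact: cmeas_log_abel|exact: cmeas_cj cmeas_chirp].
by move=> x; exact: log_abel_chirp_le.
Qed.

(** In |chirp|^2 = chirp times its conjugate, the first factor is expanded as an integral over y and
    the order of integration is exchanged. *)
Lemma abel_energyE :
  mu.-integrable (@Rplus R) (EFin \o abel_energy_density) /\
  (\int[mu]_(x in @Rplus R) abel_energy_density x)%:C =
  cintegral D (fun y => h y * abel_pairing y).
Proof.
have mR := @measurable_Rplus R.
pose F (x y : T) : R[i] := h y * (log_abel e (alpha * y) x * cj (chirp x)).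
have ia := integrable_realZ L1norm mR (integrable_log_abel e0).
have [||i1 i2 E] := @cfubini R (@Rplus R) D F _ _ mR mD _ ia integrable_nrm_h.
- apply: cmeasM; first exact: cmeas_h_snd.
  apply: cmeasM; last exact: cmeas_cj_chirp_fst.
  apply: (@measurable_log_abel_joint (@Rplus R `*` D) (fun p => alpha * p.2)).
  + by apply: measurable_funM; [exact: measurable_cst|exact: measurable_snd'].
  + by move=> p [].
  + exact: measurableX.
- move=> x y Rx _; rewrite nrmM mulrC; apply: ler_wpM2r; first exact: nrm_ge0.
  exact: log_abel_chirp_le.
have E1 x : @Rplus R x -> cintegral D (F x) = (abel_energy_density x)%:C.
  rewrite RplusE => x0; rewrite /abel_energy_density realcM -mul_cj.
  rewrite mulrA mulrAC; apply: (etrans _ (cintegralZ _ mD (chirp_integrable x0))).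
  by apply: eq_cintegral => y _; rewrite /F (log_abelE _ x0); ring.
have E2 y : cintegral (@Rplus R) (F^~ y) = h y * abel_pairing y.
  exact: (cintegralZ _ mR (log_abel_chirp_integrable _)).
have [j1 _] := eq_cintegrable mR E1 i1; split; first exact: j1.
rewrite -cintegral_real -(eq_cintegral E1) E.
by apply: eq_cintegral => y _; exact: E2.
Qed.

(** Now the conjugate factor is expanded too; the integral over x that remains is the Mellin
    transform of the regularizing factor at i alpha (y - y'), a Poisson kernel. *)
Lemma abel_pairingE y : abel_pairing y =
  cintegral D (fun y' => cj (h y') * (2 * poisson e (alpha * (y - y')))%:C).
Proof.
have mR := @measurable_Rplus R.
pose F (x y' : T) : R[i] := cj (h y') * log_abel e (alpha * (y - y')) x.
have [||i1 i2 E] := @cfubini R (@Rplus R) D F _ _ mR mD _ (integrable_log_abel e0) integrable_nrm_h.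
- apply: cmeasM; first by apply: cmeas_cj; exact: cmeas_h_snd.
  apply: (@measurable_log_abel_joint (@Rplus R `*` D) (fun p => alpha * (y - p.2))).
  + apply: measurable_funM; first exact: measurable_cst.
    by apply: measurable_funB; [exact: measurable_cst|exact: measurable_snd'].
  + by move=> p [].
  + exact: measurableX.
- by move=> x y'; rewrite RplusE => x0 _; rewrite nrmM nrm_cj (nrm_log_abel _ _ x0) mulrC.
transitivity (cintegral (@Rplus R) (fun x => cintegral D (F x))).
  apply: eq_cintegral => x; rewrite RplusE => x0.
  rewrite (cj_cintegral mD (chirp_integrable x0)).
  have ic : cintegrable D (fun y' => cj (h y' * cpow x (0 +i* (alpha * y')))).
    apply: (cintegrable_le mD _ _ integrable_nrm_h).
      by apply: cmeas_cj; exact: cintegrable_cmeas (chirp_integrable x0).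
    by move=> y' _; rewrite nrm_cj nrmM (nrm_cpow_i _ x0) mulr1; exact: lexx.
  apply: (etrans (esym (cintegralZ _ mD ic))); apply: eq_cintegral => y' _.
  rewrite /F cjM cj_cpow !(log_abelE _ x0).
  have -> : cpow x (0 +i* (alpha * (y - y'))) =
      cpow x (0 +i* (alpha * y)) * cpow x (0 -i* (alpha * y')).
    by rewrite -cpowD; congr (cpow x _); apply: complex_eq => /=; ring.
  by ring.
apply: (etrans E); apply: eq_cintegral => y' _.
rewrite -(cintegral_log_abel _ e0).
exact: (cintegralZ _ mR (cintegrable_log_abel _ e0)).
Qed.

Definition pker y y' : R := 2 * poisson e (alpha * (y - y')).

Lemma pker_ge0 y y' : 0 <= pker y y'.
Proof. by apply: mulr_ge0 => //; exact: poisson_ge0. Qed.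

Lemma pkerC y y' : pker y y' = pker y' y.
Proof. by rewrite /pker -poissonN -mulrN opprB. Qed.

Lemma pker_le y y' : pker y y' <= 2 / e.
Proof.
rewrite /pker ler_pM2l// /poisson ler_pdivrMr ?poisson_den_gt0//.
rewrite -ler_pdivrMl ?invr_gt0// invrK -expr2 lerDl; exact: sqr_ge0.
Qed.

Lemma measurable_pker (E : set (T * T)) : measurable_fun E (fun p : T * T => pker p.1 p.2).
Proof.
apply: measurable_funM; first exact: measurable_cst.
have m1 : measurable_fun E (fun p : T * T => alpha * (p.1 - p.2) : T).
  apply: measurable_funM; first exact: measurable_cst.
  by apply: measurable_funB; [exact: measurable_fst'|exact: measurable_snd'].
exact: (measurableT_comp (measurable_poisson e0) m1).
Qed.

(** A dilation turns the kernel into 2/alpha times the Poisson kernel of width e/alpha, whose mass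
    pi does not depend on e. This uniformity is what allows e to tend to 0. *)
Lemma integral_pker y : mu.-integrable D (EFin \o pker y) /\
  \int[mu]_(y' in D) pker y y' <= 2 * pi / alpha.
Proof.
have ea : 0 < e / alpha by rewrite divr_gt0.
have [ip Ip] := integral_poisson y ea.
have E y' : pker y y' = 2 / alpha * poisson (e / alpha) (y' - y).
  rewrite -[y' - y]opprB poissonN /pker /poisson.
  have := poisson_den_gt0 (alpha * (y - y')) e0; rewrite exprMn.
  move: ((y - y') ^+ 2) => q q0; field.
  by rewrite (gt_eqF alpha0) /= [q * _]mulrC gt_eqF.
have ip2 := integrable_realZ (2 / alpha) measurableT ip.
have ipk : mu.-integrable [set: T] (EFin \o pker y).
  by apply: (eq_integrable measurableT _ _ _ ip2) => y' _; rewrite /= E.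
split; first exact: (integrableS measurableT mD (@subsetT _ _) ipk).
apply: le_trans (le_Rintegral_sub mD ipk (pker_ge0 y)) _.
have -> : \int[mu]_y' pker y y' = \int[mu]_y' (2 / alpha * poisson (e / alpha) (y' - y)).
  by apply: eq_Rintegral => y' _; rewrite E.
by rewrite RintegralZl// Ip mulrAC.
Qed.

(* Schur's test for the symmetric kernel [pker]. *)
Lemma abel_energy_le :
  \int[mu]_(x in @Rplus R) abel_energy_density x <= 2 * pi / alpha * L2norm.
Proof.
pose N2 y : R := nrm (h y) ^+ 2.
have C0 : 0 <= 2 * pi / alpha by apply: mulr_ge0; [apply: mulr_ge0 => //; exact: pi_ge0|rewrite invr_ge0 ltW].
have N20 y : 0 <= N2 y by exact: sqr_ge0.
have h2' : mu.-integrable D (EFin \o N2) := h2.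
pose Q y := \int[mu]_(y' in D) (N2 y' * pker y y').
(* The crude bound 2/e of the kernel, integrable since D has finite measure, is used for
   integrability only; it does not enter the final constant. *)
have i1 : mu.-integrable D (EFin \o (fun=> 2 / e : R)).
  apply/integrableP; split; first by apply/measurable_EFinP; exact: measurable_cst.
  under eq_integral do rewrite /=.
  by rewrite integral_cst//; apply: lte_mul_pinfty.
have mN2 : measurable_fun (D `*` D) (fun p : T * T => N2 p.2).
  by apply: measurable_funX; apply: measurable_nrm; exact: cmeas_h_snd.
have [||iQ iQ' EQ] := @rfubini R D D (fun y y' => N2 y' * pker y y') _ _ mD mD _ i1 h2.
- by apply: measurable_funM => //; exact: measurable_pker.
- move=> y y' _ _; rewrite (ger0_norm (mulr_ge0 (N20 _) (pker_ge0 _ _))) mulrC.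
  by apply: ler_wpM2r; [exact: N20|exact: pker_le].
have iNp y : mu.-integrable D (EFin \o (fun y' => N2 y' * pker y y')).
  apply: (le_integrable mD _ _ (integrable_realZ (2 / e) mD h2)).
    apply/measurable_EFinP; apply: measurable_funM.
      by apply/measurable_EFinP; exact: measurable_int h2.
    by apply/measurable_EFinP; exact: measurable_int (integral_pker y).1.
  move=> y' _; rewrite /= lee_fin (ger0_norm (mulr_ge0 (N20 _) (pker_ge0 _ _))).
  by apply: le_trans (ler_norm _); rewrite mulrC; apply: ler_wpM2r; [exact: N20|exact: pker_le].
have QE : \int[mu]_(y in D) Q y <= 2 * pi / alpha * L2norm.
  rewrite EQ -(RintegralZl (2 * pi / alpha) mD h2').
  apply: (le_Rintegral mD iQ' (integrable_realZ _ mD h2')) => y' _.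
  have [ip Ip] := integral_pker y'.
  have -> : \int[mu]_(x in D) (N2 y' * pker x y') = N2 y' * \int[mu]_(x in D) pker y' x.
    by rewrite -(RintegralZl (N2 y') mD ip); apply: eq_Rintegral => x _; rewrite pkerC.
  by rewrite mulrC; apply: ler_wpM2r; [exact: N20|exact: Ip].
(* |h(y) h(y')| is at most half the sum of the squares; after integration in y' the first square
   meets the mass of the kernel and the second gives Q. *)
have bound y : nrm (h y * abel_pairing y) <= 2^-1 * (2 * pi / alpha * N2 y) + 2^-1 * Q y.
  have [ip Ip] := integral_pker y.
  have iNy := integrable_realZ (N2 y) mD ip.
  have iS := integrableD mD iNy (iNp y).
  apply: (@le_trans _ _ (\int[mu]_(y' in D) (2^-1 * (N2 y * pker y y' + N2 y' * pker y y')))).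
    rewrite abel_pairingE.
    have icj : cintegrable D (fun y' => cj (h y') * (pker y y')%:C).
      apply: (cintegrable_le mD _ _ (integrable_realZ (2 / e) mD integrable_nrm_h)).
        apply: cmeasM; first by apply: cmeas_cj; exact: cintegrable_cmeas.
        by apply: cmeas_real; apply/measurable_EFinP; exact: measurable_int ip.
      move=> y' _; rewrite nrmM nrm_cj nrm_real (ger0_norm (pker_ge0 y y')) mulrC.
      by apply: ler_wpM2r; [exact: nrm_ge0|exact: pker_le].
    have -> : h y * cintegral D (fun y' => cj (h y') * (2 * poisson e (alpha * (y - y')))%:C) =
        cintegral D (fun y' => h y * (cj (h y') * (pker y y')%:C)).
      exact: esym (cintegralZ _ mD icj).
    apply: (cintegral_nrm_le mD); first exact: cintegrable_cmeas (cintegrableZ (h y) mD icj).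
      move=> y' _; rewrite (nrmM (h y)) (nrmM (cj (h y'))) nrm_cj nrm_real.
      by rewrite (ger0_norm (pker_ge0 y y')); exact: young_half (pker_ge0 y y').
    exact: (integrable_realZ 2^-1 mD iS).
  rewrite (RintegralZl 2^-1 mD iS) (RintegralD mD iNy (iNp y)) (RintegralZl (N2 y) mD ip).
  rewrite mulrDr lerD2r; apply: ler_wpM2l; first by rewrite invr_ge0.
  by rewrite mulrC; apply: ler_wpM2r; [exact: N20|exact: Ip].
have [iA EA] := abel_energyE.
apply: (@le_trans _ _ (nrm (\int[mu]_(x in @Rplus R) abel_energy_density x)%:C)).
  by rewrite nrm_real ler_norm.
have iB1 := integrable_realZ 2^-1 mD (integrable_realZ (2 * pi / alpha) mD h2).
have iB2 := integrable_realZ 2^-1 mD iQ.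
have iB := integrableD mD iB1 iB2.
rewrite EA; apply: (@le_trans _ _ (\int[mu]_(y in D)
    (2^-1 * (2 * pi / alpha * N2 y) + 2^-1 * Q y))).
  apply: (cintegral_nrm_le mD _ (fun y _ => bound y) iB).
  apply: cmeasM; first exact: cintegrable_cmeas.
  rewrite (_ : abel_pairing = (fun y => cintegral D (fun y' => cj (h y') * (pker y y')%:C)));
    last by apply/funext => y; exact: abel_pairingE.
  apply: (@cmeas_param R D D (fun y y' => cj (h y') * (pker y y')%:C) (fun=> 2 / e)
    (fun y => nrm (h y)) mD mD).
  - apply: cmeasM; first by apply: cmeas_cj; exact: cmeas_h_snd.
    by apply: cmeas_real; exact: measurable_pker.
  - exact: measurable_cst.
  - by move=> y _; apply: mulr_ge0; [exact: ler0n|rewrite invr_ge0; exact: ltW].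
  - exact: integrable_nrm_h.
  - by move=> y _; exact: nrm_ge0.
  - move=> y y' _ _; rewrite nrmM nrm_cj nrm_real (ger0_norm (pker_ge0 y y')) mulrC.
    by apply: ler_wpM2r; [exact: nrm_ge0|exact: pker_le].
rewrite (RintegralD mD iB1 iB2) (RintegralZl 2^-1 mD iQ).
rewrite (RintegralZl 2^-1 mD (integrable_realZ _ mD h2')) (RintegralZl _ mD h2').
rewrite -/L2norm; apply: (@le_trans _ _ (2^-1 * (2 * pi / alpha * L2norm) +
    2^-1 * (2 * pi / alpha * L2norm))); last by rewrite -mulrDl -div1r -splitr mul1r.
by rewrite lerD2l; apply: ler_wpM2l; [rewrite invr_ge0|exact: QE].
Qed.

End regularized.

(** For e = 1/(n + 1) the regularizing factors increase to 1, and the bound of [abel_energy_le] is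
    uniform in e, so monotone convergence removes the regularization. *)
Lemma Bessel_chirp :
  (\int[mu]_(x in @Rplus R) (nrm (chirp x) ^+ 2 / x)%:E <= (2 * pi / alpha * L2norm)%:E)%E.
Proof.
have mR := @measurable_Rplus R.
pose e n : R := n.+1%:R^-1; have e0 n : 0 < e n by rewrite invr_gt0 ltr0n.
pose g n x := (abel_energy_density (e n) x)%:E.
have xi x : @Rplus R x -> 0 <= x^-1 by rewrite RplusE => x0; rewrite invr_ge0 ltW.
have g0 n x : @Rplus R x -> (0 <= g n x)%E.
  move=> Rx; rewrite lee_fin; apply: mulr_ge0; last exact: sqr_ge0.
  by apply: mulr_ge0; [exact: expR_ge0|exact: xi].
have mg n : measurable_fun (@Rplus R : set T) (g n).
  exact: measurable_int (abel_energyE (e0 n)).1.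
have ndg x : @Rplus R x -> nondecreasing_seq (g^~ x).
  move=> Rx; apply/nondecreasing_seqP => n; rewrite lee_fin.
  apply: ler_wpM2r; first exact: sqr_ge0.
  apply: ler_wpM2r; first exact: xi.
  rewrite ler_expR lerN2; apply: ler_wpM2r => //.
  by rewrite lef_pV2 ?posrE ?ltr0n// ler_nat.
have cg x : g n x @[n --> \oo] --> (nrm (chirp x) ^+ 2 / x)%:E.
  have c1 : - (e n * `|ln x|) @[n --> \oo] --> (0 : R).
    rewrite -[0]oppr0 -(mul0r `|ln x|); apply: cvgN; apply: cvgM; last exact: cvg_cst.
    exact: cvg_harmonic.
  have c2 : expR (- (e n * `|ln x|)) @[n --> \oo] --> (1 : R).
    by rewrite -expR0; apply: continuous_cvg => //; exact: continuous_expR.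
  have c3 : abel_energy_density (e n) x @[n --> \oo] --> nrm (chirp x) ^+ 2 / x.
    rewrite [X in _ --> X]mulrC -[x^-1]mul1r.
    by apply: cvgM; [apply: cvgM => //; exact: cvg_cst|exact: cvg_cst].
  by apply: cvg_EFin c3; exact: nearW.
have cI := cvg_monotone_convergence mR mg g0 ndg.
have E x : x \in (@Rplus R : set T) -> limn (g^~ x) = (nrm (chirp x) ^+ 2 / x)%:E.
  by move=> _; exact/cvg_lim.
have le0 : (\int[mu]_(x in @Rplus R) (nrm (chirp x) ^+ 2 / x)%:E <=
    \int[mu]_(x in @Rplus R) limn (g^~ x))%E.
  rewrite le_eqVlt; apply/orP; left; apply/eqP.
  by apply: eq_integral => x Rx; rewrite (E _ Rx).
apply: (le_trans le0);  apply: (cvge_to_le (cI mu)); apply: nearW => n.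
have [iA _] := abel_energyE (e0 n).
rewrite -(fineK (integrable_fin_num mR iA)) lee_fin.
exact: abel_energy_le.
Qed.

End Bessel.

(** * Completeness of weighted L_2 spaces *)

Section L2_completeness.
Variable R : realType.
Local Notation mu := (@lebesgue_measure R).
Local Notation T := (measurableTypeR R).
Implicit Types (x t s e : R).

(** The telescoping series of the increments is compared with a geometric series of ratio 1/2. *)
Lemma geometric_increments_cvg (u : nat -> R) (B : R) : 0 <= B ->
  (forall k, `|u k.+1 - u k| <= B * 2^-1 ^+ k) -> cvgn u.
Proof.
move=> B0 Hu; rewrite (_ : u = (fun n => u 0%N + series (telescope u) n)); last first.
  by apply/funext => n; exact: eq_sum_telescope.
apply: is_cvgD; first exact: is_cvg_cst.
apply: normed_cvg; apply: (@series_le_cvg _ _ (geometric B 2^-1)).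
- by move=> n; exact: normr_ge0.
- by move=> n; apply: mulr_ge0 => //; apply: exprn_ge0; rewrite invr_ge0.
- by move=> n; exact: Hu.
- by apply: is_cvg_geometric_series; rewrite gtr0_norm ?invr_gt0// invf_lt1 ?ltr1n.
Qed.

Lemma limn_einf_le (u : nat -> \bar R) (B : \bar R) : (forall n, (u n <= B)%E) ->
  (limn_einf u <= B)%E.
Proof.
move=> uB; rewrite limn_einf_lim; apply: lime_le; first exact: is_cvg_einfs.
apply: nearW => n; apply: le_trans (uB n).
by apply: ereal_inf_lbound; exists n => /=.
Qed.

Lemma limn_einf_ge0 (u : nat -> \bar R) : (forall n, (0 <= u n)%E) ->
  (0 <= limn_einf u)%E.
Proof.
move=> u0; rewrite limn_einf_lim; apply: lime_ge; first exact: is_cvg_einfs.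
by apply: nearW => n; apply: le_ereal_inf_tmp => _ [m _ <-].
Qed.

Lemma ccvg_nrm_sub (a : nat -> R[i]) (l z : R[i]) : nrm (a n - l) @[n --> \oo] --> 0 ->
  nrm (z - a n) @[n --> \oo] --> nrm (z - l).
Proof.
move=> al; apply/cvgrPdist_le => e e0; move/cvgrPdist_le : al => /(_ _ e0).
apply: filterS => n; rewrite sub0r normrN ger0_norm ?nrm_ge0//; apply: le_trans.
have h1 := nrmD (z - a n) (a n - l); have h2 := nrmD (z - l) (- (a n - l)).
rewrite addrA subrK in h1; rewrite nrmN opprB addrA subrK in h2.
by rewrite ler_norml; apply/andP; split; lra.
Qed.

Variables (D : set T) (w : T -> R) (F : R -> T -> R[i]) (r : R -> R) (t0 : R).
Hypotheses (mD : measurable D) (mw : measurable_fun D w) (w0 : forall x, D x -> 0 < w x)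
  (mF : forall t, cmeas D (F t)) (r0 : r t @[t --> +oo] --> 0)
  (Fr : forall s t, (sqnorm D w (fun x => F s x - F t x)%R <= (r s + r t)%:E)%E)
  (F0 : forall x, D x -> F t0 x = 0).

(** The factor 4^{-k} compensates the weight 4^k put on the increments, and 2^{-(k + 2)} makes 4^k
    (delta k + delta k) = 2^{-(k + 1)} summable. *)
Let delta k : R := 4^-1 ^+ k / (2 ^ (k + 2))%:R.

Let delta_gt0 k : 0 < delta k.
Proof. by rewrite divr_gt0 ?exprn_gt0 ?invr_gt0// ltr0n expn_gt0. Qed.

Let cvg_delta : delta k @[k --> \oo] --> 0.
Proof.
apply: (@squeeze_cvgr _ _ _ _ (fun=> 0) (fun k => (4^-1 : R) ^+ k)).
- apply: nearW => k; rewrite ltW//= ler_piMr ?exprn_ge0 ?invr_ge0//.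
  by rewrite invf_le1 ?ltr0n ?expn_gt0// ler1n expn_gt0.
- exact: cvg_cst.
- by apply: cvg_expr; rewrite gtr0_norm ?invr_gt0// invf_lt1 ?ltr1n.
Qed.

Let density f x : \bar R := (w x * nrm (f x) ^+ 2)%:E.

Let density_ge0 f x : D x -> (0 <= density f x)%E.
Proof. by move=> Dx; rewrite lee_fin; apply: mulr_ge0; [exact: ltW (w0 Dx)|exact: sqr_ge0]. Qed.

Let measurable_density f : cmeas D f -> measurable_fun D (density f).
Proof.
move=> mf; apply/measurable_EFinP; apply: measurable_funM => //.
by apply: measurable_funX; exact: measurable_nrm.
Qed.

(* Along the times [Tn k] the factor [4 ^+ k] makes the increments geometrically
   small almost everywhere; Fatou's lemma then controls the whole family. *)
Lemma L2_complete : exists g, mean_square_limit D w F g.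
Proof.
have /choice[Tn rTn] k : exists t, `|r t| <= delta k.
  move/cvgrPdist_le : r0 => /(_ _ (delta_gt0 k)) [A [_ HA]]; exists (A + 1).
  by have := HA (A + 1); rewrite ltrDl ltr01 sub0r normrN; exact.
pose u k x := F (Tn k) x; pose d k := density (fun x => u k.+1 x - u k x).
have mu_ k : cmeas D (u k) by exact: mF.
have md k : measurable_fun D (d k) by apply: measurable_density; exact: cmeasB.
pose S x := (\sum_(k <oo) ((4 ^+ k)%:E * d k x))%E.
have d0 k x : D x -> (0 <= (4 ^+ k)%:E * d k x)%E.
  by move=> Dx; apply: mule_ge0; [rewrite lee_fin exprn_ge0|exact: density_ge0].
have md4 k : measurable_fun D (fun x => ((4 ^+ k)%:E * d k x)%E).
  by apply: emeasurable_funM => //; exact: measurable_cst.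
have mS : measurable_fun D S.
  by apply: (ge0_emeasurable_sum (P := xpredT)) => [k x Dx _|k _]; [exact: d0|exact: md4].
have S0 x : D x -> (0 <= S x)%E by move=> Dx; apply: nneseries_ge0 => k _ _; exact: d0.
have iS : mu.-integrable D S.
  apply/integrableP; split => //.
  rewrite (@eq_integral _ T R mu D S); last by move=> x; rewrite inE => Dx; rewrite gee0_abs// S0.
  rewrite integral_nneseries//.
  have h : (\sum_(k <oo) \int[mu]_(x in D) ((4 ^+ k)%:E * d k x) <=
      \sum_(k <oo) (1 / (2 ^ (k + 1))%:R)%:E)%E.
    apply: lee_nneseries => [k _ _|k _]; first by apply: integral_ge0 => x Dx; exact: d0.
    rewrite ge0_integralZl//; last by move=> x Dx; exact: density_ge0.
    apply: (@le_trans _ _ ((4 ^+ k)%:E * (delta k + delta k)%:E)%E).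
      apply: lee_wpmul2l; first by rewrite lee_fin exprn_ge0.
      apply: le_trans (Fr (Tn k.+1) (Tn k)) _; rewrite lee_fin; apply: lerD.
        apply: le_trans (ler_norm _) (le_trans (rTn _) _).
        apply: ler_pM; rewrite ?exprn_ge0 ?invr_ge0//.
          by rewrite exprS ler_piMl ?exprn_ge0 ?invr_ge0// invf_le1 ?ler1n.
        by rewrite lef_pV2 ?posrE ?ltr0n ?expn_gt0// ler_nat leq_exp2l// addSn.
      exact: le_trans (ler_norm _) (rTn _).
    rewrite -EFinM lee_fin /delta exprVn.
    have -> : (2 ^ (k + 2))%:R = 2 * (2 ^ (k + 1))%:R :> R by rewrite -natrM -expnS addnS.
    have q0 : (4 : R) ^+ k != 0 by rewrite expf_neq0// pnatr_eq0.
    have p0 : (2 ^ (k + 1))%:R != 0 :> R by rewrite pnatr_eq0 -lt0n expn_gt0.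
    move: (4 ^+ k) (2 ^ (k + 1))%:R q0 p0 => q p q0 p0.
    by rewrite le_eqVlt; apply/orP; left; apply/eqP; field; rewrite q0 p0.
  apply: (le_lt_trans h); have /cvg_lim := @cvg_geometric_eseries_half R 1 0.
  by move=> ->//; rewrite ltry.
(* Upper limits are measurable, and limits almost everywhere. *)
pose g x : R[i] := fine (limn_esup (fun k => (Cre (u k x))%:E)) +i*
  fine (limn_esup (fun k => (Cim (u k x))%:E)).
have mg : cmeas D g.
  apply: cmeas_Complex; apply: (measurableT_comp (@fine_measurable R setT measurableT));
    apply: measurable_fun_limn_esup => k; apply/measurable_EFinP.
    exact: (mu_ k).1.
  exact: (mu_ k).2.
have cvg_u x : D x -> S x \is a fin_num -> nrm (u k x - g x) @[k --> \oo] --> 0.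
  (* The squared increments multiplied by 4^k are at most S(x)/w(x) <= B <= B^2, so the increments
     are at most B 2^{-k}; the 1 in B ensures B <= B^2. *)
  move=> Dx Sx; pose B := 1 + fine (S x) / w x.
  have wx := w0 Dx; have M0 : 0 <= fine (S x) by apply: fine_ge0; exact: S0.
  have B1 : 1 <= B by rewrite lerDl divr_ge0// ltW.
  have inc k : nrm (u k.+1 x - u k x) <= B * 2^-1 ^+ k.
    have : ((4 ^+ k)%:E * d k x <= S x)%E.
      have hk : ((4 ^+ k)%:E * d k x <= \sum_(0 <= i < k.+1) ((4 ^+ i)%:E * d i x))%E.
        by rewrite big_nat_recr//= leeDr// sume_ge0// => i _; exact: d0.
      by apply: (le_trans hk); apply: nneseries_lim_ge => i _ _; exact: d0.
    rewrite -(fineK Sx) -EFinM lee_fin => hk.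
    rewrite exprVn ler_pdivlMr ?exprn_gt0// -(@ler_pXn2r _ 2)// ?nnegrE; last 2 first.
      by rewrite mulr_ge0 ?nrm_ge0 ?exprn_ge0.
      exact: le_trans ler01 B1.
    have h2 : (nrm (u k.+1 x - u k x) * 2 ^+ k) ^+ 2 <= fine (S x) / w x.
      rewrite ler_pdivlMr//; apply: le_trans hk.
      rewrite exprMn -exprM mulnC exprM (_ : 2 ^+ 2 = 4 :> R); last by rewrite expr2; ring.
      have E (a b c : R) : a * b * c = b * (c * a) by ring.
      by rewrite E.
    apply: le_trans h2 _; apply: (@le_trans _ _ B); first by rewrite lerDr.
    by rewrite expr2 ler_peMl// (le_trans ler01 B1).
  have cu (p : R[i] -> R) : (forall z v, p (z - v) = p z - p v) ->
      (forall z, `|p z| <= nrm z) ->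
      p (u k x) @[k --> \oo] --> fine (limn_esup (fun k => (p (u k x))%:E)).
    move=> pB ple; have cp : cvgn (fun k => p (u k x)).
      apply: (geometric_increments_cvg (le_trans ler01 B1)) => k.
      by rewrite -pB; apply: le_trans (ple _) (inc k).
    have E := EFin_lim cp.
    have cE : cvgn (EFin \o (fun k => p (u k x))).
      by apply/cvg_ex; exists (limn (fun k => p (u k x)))%:E; apply: cvg_EFin => //; exact: nearW.
    by rewrite (is_cvg_limn_esupE cE) E.
  have c1 := cu _ (fun z v => etrans (ReD z (- v)) (congr1 _ (ReN v))) (@le_Re_nrm R).
  have c2 := cu _ (fun z v => etrans (ImD z (- v)) (congr1 _ (ImN v))) (@le_Im_nrm R).
  exact: (@ccvg_of_ReIm R (fun k => u k x) (g x) c1 c2).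
(* Fatou's lemma along the subsequence bounds the distance from [F t] to the limit; the shift by
   [k0] makes the term r(Tn) at most e. *)
have key t e : 0 < e -> (sqnorm D w (fun x => F t x - g x)%R <= (r t + e)%:E)%E.
  move=> e0; move/cvgrPdist_le : cvg_delta => /(_ _ e0) [k0 _ Hk0].
  pose f k := density (fun x => F t x - u (k + k0)%N x).
  have mf k : measurable_fun D (f k) by apply: measurable_density; exact: cmeasB.
  have f0 k x : D x -> (0 <= f k x)%E by exact: density_ge0.
  have FT := fatou mu mD mf f0.
  apply: (@le_trans _ _ (\int[mu]_(x in D) limn_einf (f^~ x))%E).
    rewrite le_eqVlt; apply/orP; left; apply/eqP; apply: ge0_ae_eq_integral => //.
    - exact: (measurable_density (cmeasB (mF t) mg)).
    - apply: (@emeasurable_fun_cvg _ _ _ _ (fun n x => einfs (f^~ x) n)).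
        exact: measurable_fun_einfs.
      by move=> x _; rewrite limn_einf_lim; exact: is_cvg_einfs.
    - exact: (@density_ge0 (fun x => F t x - g x)).
    - by move=> x Dx; apply: limn_einf_ge0 => k; exact: f0.
    have ae := integrable_ae mD iS; apply: filterS ae => x Sx Dx.
    have c1 := cvg_u x Dx (Sx Dx).
    apply/esym; have cf : f k x @[k --> \oo] --> density (fun x => F t x - g x) x.
      apply: cvg_EFin; first exact: nearW.
      apply: cvgM; first exact: cvg_cst.
      have c2 : nrm (F t x - u (k + k0)%N x) @[k --> \oo] --> nrm (F t x - g x).
        by apply: ccvg_nrm_sub; move: c1; rewrite -(cvg_shiftn k0).
      by rewrite expr2; apply: cvgM.
    by rewrite is_cvg_limn_einfE ?(cvg_lim _ cf)//; apply/cvg_ex; eexists; exact: cf.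
  apply: (le_trans FT); apply: limn_einf_le => k.
  apply: (le_trans (Fr t (Tn (k + k0)%N))); rewrite lee_fin lerD2l.
  apply: le_trans (ler_norm _) (le_trans (rTn _) _).
  have := Hk0 (k + k0)%N; rewrite /= leq_addl sub0r normrN => /(_ isT).
  by rewrite gtr0_norm.
exists g; split.
  split; first exact: mg.
  (* As [F t0] vanishes on D, the squared norm of g is its squared distance to [F t0]. *)
  apply: (@le_lt_trans _ _ (r t0 + 1)%:E); last exact: ltry.
  apply: le_trans (key t0 1 ltr01); rewrite le_eqVlt; apply/orP; left; apply/eqP.
  by apply: eq_integral => x; rewrite inE => Dx; rewrite F0// sub0r nrmN.
have fin t : sqnorm D w (fun x => F t x - g x) \is a fin_num.
  rewrite ge0_fin_numE; first exact: le_lt_trans (key t 1 ltr01) (ltry _).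
  by apply: integral_ge0; exact: (@density_ge0 (fun x => F t x - g x)).
apply/fine_cvgP; split; first exact: nearW.
apply/cvgrPdist_le => e e0; have e2 : 0 < e / 2 by rewrite divr_gt0.
move/cvgrPdist_le : r0 => /(_ _ e2); apply: filterS => t.
rewrite !sub0r !normrN => rt; rewrite ger0_norm; last first.
  by apply: fine_ge0; apply: integral_ge0; exact: (@density_ge0 (fun x => F t x - g x)).
rewrite -lee_fin fineK//; apply: le_trans (key t _ e2) _.
by rewrite lee_fin [leRHS]splitr lerD2r; exact: le_trans (ler_norm _) rt.
Qed.

End L2_completeness.

(** * Existence of the transform *)

Section existence.
Variable R : realType.
Local Notation mu := (@lebesgue_measure R).
Local Notation T := (measurableTypeR R).
Implicit Types (D E : set T) (x y s t : R) (f h : T -> R[i]) (fs : R[i] -> R[i]).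

Lemma in_L2_le h f (C : R) : in_L2 [set: T] (fun=> 1) h -> cmeas [set: T] f ->
  (forall y, nrm (f y) <= C * nrm (h y)) -> in_L2 [set: T] (fun=> 1) f.
Proof.
move=> h2 mf fh; split => //.
have m1 : measurable_fun [set: T] (fun=> 1 : R) by exact: measurable_cst.
have i2 := in_L2_integrable measurableT m1 (fun _ _ => ler01) h2.
have i3 := integrable_realZ (C ^+ 2) measurableT i2.
have /integrableP[_ foo] := i3; apply: le_lt_trans foo.
apply: ge0_le_integral => //.
- by move=> y _; rewrite lee_fin mul1r sqr_ge0.
- apply/measurable_EFinP; apply: measurable_funM => //; apply: measurable_funX.
  exact: measurable_nrm.
- by apply: measurableT_comp => //; exact: measurable_int i3.
move=> y _; rewrite lee_fin /=; apply: le_trans (ler_norm _).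
rewrite !mul1r -exprMn ler_pXn2r ?nnegrE ?nrm_ge0 ?fh//.
exact: le_trans (nrm_ge0 _) (fh y).
Qed.

Lemma Rintegral_setD D E (f : T -> R) : measurable D -> measurable E -> E `<=` D ->
  mu.-integrable D (EFin \o f) ->
  \int[mu]_(x in D `\` E) f x = \int[mu]_(x in D) f x - \int[mu]_(x in E) f x.
Proof.
move=> mD mE ED fi; have UE : D = E `|` (D `\` E) by rewrite setDUK.
rewrite [in X in _ = X - _]UE Rintegral_setU -?UE//; first by rewrite addrC addKr.
- exact: measurableD.
- by apply/eqP/seteqP; split => // x [/= Ex []].
Qed.

Lemma cintegral_setD D E f : measurable D -> measurable E -> E `<=` D -> cintegrable D f ->
  cintegral (D `\` E) f = cintegral D f - cintegral E f.
Proof.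
move=> mD mE ED [i1 i2]; apply: complex_eq; rewrite ?ReD ?ImD ?ReN ?ImN /=;
  exact: Rintegral_setD.
Qed.

Section contour.
Variables (alpha gamma : R) (h : T -> R[i]).
Hypotheses (alpha0 : 0 < alpha)
  (h2 : in_L2 [set: T] (fun=> 1) h).

Let I t : set T := `[- t, t]%classic.
Let mI t : measurable (I t). Proof. exact: measurable_itv. Qed.

Let w x : R := x `^ (1 - 2 * alpha * gamma).

Let integrable_sqr : mu.-integrable [set: T] (EFin \o (fun y => nrm (h y) ^+ 2)).
Proof.
have m1 : measurable_fun [set: T] (fun=> 1 : R) by exact: measurable_cst.
have i2 := in_L2_integrable measurableT m1 (fun _ _ => ler01) h2.
by apply: (eq_integrable measurableT _ _ _ i2) => y _; rewrite /= mul1r.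
Qed.

Lemma contour_chirp D x : measurable D -> cintegrable D h -> 0 < x ->
  contour_integral alpha gamma D h x = (x `^ (alpha * gamma - 1))%:C * chirp alpha D h x.
Proof.
move=> mD ih x0; apply: (etrans _ (cintegralZ _ mD (chirp_integrable alpha mD ih x0))).
apply: eq_cintegral => y _.
have -> : alpha%:C * (gamma +i* y) - 1 = (alpha * gamma - 1)%:C + (0 +i* (alpha * y)) :> R[i].
  by apply: complex_eq => /=; ring.
by rewrite cpowD (cpow_real _ x0) mulrCA.
Qed.

(** The weight x^{1 - 2 alpha gamma} times the square of x^{alpha gamma - 1} is 1/x, so the mean
    square norm of G_alpha is exactly the norm in the Bessel inequality. *)
Lemma Bessel_contour D t : measurable D -> D `<=` I t ->
  (sqnorm (@Rplus R) w (contour_integral alpha gamma D h) <=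
   (2 * pi / alpha * L2norm D h)%:E)%E.
Proof.
move=> mD DI; have ih := cintegrable_sub (mI t) mD DI (in_L2_integrable_itv _ _ h2).
have h2D := integrableS measurableT mD (@subsetT _ _) integrable_sqr.
have Doo : (mu D < +oo)%E.
  by apply: le_lt_trans (lebesgue_itv_lty (- t) t); apply: le_measure => //; rewrite inE.
apply: le_trans (Bessel_chirp alpha0 mD ih h2D Doo).
rewrite le_eqVlt; apply/orP; left; apply/eqP; apply: eq_integral => x.
rewrite inE RplusE => x0; rewrite (contour_chirp mD ih x0) nrmM nrm_real.
rewrite ger0_norm ?powR_ge0// exprMn mulrA mulrC; congr (_ * _)%:E.
rewrite -powR_mulrn ?powR_ge0// -powRrM -powRD ?(gt_eqF x0) ?implybT//.
have -> : 1 - 2 * alpha * gamma + (alpha * gamma - 1) * 2 = -1 by ring.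
by rewrite powR_inv1// ltW.
Qed.

Let V t := L2norm (I t) h.
Let N := \int[mu]_y (nrm (h y) ^+ 2).

Let I_sub s t : s <= t -> I s `<=` I t.
Proof.
move=> st y; rewrite /I /= !in_itv/= => /andP[h1 h3].
by apply/andP; split; lra.
Qed.

Let V_le s t : s <= t -> V s <= V t.
Proof.
move=> st; have it := integrableS measurableT (mI t) (@subsetT _ _) integrable_sqr.
rewrite -subr_ge0 /V /L2norm -Rintegral_setD//; last exact: I_sub.
by apply: Rintegral_ge0 => y _; exact: sqr_ge0.
Qed.

Let V_leN t : V t <= N.
Proof. by apply: le_Rintegral_sub => // y; exact: sqr_ge0. Qed.

(** The Bessel constant times the squared norm of h outside [-t, t]. *)
Let r t := 2 * pi / alpha * (N - V t).

Let C0 : 0 < 2 * pi / alpha.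
Proof. by rewrite divr_gt0// mulr_gt0// pi_gt0. Qed.

Let cvg_r : r t @[t --> +oo] --> 0.
Proof.
rewrite -[0](mulr0 (2 * pi / alpha)); apply: cvgM; first exact: cvg_cst.
have cV := cvg_integral_exhaust (fun n => mI n.+1%:R) (@line_nd R) (@line_bigcup R) integrable_sqr.
apply/cvgrPdist_le => e e0; move/cvgrPdist_le : cV => /(_ _ e0) [n _ Hn].
have := Hn n (leqnn n); rewrite /= => VN.
(* Monotonicity of [V] extends the limit along the integers to real t. *)
near=> t; have tn : n.+1%:R <= t by near: t; apply: nbhs_pinfty_ge; rewrite num_real.
rewrite sub0r normrN ger0_norm ?subr_ge0//.
apply: le_trans (le_trans _ (ler_norm _)) VN.
by rewrite lerD2l lerN2; exact: V_le tn.
Unshelve. all: by end_near. Qed.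

Let G t := contour_integral alpha gamma (I t) h.

(** For s <= t the difference is, up to sign, the contour integral over the part of [-t, t] outside
    [-s, s], whose Bessel bound is r(s) - r(t). *)
Let G_dist s t : (sqnorm (@Rplus R) w (fun x => G s x - G t x)%R <= (r s + r t)%:E)%E.
Proof.
wlog st : s t / s <= t.
  move=> H; have [/H//|ts] := leP s t; rewrite addrC; apply: le_trans (H _ _ (ltW ts)).
  rewrite le_eqVlt; apply/orP; left; apply/eqP; apply: eq_integral => x _.
  by rewrite -opprB nrmN.
have mD : measurable (I t `\` I s) by exact: measurableD.
have B := Bessel_contour mD (@subDsetl _ (I t) (I s)).
apply: le_trans (le_trans _ B) _.
  rewrite le_eqVlt; apply/orP; left; apply/eqP; apply: eq_integral => x.
  rewrite inE RplusE => x0; congr ((_ * _ ^+ 2)%:E).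
  rewrite -nrmN opprB; congr nrm; apply: esym; apply: cintegral_setD => //; first exact: I_sub.
  by apply: contour_integrable => //; exact: in_L2_integrable_itv.
rewrite lee_fin /r -mulrDr; apply: ler_wpM2l; first exact: ltW.
have it := integrableS measurableT (mI t) (@subsetT _ _) integrable_sqr.
rewrite /L2norm Rintegral_setD//; last exact: I_sub.
have := V_leN t; rewrite /V /L2norm; lra.
Qed.

Lemma contour_mean_square :
  exists g, mean_square_limit (@Rplus R) w (fun t => contour_integral alpha gamma `[- t, t] h) g.
Proof.
apply: (@L2_complete R (@Rplus R) w G r (-1) (@measurable_Rplus R)).
- exact: measurable_powR'.
- by move=> x; rewrite RplusE => x0; exact: powR_gt0.
- by move=> t; apply: cmeas_contour_integral => //; exact: in_L2_integrable_itv.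
- exact: cvg_r.
- exact: G_dist.
(* At [t = -1] the contour is empty. *)
- move=> x _; have I0 : I (-1) = set0.
    by apply/seteqP; split => // y; rewrite /I /= in_itv/= => /andP[]; lra.
  by rewrite /G I0; apply: complex_eq; rewrite /= Rintegral_set0.
Qed.

End contour.

(** The factor 1/(2 pi) is moved into the density, so that [contour_mean_square] gives the limit of
    the truncated integrals of G_alpha themselves. *)
Lemma G_mean_square_exists alpha gamma f fs : 0 < alpha -> 0 < gamma ->
  is_mellin gamma f fs ->
  vline_L2 gamma (fun z => Gamma_ratio alpha z * fs (1 - z)) ->
  exists g, is_G alpha gamma f g.
Proof.
move=> alpha0 gamma0 ff hL2; have mR := @measurable_Rplus R.
pose h0 (y : T) : R[i] := Gamma_ratio alpha (gamma +i* y) * fs (1 - (gamma +i* y)).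
pose h (y : T) : R[i] := ((2 * pi)^-1)%:C * h0 y.
have h2 : in_L2 [set: T] (fun=> 1) h.
  apply: (in_L2_le (C := `|(2 * pi)^-1|) hL2).
    by apply: cmeasM; [exact: cmeas_cst|exact: hL2.1].
  by move=> y; rewrite {1}/h (nrmM _ (h0 y)) nrm_real; exact: lexx.
have [g [g2 lim]] := contour_mean_square gamma alpha0 h2.
exists g; apply: Or33; exists fs; split => //; split => //.
rewrite (_ : (fun t => _) = (fun t => sqnorm (@Rplus R) (fun x => x `^ (1 - 2 * alpha * gamma))
  (fun x => contour_integral alpha gamma `[- t, t] h x - g x)))//.
apply/funext => t; apply: eq_integral => x; rewrite inE RplusE => x0.
congr ((_ * nrm (_ - _) ^+ 2)%:E); rewrite G_mellin_contour.
have mI : measurable (`[- t, t]%classic : set T) by exact: measurable_itv.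
have ih0 := in_L2_integrable_itv (- t) t (hL2 : in_L2 [set: T] (fun=> 1) h0).
have ic := contour_integrable alpha gamma mI ih0 x0.
apply: (etrans (esym (cintegralZ _ mI ic))); apply: eq_cintegral => y _.
exact: mulrA.
Qed.

Lemma vline_L2_Gamma_ratio alpha gamma fs : 0 < alpha -> 0 < gamma -> alpha <= 1 ->
  vline_L2 gamma (fun z => fs (1 - z)) ->
  vline_L2 gamma (fun z => Gamma_ratio alpha z * fs (1 - z)).
Proof.
move=> alpha0 gamma0 a1 hL2; apply: (in_L2_le (C := ratio_cst alpha gamma) hL2).
  by apply: cmeasM; [exact: cmeas_Gamma_ratio_line|exact: hL2.1].
move=> y; rewrite nrmM; apply: ler_wpM2r; first exact: nrm_ge0.
exact: Gamma_ratio_le.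
Qed.

End existence.

Theorem theorem4 (R : realType) (alpha gamma : R) (f : R -> R[i])
    (alpha_gt0 : 0 < alpha) (gamma_gt0 : 0 < gamma)
    (hyp : [\/ alpha < 1 /\ in_L1 (@Rplus R) (fun x => x `^ (- gamma)) f,
               alpha <= 1 /\
               (exists fs : R[i] -> R[i], is_mellin gamma f fs /\
                  vline_L2 gamma (fun s => fs (1 - s))),
               (exists fs : R[i] -> R[i], is_mellin gamma f fs /\
                  vline_L1 gamma (fun s => Gamma_ratio alpha s * fs (1 - s)))
             | (exists fs : R[i] -> R[i], is_mellin gamma f fs /\
                  vline_L2 gamma (fun s => Gamma_ratio alpha s * fs (1 - s)))]) :
  (exists g : R -> R[i], is_G alpha gamma f g) /\
  (forall g : R -> R[i], is_G alpha gamma f g -> forall tau : R,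
     [/\ cintegrable (@Rplus R) (fun x => K alpha (0 +i* tau) x%:C * f x),
         cintegrable (@Rplus R) (fun x => K 1 (0 +i* tau) x%:C * g x)
       & FKL alpha f tau = FKL 1 g tau]).
Proof.
split; last first.
  by move=> g Gg tau; exact: (is_G_represents alpha_gt0 gamma_gt0 Gg tau).
case: hyp => [[a1 f1]|[a1 [fs [ff h2]]]|[fs [ff h1]]|[fs [ff h2]]].
- exists (G_kernel alpha gamma f); apply: Or31; split => //.
  by rewrite alpha_gt0.
(* For alpha <= 1 the quotient is bounded, which reduces this case to the square integrable one. *)
- apply: (G_mean_square_exists alpha_gt0 gamma_gt0 ff).
  exact: vline_L2_Gamma_ratio.
- by exists (G_mellin_on alpha gamma [set: R] fs); apply: Or32; exists fs; split.
- exact: (G_mean_square_exists alpha_gt0 gamma_gt0 ff h2).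
Qed.
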